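(* Let $N\ge 1$ be an integer, $\alpha>0$ and $\sigma>0$. Let $z\in C^{2}(\mathbb{R}^{N})$ be the positive convex solution, constructed as described in the context, of $$-2\sigma^{2}\Delta z+|\nabla z|^{2}+4\alpha z=4|x|^{2},\qquad x\in\mathbb{R}^{N}.$$ Let $p^{*}=(p_1^{*},\dots,p_N^{*})$ be the feedback control $$p_i^{*}(t)=-\frac12\,\frac{\partial z}{\partial x_i}\big(y_1^{*}(t),\dots,y_N^{*}(t)\big),\qquad i=1,\dots,N,$$ where $y^{*}=(y_1^{*},\dots,y_N^{*})$ is the corresponding inventory level, i.e. $$dy_i^{*}(t)=p_i^{*}(t)\,dt+\sigma\,dw_i(t),\qquad y_i^{*}(0)=x_i,\qquad i=1,\dots,N,$$ with initial level $x=(x_1,\dots,x_N)\in\mathbb{R}^{N}$. Then the control $p^{*}$ is optimal for the stochastic production planning problem of minimizing $J(p_1,\dots,p_N)$ over the acceptable production rates: $J(p_1^{*},\dots,p_N^{*})\le J(p_1,\dots,p_N)$ for every acceptable production rate $p=(p_1,\dots,p_N)$ with the same initial inventory level $x$.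
   Context: $|\cdot|$ is the Euclidean norm on $\mathbb{R}^{N}$. Control problem: $w=(w_1,\dots,w_N)$ is an $N$-dimensional Brownian motion on a complete probability space $(\Omega,\mathcal F,P)$ endowed with the completed natural filtration generated by $w$. A factory produces $N$ goods; $p(t)=(p_1(t),\dots,p_N(t))$, $t\ge 0$, is the production rate (control; a deviation from the factory-optimal level, so it may be negative), and $y(t)=(y_1(t),\dots,y_N(t))$ is the inventory level (state), governed by $$dy_i(t)=p_i(t)\,dt+\sigma\,dw_i(t),\qquad y_i(0)=x_i,\qquad i=1,\dots,N.$$ Here $\sigma>0$ is the diffusion coefficient and $\alpha>0$ the discount rate. The cost is $$J(p_1,\dots,p_N)=E\int_0^\infty\big(|p(t)|^{2}+|y(t)|^{2}\big)e^{-\alpha t}\,dt.$$ A production rate is called acceptable if $J(p_1,\dots,p_N)<\infty$ and the transversality condition $\lim_{t\to\infty}E\,e^{-\alpha t}|y(t)|^{2}=0$ holds. The system for $y^{*}$ is solved in the weak sense. The function $z$: $z=-2\sigma^{2}\ln u$, where $u\in C^{2}(\mathbb{R}^{N})$ solves $-\Delta u+\frac{1}{\sigma^{4}}|x|^{2}u=-\frac{2\alpha}{\sigma^{2}}u\ln u$ on $\mathbb{R}^{N}$ with $\underline u\le u\le 1$, $\underline u(x)=\exp\!\big(-\frac{|x|^{2}}{2\sigma^{2}}-\frac{1}{2\sigma^{2}}-\frac{N}{2\alpha}\big)$; $u$ is obtained as the limit (by a diagonal subsequence, in $C^{2}$ on each closed ball) of solutions $u_k$ of the same equation on the balls $B_k=\{|x|<k\}$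 with $u_k=\underline u$ on $\partial B_k$ and $\underline u\le u_k\le 1$. This $z$ is positive and convex and satisfies $0\le z(x)\le |x|^{2}+1+\frac{N}{\alpha}\sigma^{2}$ and $|\nabla z(x)|\le C(1+|x|)$ on $\mathbb{R}^{N}$ for some constant $C>0$. *)

(* Defs.v *)
From HB Require Import structures.
From mathcomp Require Import all_boot all_order all_algebra.
From mathcomp Require Import all_classical all_reals all_analysis.

Set Implicit Arguments.
Unset Strict Implicit.
Unset Printing Implicit Defensive.

Import Order.TTheory GRing.Theory Num.Theory.
Import numFieldNormedType.Exports.

Local Open Scope classical_set_scope.
Local Open Scope ring_scope.

Section calculus.
Context {R : realType} {N : nat}.
Implicit Types (f : 'rV[R]_N -> R) (x : 'rV[R]_N) (U : set 'rV[R]_N).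

(* The library norm on ['rV_N] is the sup norm; the topologies coincide. *)
Definition enorm x : R := Num.sqrt (\sum_(i < N) x 0 i ^+ 2).

Definition partial (i : 'I_N) f : 'rV[R]_N -> R :=
  fun x => 'D_(delta_mx 0 i) f x.

Definition grad f x : 'rV[R]_N := \row_i partial i f x.

Definition laplacian f x : R := \sum_(i < N) partial i (partial i f) x.

(* Meant for open [U] only. *)
Definition is_C2 U f : Prop :=
  forall x, U x ->
  [/\ {for x, continuous f},
      forall i, derivable f x (delta_mx 0 i) /\
                {for x, continuous (partial i f)}
    & forall i j, derivable (partial j f) x (delta_mx 0 i) /\
                  {for x, continuous (partial i (partial j f))}].

Definition cvg_C2 U (g : nat -> 'rV[R]_N -> R) f : Prop :=
  [/\ {uniform U, g @ \oo --> f},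
      forall i, {uniform U, (fun k => partial i (g k)) @ \oo --> partial i f}
    & forall i j, {uniform U, (fun k => partial i (partial j (g k))) @ \oo -->
                              partial i (partial j f)}].

End calculus.

Section value_function.
Context {R : realType} {N : nat}.
Variables alpha sigma : R.
Implicit Types (z u : 'rV[R]_N -> R) (x : 'rV[R]_N).

Definition u_sub x : R :=
  expR (- (enorm x ^+ 2 / (2 * sigma ^+ 2)) - 1 / (2 * sigma ^+ 2)
        - N%:R / (2 * alpha)).

Definition u_equation u x : Prop :=
  - laplacian u x + 1 / sigma ^+ 4 * enorm x ^+ 2 * u x =
  - (2 * alpha / sigma ^+ 2) * u x * ln (u x).

Definition solves_on_ball (r : R) u : Prop :=
  [/\ is_C2 [set x | enorm x < r] u,
      {within [set x | enorm x <= r], continuous u},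
      forall x, enorm x < r -> u_equation u x,
      forall x, enorm x = r -> u x = u_sub x
    & forall x, enorm x <= r -> u_sub x <= u x <= 1].

Definition constructed_by_balls z : Prop :=
  exists (u : 'rV[R]_N -> R) (uk : nat -> 'rV[R]_N -> R) (phi : nat -> nat),
  [/\ forall k, (0 < k)%N -> solves_on_ball k%:R (uk k),
      {homo phi : j k / (j < k)%N} /\
      (forall r : R, 0 < r ->
         cvg_C2 [set x | enorm x <= r] (fun k => uk (phi k)) u),
      is_C2 setT u,
      forall x, u_equation u x /\ u_sub x <= u x <= 1
    & forall x, z x = - (2 * sigma ^+ 2) * ln (u x)].

Definition hjb_equation z x : Prop :=
  - (2 * sigma ^+ 2) * laplacian z x + enorm (grad z x) ^+ 2 +
    4 * alpha * z x = 4 * enorm x ^+ 2.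

End value_function.

(* Processes are indexed by [R]; only the times [0 <= t] are ever used. *)
Section processes.
Context {R : realType} {N : nat} {d : measure_display} {T : measurableType d}.
Variable P : probability T R.
Implicit Types (F : R -> set (set T)) (w p y : R -> T -> 'rV[R]_N).

Definition is_filtration F : Prop :=
  [/\ forall t, 0 <= t -> sigma_algebra setT (F t),
      forall t, 0 <= t -> F t `<=` measurable
    & forall s t, 0 <= s -> s <= t -> F s `<=` F t].

Definition completed_natural_filtration w : R -> set (set T) := fun t =>
  <<s [set A | exists (i : 'I_N) (s : R) (B : set R),
         [/\ 0 <= s <= t, measurable B & A = [set o | B (w s o 0 i)]]]
      `|` [set A | P.-negligible A] >>.

Definition adapted F p : Prop :=
  forall (i : 'I_N) (t : R) (B : set R),
    0 <= t -> measurable B -> F t [set o | B (p t o 0 i)].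

Definition measurable_process p : Prop :=
  forall i : 'I_N,
    measurable_fun ((`[0, +oo[%classic : set R) `*` [set: T])
      (fun q : measurableTypeR R * T => p q.1 q.2 0 i).

(* The last clause says that w(t) - w(s) is independent of [F s] with law
   N(0, (t - s) I): take [A := setT] for the law. The second argument of
   [normal_prob] is the standard deviation. *)
Definition brownian_motion F w : Prop :=
  [/\ adapted F w,
      {ae P, forall o, w 0 o = 0},
      {ae P, forall o, {within `[0, +oo[, continuous (fun t => w t o)}}
    & forall (s t : R) (A : set T) (B : 'I_N -> set R),
        0 <= s -> s < t -> F s A -> (forall i, measurable (B i)) ->
        P (A `&` [set o | forall i, B i (w t o 0 i - w s o 0 i)]) =
        (P A * \prod_(i < N) normal_prob 0 (Num.sqrt (t - s)) (B i))%E].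

(* Integral form of dy = p dt + sigma dw, y(0) = x; the noise is additive, so
   no stochastic integral occurs. *)
Definition controlled_system F w (sigma : R) (x : 'rV[R]_N) p y : Prop :=
  [/\ measurable_process p, adapted F p, measurable_process y, adapted F y
    & {ae P, forall o, forall (t : R) (i : 'I_N), 0 <= t ->
        lebesgue_measure.-integrable `[0, t] (fun s => (p s o 0 i)%:E) /\
        y t o 0 i = x 0 i + \int[lebesgue_measure]_(s in `[0, t]) (p s o 0 i)
                    + sigma * w t o 0 i}].

Definition cost (alpha : R) p y : \bar R :=
  (\int[P]_o \int[lebesgue_measure]_(t in `[0%R, +oo[)
     ((enorm (p t o) ^+ 2 + enorm (y t o) ^+ 2) * expR (- alpha * t))%:E)%E.

Definition acceptable (alpha : R) p y : Prop :=
  (cost alpha p y < +oo)%E /\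
  (fun t : R => \int[P]_o (expR (- alpha * t) * enorm (y t o) ^+ 2)%:E)%E
    @ +oo --> 0%E.

Definition feedback (z : 'rV[R]_N -> R) y : R -> T -> 'rV[R]_N :=
  fun t o => - 2^-1 *: grad z (y t o).

(* [F] is any filtration for which [w] is a Brownian motion, not necessarily
   the one generated by [w]: weak solutions. *)
Definition weak_solution F w (sigma : R) (z : 'rV[R]_N -> R) (x : 'rV[R]_N) y :
    Prop :=
  [/\ is_filtration F, brownian_motion F w
    & controlled_system F w sigma x (feedback z y) y].

End processes.

(* Main.v *)
Require Import Defs.
From HB Require Import structures.
From mathcomp Require Import all_boot all_order all_algebra.
From mathcomp Require Import all_classical all_reals all_analysis.
From mathcomp Require Import measurable_realfun ring lra.

(* Fix s > 0, put h = s^2, and observe the system at an independent exponential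
   time of rate alpha. Since z is convex, the subgradient inequality taken at
   y(t) + sigma (w(t+h) - w(t)), respectively at y(t+h), compares z(y(t+h)) with
   z(y(t) + sigma (w(t+h) - w(t))) from below, respectively from above, up to
   the terms h/4 |grad z|^2 and the energy of the drift on [t, t+h]. Flipping
   the sign of one Gaussian coordinate at a time expresses the mean of
   z(y(t) + sigma (w(t+h) - w(t))) - z(y(t)) through second differences of z,
   which divided by h converge to sigma^2/2 times the mean of the Laplacian, so
   no stochastic integral is needed. Averaging over the exponential time,
   dividing by h and letting h tend to 0, the HJB equation turns the two
   comparisons into z(x) <= J(p) for every control p with finite cost and
   J(p) <= z(x) for the feedback control; in the second one the square of
   grad z(y(t+h)) plus the mean of grad z(y) over [t, t+h] passes to the limit by
   Fatou's lemma. Under the feedback control |y - sigma w|^2 has derivative at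
   most z(sigma w), hence E|y(t)|^2 grows at most polynomially, which gives the
   finite cost and the transversality condition. *)

Set Implicit Arguments.
Unset Strict Implicit.
Unset Printing Implicit Defensive.

Import Order.TTheory GRing.Theory Num.Theory.
Import numFieldNormedType.Exports.

Local Open Scope classical_set_scope.
Local Open Scope ring_scope.

(** * Convex functions with partial derivatives *)

Section convex_calculus.
Context {R : realType} {N : nat}.
Implicit Types (f : 'rV[R]_N -> R) (a b x : 'rV[R]_N).

(** The exponential time tau turns [alpha] times the discounted cost into the plain mean of
    |y(tau)|^2 + |p(tau)|^2, and by lack of memory replacing tau by tau + h costs the factor
    exp(alpha h) and the times below h. The factor produces the term alpha z of the HJB equation;
    the lost times carry mass about alpha h and are the only place where z(x) enters. Hence a
    separate study of the state near time 0. A control is merely square integrable in the mean, so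
    the cross term between grad z and the integral of p over a window has no pointwise limit. It is
    absorbed by completing a square with weights h/4 and 1/h; the square so lost vanishes when that
    integral is -h/2 grad z, that is, for the feedback law. This is why both comparisons give the
    same value. The parameter is s, not h, so that every increment has the law of s times one fixed
    Gaussian vector. Inequalities are kept as sums of nonnegative extended reals, because the mean
    of z(y(t)) is not known to be finite at each single t; subtraction is made only after the
    averages are shown finite. *)

Definition nsq x : R := \sum_i x 0 i ^+ 2.

Lemma nsq_ge0 x : 0 <= nsq x.
Proof. by apply: sumr_ge0 => i _; exact: sqr_ge0. Qed.

Lemma enorm_sqr x : enorm x ^+ 2 = nsq x.
Proof. by rewrite /enorm sqr_sqrtr// nsq_ge0. Qed.

Lemma nsq_coord x i : x 0 i ^+ 2 <= nsq x.
Proof.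
rewrite /nsq (bigD1 i)//= lerDl; apply: sumr_ge0 => j _; exact: sqr_ge0.
Qed.

Lemma nsqD a b : nsq (a + b) <= 2 * nsq a + 2 * nsq b.
Proof.
rewrite /nsq !mulr_sumr -big_split/=; apply: ler_sum => i _.
by rewrite mxE -subr_ge0; have := sqr_ge0 (a 0 i - b 0 i); nra.
Qed.

Lemma nsqZ c a : nsq (c *: a) = c ^+ 2 * nsq a.
Proof.
by rewrite /nsq mulr_sumr; apply: eq_bigr => i _; rewrite mxE exprMn.
Qed.

Definition unitv (k : 'I_N) : 'rV[R]_N := delta_mx 0 k.

Lemma nsq_unitv k : nsq (unitv k) = 1.
Proof.
rewrite /nsq (bigD1 k)//= big1 ?addr0; first by rewrite mxE !eqxx expr1n.
by move=> j jk; rewrite mxE eqxx (negbTE jk) expr0n.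
Qed.

(** Plays the part of the Itô correction: nonnegative for convex [f], so its mean always makes
    sense, and comparable to [s ^+ 2] times a second partial derivative. *)
Definition second_diff f k a s : R :=
  f (a + s *: unitv k) + f (a - s *: unitv k) - 2 * f a.

Lemma is_derive_line f k a (s : R) : derivable f (a + s *: unitv k) (unitv k) ->
  is_derive s 1 (fun t : R => f (a + t *: unitv k))
    (partial k f (a + s *: unitv k)).
Proof.
move=> df.
have E : (fun h : R => h^-1 *: (f (a + (h *: 1 + s) *: unitv k)
      - f (a + s *: unitv k))) =
    (fun h : R => h^-1 *: (f (h *: unitv k + (a + s *: unitv k))
      - f (a + s *: unitv k))).
  apply/funext => h; congr (_ *: (f _ - _)).
  by rewrite scalerDl [h *: 1]mulr1 addrCA.
by apply: DeriveDef; [rewrite /derivable /= E | rewrite /derive /= E].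
Qed.

Lemma cvg_sumr (U : Type) (F : set_system U) (FF : Filter F) (I : Type)
    (r : seq I) (P : pred I) (g : I -> U -> R) (l : I -> R) :
  (forall i, P i -> g i x @[x --> F] --> l i) ->
  (\sum_(i <- r | P i) g i x) @[x --> F] --> \sum_(i <- r | P i) l i.
Proof.
move=> H; elim: r => [|i r IH].
  by under eq_fun do rewrite big_nil; rewrite big_nil; exact: cvg_cst.
under eq_fun do rewrite big_cons; rewrite big_cons.
by case: ifPn => // Pi; apply: cvgD => //; exact: H.
Qed.

Lemma second_diffN f k a s : second_diff f k a (- s) = second_diff f k a s.
Proof. by rewrite /second_diff scaleNr opprK [f (a - _) + _]addrC. Qed.

(** Two one-variable theorems: Rolle turns the second difference into the difference of the first
    partial between [t1] and [- t1], then the mean value theorem on that interval produces the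
    second partial. The bound on [t] serves both the limit and the domination later. *)
Lemma second_diff_mean f k a s : (forall x, derivable f x (unitv k)) ->
  (forall x, derivable (partial k f) x (unitv k)) ->
  exists2 t : R, `|t| <= `|s| &
    second_diff f k a s = s ^+ 2 * partial k (partial k f) (a + t *: unitv k).
Proof.
move=> df ddf.
wlog s0 : s / 0 < s => [H|].
  have [s0|s0|->] := ltgtP s 0; last 2 first.
  - exact: H.
  - exists 0; rewrite // /second_diff scale0r subr0 addr0 expr0n/=; ring.
  have [|t ts tE] := H (- s); first by rewrite oppr_gt0.
  exists t; first by rewrite -(normrN s).
  by rewrite -second_diffN tE sqrrN.
(* [c] is the value that makes the even function [phi] agree at [0] and [s]. *)
pose c := second_diff f k a s / s ^+ 2.
pose phi (t : R) := f (a + t *: unitv k) + f (a + (- t) *: unitv k) - c * t ^+ 2.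
have D1 (t : R) : is_derive t 1 (fun t => f (a + t *: unitv k)) (partial k f (a + t *: unitv k)).
  exact: is_derive_line.
have D2 (t : R) : is_derive t 1 (fun t => f (a + (- t) *: unitv k)) (- partial k f (a + (- t) *: unitv k)).
  have := @is_derive1_comp R (fun t => f (a + t *: unitv k)) (-%R) t _ _ (D1 (- t)) _.
  by move=> /(_ (-1) _); rewrite mulrN1; apply.
have Dphi (t : R) : is_derive t 1 phi
    (partial k f (a + t *: unitv k) - partial k f (a + (- t) *: unitv k) - 2 * c * t).
  apply: is_derive_eq; rewrite /GRing.scale/=; ring.
have [|||t1] := @Rolle R phi 0 s s0.
  by move=> u _; exact: ex_derive.
  by apply: derivable_within_continuous => t _; exact: ex_derive.
  rewrite /phi oppr0 scale0r addr0 /c scaleNr expr0n/= mulr0 divfK ?expf_neq0 ?gt_eqF//.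
  rewrite /second_diff; ring.
rewrite in_itv/= => /andP[t10 t1s] Dt1.
have e1 : partial k f (a + t1 *: unitv k) - partial k f (a + (- t1) *: unitv k) = 2 * c * t1.
  have := @derive_val _ _ _ _ _ _ _ (Dphi t1).
  by rewrite (@derive_val _ _ _ _ _ _ _ Dt1) => /esym/eqP; rewrite subr_eq0 => /eqP.
have D3 (t : R) : is_derive t 1 (fun t => partial k f (a + t *: unitv k))
    (partial k (partial k f) (a + t *: unitv k)).
  exact: is_derive_line.
have [||t2] := @MVT R _ _ (- t1) t1 _ (fun t _ => D3 t).
  lra.
  by apply: derivable_within_continuous => t _; exact: ex_derive.
rewrite in_itv/= => /andP[t20 t21]; rewrite e1 => e2.
exists t2.
  by rewrite (gtr0_norm s0) ler_norml; apply/andP; split; lra.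
have -> : partial k (partial k f) (a + t2 *: unitv k) = c.
  apply: (@mulIf _ (2 * t1)); first by rewrite mulf_neq0// gt_eqF.
  have -> : 2 * t1 = t1 - - t1 by ring.
  by rewrite -e2; ring.
by rewrite /c mulrC divfK// expf_neq0// gt_eqF.
Qed.

(** The step is split as [s n * c] because it will be a deterministic [s n] times a Gaussian
    coordinate: the division is by [s n ^+ 2] alone, and [c] may be zero. The base point moves too,
    since the coordinates already switched on shift it. *)
Lemma cvg_second_diff f k (u : nat -> 'rV[R]_N) (a : 'rV[R]_N) (s : nat -> R) (c : R) :
  (forall x, derivable f x (unitv k)) ->
  (forall x, derivable (partial k f) x (unitv k)) ->
  {for a, continuous (partial k (partial k f))} ->
  u n @[n --> \oo] --> a -> s n @[n --> \oo] --> 0 -> (forall n, s n != 0) ->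
  second_diff f k (u n) (s n * c) / s n ^+ 2 @[n --> \oo] -->
    c ^+ 2 * partial k (partial k f) a.
Proof.
move=> df ddf cddf ua s0 sN0.
have /choice[t tP] : forall n, exists t : R, `|t| <= `|s n * c| /\
    second_diff f k (u n) (s n * c) =
    (s n * c) ^+ 2 * partial k (partial k f) (u n + t *: unitv k).
  by move=> n; have [t] := @second_diff_mean f k (u n) (s n * c) df ddf; exists t.
have -> : (fun n => second_diff f k (u n) (s n * c) / s n ^+ 2) =
    (fun n => c ^+ 2 * partial k (partial k f) (u n + t n *: unitv k)).
  by apply/funext => n; rewrite (tP n).2; field; exact: sN0.
apply: cvgMr; apply: (cvg_comp (fun n => u n + t n *: unitv k)); last exact: cddf.
suff t0 : t n @[n --> \oo] --> 0.
  have : u n + t n *: unitv k @[n --> \oo] --> a + 0 *: unitv k.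
    by apply: cvgD => //; apply: cvgZr_tmp.
  by rewrite scale0r addr0.
apply/norm_cvg0P.
have sc0 : `|s n * c| @[n --> \oo] --> 0.
  have <- : `|0 * c| = 0 :> R by rewrite mul0r normr0.
  by apply: cvg_norm; apply: cvgMl.
apply: (squeeze_cvgr _ (cvg_cst 0) sc0); near=> n.
by rewrite normr_ge0 (tP n).1.
Unshelve. all: by end_near. Qed.

Section convex.
Variable f : 'rV[R]_N -> R.
Hypothesis fconv : convex_function setT f.

Lemma convexW a b (t : R) : 0 <= t <= 1 ->
  f (t *: a + (1 - t) *: b) <= t * f a + (1 - t) * f b.
Proof.
move=> /andP[t0 t1].
have t01 : Itv.spec (@Itv.num_sem R) (Itv.Real `[0%Z, 1%Z]) t.
  by rewrite /Itv.num_sem/= num_real/= in_itv/= t0 t1.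
have := @fconv (Itv.mk t01) a b; rewrite !in_setT => /(_ isT isT).
by [].
Qed.

Lemma convex_mid a b : 2 * f (2^-1 *: (a + b)) <= f a + f b.
Proof.
have h : 1 - 2^-1 = 2^-1 :> R by lra.
have := @convexW a b 2^-1; rewrite h -scalerDr => /(_ ltac:(lra)); lra.
Qed.

Lemma second_diff_ge0 k a s : 0 <= second_diff f k a s.
Proof.
have := convex_mid (a + s *: unitv k) (a - s *: unitv k).
have -> : 2^-1 *: (a + s *: unitv k + (a - s *: unitv k)) = a.
  by apply/rowP => j; rewrite !mxE; field.
rewrite /second_diff; lra.
Qed.

(** Jensen's inequality with equal weights, by induction: the last vector is weighed against the
    mean of the others. *)
Lemma convex_avg n (v : 'I_n -> 'rV[R]_N) : (0 < n)%N ->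
  n%:R * f (n%:R^-1 *: \sum_i v i) <= \sum_i f (v i).
Proof.
case: n v => // n v _.
elim: n v => [|n IH] v; first by rewrite !big_ord_recl !big_ord0 !addr0 invr1 scale1r mul1r.
rewrite big_ord_recr /= [leRHS]big_ord_recr /=.
set u := \sum_(i < n.+1) _.
have n1 : (n.+1%:R : R) > 0 by rewrite ltr0n.
have n2 : (n.+2%:R : R) > 0 by rewrite ltr0n.
have e2 : n.+2%:R = n.+1%:R + 1 :> R by rewrite -natr1.
have := @convexW (n.+1%:R^-1 *: u) (v ord_max) (n.+1%:R / n.+2%:R).
have -> : 1 - n.+1%:R / n.+2%:R = n.+2%:R^-1 :> R.
  by rewrite -{1}(@mulfV _ n.+2%:R) ?gt_eqF// -mulrBl {1}e2 addrAC subrr add0r mul1r.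
rewrite scalerA mulrAC mulfV ?gt_eqF// mul1r -scalerDr => /(_ _).
rewrite divr_ge0 ?ler0n// ler_pdivrMr// mul1r ler_nat leqnSn => /(_ isT) H.
have := IH (fun i => v (widen_ord (leqnSn n.+1) i)) => H2.
rewrite -(ler_pM2l n2) in H; apply: (le_trans H).
rewrite mulrDr !mulrA [n.+2%:R * n.+1%:R]mulrC mulfK ?gt_eqF// mulfV ?gt_eqF//.
by rewrite mul1r lerD2r.
Qed.

(** [a] lies between [a - s *: v] and [a + v], the latter with weight s/(1+s); convexity at these
    three points rearranges to the claim. *)
Lemma convex_slope a v (s : R) : 0 < s -> s <= 1 ->
  (f a - f (a - s *: v)) / s <= f (a + v) - f a.
Proof.
move=> s0 s1.
pose t := s / (1 + s).
have p1 : 0 < 1 + s by lra.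
have := @convexW (a + v) (a - s *: v) t.
have -> : 1 - t = (1 + s)^-1 by rewrite /t; field; rewrite gt_eqF.
have -> : t *: (a + v) + (1 + s)^-1 *: (a - s *: v) = a.
  rewrite !scalerDr scalerN scalerA addrACA -scalerDl -[_^-1 * s]/(_ * _).
  rewrite [_^-1 * s]mulrC subrr addr0 -[RHS]scale1r; congr (_ *: _).
  by rewrite /t; field; rewrite gt_eqF.
move=> /(_ _); rewrite divr_ge0 ?ler_pdivrMr ?mul1r /t; try lra.
move=> /(_ ltac:(lra)).
rewrite -mulrAC -[X in _ + X]mulrC -mulrDl ler_pdivlMr// => H.
nra.
Qed.

Hypothesis N0 : (0 < N)%N.

Lemma sum_coord (x : 'rV[R]_N) : \sum_i x 0 i *: unitv i = x.
Proof. by rewrite [RHS]row_sum_delta. Qed.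

Hypothesis df : forall x k, derivable f x (unitv k).

(** Only partial derivatives are at hand, not a total differential. With v = b - a, the point a - s
    v is the mean of the N points a - N s v_i e_i, each of which moves one coordinate; Jensen bounds
    the slope along v by the sum of the coordinate slopes [q i s], and these tend to the partial
    derivatives as s decreases to 0. *)
Lemma convex_subgradient a b :
  f a + \sum_i partial i f a * (b 0 i - a 0 i) <= f b.
Proof.
pose v : 'rV[R]_N := b - a.
pose q (i : 'I_N) (s : R) := (f a - f (a + (- (N%:R * s * v 0 i)) *: unitv i)) / (N%:R * s).
have H1 (s : R) : 0 < s -> s <= 1 -> \sum_i q i s <= f b - f a.
  move=> s0 s1.
  have := @convex_slope a v s s0 s1.
  have -> : a + v = b by rewrite /v addrC subrK.
  apply: le_trans.
  have Nr : 0 < (N%:R : R) by rewrite ltr0n.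
  have key : N%:R * f (a - s *: v) <= \sum_i f (a + (- (N%:R * s * v 0 i)) *: unitv i).
    have -> : a - s *: v = N%:R^-1 *: \sum_i (a + (- (N%:R * s * v 0 i)) *: unitv i).
      rewrite big_split/= sumr_const card_ord.
      under eq_bigr do rewrite scaleNr -scalerA.
      rewrite sumrN -scaler_sumr sum_coord.
      apply/rowP => j; rewrite !mxE mulmxnE -[a 0 j *+ N]mulr_natl.
      by field; rewrite gt_eqF.
    exact: convex_avg.
  rewrite /q -mulr_suml sumrB sumr_const card_ord ler_pdivrMr; last by nra.
  have -> : (f a - f (a - s *: v)) / s * (N%:R * s) = N%:R * (f a - f (a - s *: v)).
    by field; rewrite gt_eqF.
  by rewrite mulrBr lerB// -[leLHS]mulr_natl.
have cq i : (q i s @[s --> 0^'+]) --> partial i f a * v 0 i.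
  pose c := N%:R * v 0 i.
  have D := @is_derive_line f i a 0.
  rewrite scale0r addr0 in D; have {}D := D (@df _ _).
  (* For [v 0 i = 0] the substitution by [- c * s] below would degenerate, but then [q i] is
     identically zero. *)
  have [c0|c0] := eqVneq (v 0 i) 0.
    rewrite c0 mulr0 (_ : q i = cst 0); first exact: cvg_cst.
    by apply/funext => s; rewrite /q c0 mulr0 oppr0 scale0r addr0 subrr mul0r.
  have Nr : (N%:R : R) != 0 by rewrite pnatr_eq0 -lt0n.
  have cN : - c != 0 by rewrite oppr_eq0 mulf_neq0.
  have /= D0 : (h^-1 * (f (a + h *: unitv i) - f a) @[h --> 0^']) --> partial i f a.
    have := @ex_derive _ _ _ _ _ _ _ D; rewrite /derivable /=.
    have := @derive_val _ _ _ _ _ _ _ D; rewrite /derive /= => <- H.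
    by move: H; under eq_fun do rewrite [_ *: 1]mulr1 addr0 scale0r addr0.
  have D1 : (((- c * s)^-1 * (f (a + (- c * s) *: unitv i) - f a)) @[s --> 0^'+]) --> partial i f a.
    apply: (@cvg_comp _ _ _ (fun s => - c * s) (fun h => h^-1 * (f (a + h *: unitv i) - f a)) _ (0^')); last exact: D0.
    have C : (- c * s @[s --> 0^'+]) --> (0:R).
      rewrite -[X in _ --> X](mulr0 (- c)); apply: cvgMr.
      exact: (cvg_at_right_filter cvg_id).
    move=> A [e /= e0 eA]; near=> s; apply: eA => /=; last first.
      by rewrite mulf_neq0//; near: s; exact: nbhs_right_neq.
    rewrite sub0r normrN; near: s.
    have := C; move/cvgrPdist_lt => /(_ e e0); apply: filterS => s.
    by rewrite sub0r normrN.
  rewrite [_ * v 0 i]mulrC.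
  have -> : q i = fun s => v 0 i * ((- c * s)^-1 * (f (a + (- c * s) *: unitv i) - f a)).
    apply/funext => s; rewrite /q.
    have -> : - (N%:R * s * v 0 i) = - c * s by rewrite /c; ring.
    (* At [s = 0] both sides are zero because the inverse of zero is zero, so the functions agree
       everywhere. *)
    rewrite /c; have [->|s0] := eqVneq s 0; first by rewrite !mulr0 invr0; ring.
    by move: (f _) => F; field; rewrite s0 c0 Nr.
  by apply: cvgMr.
have Cs : (\sum_i q i s @[s --> 0^'+]) --> \sum_i partial i f a * v 0 i.
  by apply: cvg_sumr => i _.
rewrite addrC -lerBrDr.
rewrite (eq_bigr (fun i => partial i f a * v 0 i)); last by move=> i _; rewrite !mxE.
apply: (cvgr_to_le Cs); near=> s; apply: H1; near: s.
  exact: nbhs_right_gt.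
exact: nbhs_right_le.
Unshelve. all: by end_near. Qed.

(** Test the subgradient inequality at [x] against x + g/4, g the gradient: a quarter of |g|^2 is at
    most 2|x|^2 + |g|^2/8 + K. The step 1/4 leaves |g|^2/8 on the left, whence the constants 16 and
    8. *)
Lemma convex_quadratic_grad K : (forall x, 0 <= f x <= nsq x + K) ->
  forall x, \sum_i partial i f x ^+ 2 <= 16 * nsq x + 8 * K.
Proof.
move=> fK x; set G := \sum_i _.
pose g : 'rV[R]_N := \row_i partial i f x.
have gG : nsq g = G by apply: eq_bigr => i _; rewrite mxE.
have := convex_subgradient x (x + 4^-1 *: g).
have -> : \sum_i partial i f x * ((x + 4^-1 *: g) 0 i - x 0 i) = 4^-1 * G.
  by rewrite /G mulr_sumr; apply: eq_bigr => i _; rewrite !mxE; ring.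
have /andP[f0 _] := fK x; have /andP[_ fu] := fK (x + 4^-1 *: g).
have := nsqD x (4^-1 *: g); rewrite nsqZ gG; lra.
Qed.

Lemma convex_second_partial_ge0 k a :
  (forall x, derivable (partial k f) x (unitv k)) ->
  {for a, continuous (partial k (partial k f))} ->
  0 <= partial k (partial k f) a.
Proof.
move=> ddf cddf.
have C : (fun=> a) n @[n --> \oo] --> a by exact: cvg_cst.
have := @cvg_second_diff f k (fun=> a) a harmonic 1 (fun x => @df x k) ddf cddf
  C cvg_harmonic (fun n => lt0r_neq0 (harmonic_gt0 n)).
rewrite expr1n mul1r => H; apply: (cvgr_to_ge H); near=> n.
by rewrite mulr_ge0 ?second_diff_ge0// invr_ge0 sqr_ge0.
Unshelve. all: by end_near. Qed.

End convex.
End convex_calculus.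

(** * Measurability of continuous functions of random row vectors *)

Section measurability.
Context {R : realType} {N : nat} {d : measure_display} {T : measurableType d}.

Lemma cvg_row (U : Type) (F : set_system U) (FF : Filter F) (v : U -> 'rV[R]_N)
    (l : 'rV[R]_N) : (forall i, v x 0 i @[x --> F] --> l 0 i) -> v x @[x --> F] --> l.
Proof.
move=> H; apply/cvgrPdist_lt => e e0.
have : \forall x \near F, forall i : 'I_N, `|l 0 i - v x 0 i| < e.
  by apply: filter_forall => i; have /cvgrPdist_lt := H i; apply.
apply: filterS => x Hx; rewrite /Num.norm /= mx_normrE.
apply/bigmax_ltP; split=> // -[i j] _ /=.
by rewrite (ord1 i) !mxE; exact: Hx.
Qed.

Lemma measurable_fun_countable (I : countType) (V : T -> I) (G : I -> R) :
  (forall q, measurable (V @^-1` [set q])) -> measurable_fun setT (G \o V).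
Proof.
move=> mV _ B mB; rewrite setTI.
have -> : (G \o V) @^-1` B =
    \bigcup_(q in [set: I]) (if `[< B (G q) >] then V @^-1` [set q] else set0).
  apply/seteqP; split => [x /= Bx|x [q _] /=].
    by exists (V x) => //; case: asboolP.
  by case: asboolP => //= ? ->.
apply: countable_bigcupT_measurable => // q; case: ifP => // _.
Qed.

(** The vector is rounded down to the grid of mesh 1/(n+1). The rounded vector takes countably many
    values, so any function of it is measurable, and continuity of [f] recovers [f (Y o)] as the
    pointwise limit. *)
Lemma measurable_fun_row (f : 'rV[R]_N -> R) (Y : T -> 'rV[R]_N) :
  continuous f -> (forall i, measurable_fun setT (fun o => Y o 0 i)) ->
  measurable_fun setT (fun o => f (Y o)).
Proof.
move=> cf mY.
pose V n (o : T) : {ffun 'I_N -> int} := [ffun i => Num.floor (n.+1%:R * Y o 0 i)].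
pose G n (q : {ffun 'I_N -> int}) : R := f (\row_i ((q i)%:~R / n.+1%:R)).
apply: (@measurable_fun_cvg _ _ _ setT (fun n => G n \o V n)) => [n|o _].
  apply: measurable_fun_countable => q.
  have -> : V n @^-1` [set q] = \bigcap_(i in [set: 'I_N])
      ((fun o => n.+1%:R * Y o 0 i) @^-1` `[(q i)%:~R, (q i + 1)%:~R[).
    apply/seteqP; split=> [x /= <- i _ /=|x H /=].
      rewrite in_itv/= ffunE; exact: floor_itv.
    apply/ffunP => i; rewrite ffunE; apply/floor_def.
    by have := H i I; rewrite /= in_itv.
  apply: fin_bigcap_measurable => // i _; rewrite -[X in measurable X]setTI.
  apply: (_ : measurable_fun setT (fun o => n.+1%:R * Y o 0 i)) => //.
  exact: measurable_funM.
apply: (cvg_comp (fun n => \row_i ((V n o i)%:~R / n.+1%:R)) f); last exact: cf.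
apply: cvg_row => i.
under eq_fun do rewrite mxE ffunE.
have H (n : nat) : (Y o 0 i) - harmonic n <= (Num.floor (n.+1%:R * Y o 0 i))%:~R / n.+1%:R <= Y o 0 i.
  have n0 : (0 : R) < n.+1%:R by rewrite ltr0n.
  have /andP[h1 h2] := floor_itv (n.+1%:R * Y o 0 i).
  rewrite intrD in h2.
  apply/andP; split.
    by rewrite ler_pdivlMr// mulrBl [harmonic n * _]mulVf ?gt_eqF//; lra.
  by rewrite ler_pdivrMr// [Y o 0 i * _]mulrC.
apply: (@squeeze_cvgr _ _ _ _ (fun n => Y o 0 i - harmonic n) (cst (Y o 0 i))).
- by near=> n; exact: H.
- rewrite -[X in _ --> X]subr0; apply: cvgB; first exact: cvg_cst.
  exact: cvg_harmonic.
- exact: cvg_cst.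
Unshelve. all: by end_near. Qed.

End measurability.

(** * Densities, image measures and affine changes of variable *)

Section density.
Local Open Scope ereal_scope.
Context {R : realType} {d : measure_display} {T : measurableType d}.

(** [nu] is absolutely continuous with respect to [mu], so the Radon-Nikodym change of variables
    applies; [g] has the same integrals over measurable sets as the derivative and therefore equals
    it almost everywhere. *)
Lemma ge0_integral_density (mu : {sigma_finite_measure set T -> \bar R})
    (nu : {finite_measure set T -> \bar R}) (g : T -> R) (f : T -> \bar R) :
  measurable_fun setT g -> (forall x, (0 <= g x)%R) ->
  (forall A, measurable A -> nu A = \int[mu]_(x in A) (g x)%:E) ->
  measurable_fun setT f -> (forall x, 0 <= f x) ->
  \int[nu]_x f x = \int[mu]_x (f x * (g x)%:E).
Proof.
move=> mg g0 nuE mf f0.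
have numu : nu `<< mu.
  apply/null_content_dominatesP => A mA muA; rewrite nuE//.
  apply: null_set_integral => //.
  exact/measurable_funTS/measurable_EFinP.
rewrite -(Radon_Nikodym_SigmaFinite.change_of_variables numu)//.
have ig : mu.-integrable setT (EFin \o g).
  apply/integrableP; split; first exact/measurable_EFinP.
  under eq_integral do rewrite /= ger0_norm//.
  by rewrite -nuE// -ge0_fin_numE// fin_num_measure.
apply: ae_eq_integral => //.
- apply: emeasurable_funM => //.
  exact: measurable_int (Radon_Nikodym_SigmaFinite.f_integrable numu).
- by apply: emeasurable_funM => //; exact/measurable_EFinP.
apply: ae_eqe_mul2l.
apply: integral_ae_eq => //.
- exact: Radon_Nikodym_SigmaFinite.f_integrable.
- exact/measurable_EFinP.
- by move=> A _ mA; rewrite -Radon_Nikodym_SigmaFinite.f_integral// nuE.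
Qed.

End density.

Section image_measure.
Local Open Scope ereal_scope.
Context {R : realType} {d1 d2 : measure_display} {T1 : measurableType d1}
  {T2 : measurableType d2}.

Definition pushm (mu : {measure set T1 -> \bar R}) (f : T1 -> T2)
    (mf : measurable_fun setT f) : {measure set T2 -> \bar R} :=
  measure_function_pushforward__canonical__measure_function_Measure mu mf.

Lemma pushmE (mu : {measure set T1 -> \bar R}) (f : T1 -> T2)
  (mf : measurable_fun setT f) A : pushm mu mf A = mu (f @^-1` A).
Proof. by []. Qed.

Lemma ge0_integral_pushm (mu : {measure set T1 -> \bar R}) (f : T1 -> T2)
    (mf : measurable_fun setT f) (g : T2 -> \bar R) :
  measurable_fun setT g -> (forall y, 0 <= g y) ->
  \int[pushm mu mf]_y g y = \int[mu]_x g (f x).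
Proof. by move=> mg g0; rewrite ge0_integral_pushforward. Qed.

End image_measure.

Section lebesgue_affine.
Local Open Scope ereal_scope.
Context {R : realType}.
Notation mu := (@lebesgue_measure R).

(** [c] times the image of Lebesgue measure under the affine map gives each half-open interval its
    length, so it is Lebesgue measure by uniqueness. *)
Lemma ge0_integral_affine (c b : R) (f : R -> \bar R) : (0 < c)%R ->
  measurable_fun setT f -> (forall x, 0 <= f x) ->
  \int[mu]_x f x = c%:E * \int[mu]_x f (c * x + b)%R.
Proof.
move=> c0 mf f0.
pose phi : measurableTypeR R -> measurableTypeR R := fun x => (c * x + b)%R.
have mphi : measurable_fun setT phi.
  by apply: measurable_funD => //; exact: measurable_funM.
pose k : {nonneg R} := NngNum (ltW c0).
pose m' := mscale k (pushm mu mphi).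
have E A : measurable A -> mu A = m' A.
  apply: lebesgue_measure_unique => //= _ [[u v]] _ <-.
  rewrite /m' /mscale /= /pushforward.
  have -> : phi @^-1` `]u, v] = `]((u - b) / c)%R, ((v - b) / c)%R]%classic.
    apply/seteqP; split=> x; rewrite /= !in_itv/= /phi ltr_pdivrMr// ler_pdivlMr//;
    by rewrite ltrBlDr lerBrDr [(x * c)%R]mulrC.
  rewrite !lebesgue_measure_itv/= !lte_fin ltr_pM2r ?invr_gt0// ltrD2r.
  case: ifPn => _; last by rewrite mule0.
  by rewrite -!EFinB -EFinM; congr EFin; field; rewrite gt_eqF.
rewrite (eq_measure_integral m'); last by move=> A mA _; exact: E.
by rewrite ge0_integral_mscale// ge0_integral_pushm.
Qed.

Lemma ge0_integral_opp (f : R -> \bar R) :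
  measurable_fun setT f -> (forall x, 0 <= f x) ->
  \int[mu]_x f x = \int[mu]_x f (- x)%R.
Proof.
move=> mf f0.
have mN : measurable_fun setT (-%R : measurableTypeR R -> measurableTypeR R) by [].
rewrite (eq_measure_integral (pushm mu mN)); first by rewrite ge0_integral_pushm.
by move=> A mA _; rewrite -[LHS]lebesgue_measureN.
Qed.

End lebesgue_affine.

(** * The one-dimensional normal law and its moments *)

Section normal_law.
Context {R : realType}.
Notation mu := (@lebesgue_measure R).
Notation nu := (normal_prob (0 : R) 1).
Implicit Types (s x : R) (B : set (measurableTypeR R)).

Lemma normal_probE s B : measurable B ->
  (normal_prob 0 s B = \int[mu]_x ((normal_pdf 0 s x)%:E * (\1_B x)%:E))%E.
Proof.
move=> mB; rewrite /normal_prob integral_mkcond.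
by apply: eq_integral => x _; rewrite epatch_indic.
Qed.

Lemma normal_pdf_scale s x : 0 < s -> s * normal_pdf 0 s (s * x) = normal_pdf 0 1 x.
Proof.
move=> s0; rewrite !normal_pdfE ?oner_neq0 ?gt_eqF//= mulrA; congr (_ * expR _).
  rewrite /normal_peak expr1n mul1r -mulrnAr sqrtrM ?sqr_ge0// sqrtr_sqr gtr0_norm//.
  by rewrite invfM mulrA mulfV ?gt_eqF// mul1r.
rewrite !subr0 exprMn expr1n -mulr_natr -[1 *+ 2]mulr_natr; field.
by rewrite gt_eqF.
Qed.

(** Allows an increment of any length to be represented as a multiple of one standard vector. *)
Lemma normal_prob_scale s B : 0 < s -> measurable B ->
  normal_prob 0 s B = nu [set x | B (s * x)].
Proof.
move=> s0 mB.
have mS : measurable_fun setT (fun x => s * x) by exact: measurable_funM.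
have mB' : measurable [set x | B (s * x)].
  by rewrite -[X in measurable X]setTI; exact: mS.
rewrite !normal_probE// (@ge0_integral_affine _ s 0)//.
- under eq_integral do rewrite addr0.
  rewrite -ge0_integralZl//.
  + apply: eq_integral => x _; rewrite muleA -EFinM normal_pdf_scale//.
  + apply: emeasurable_funM.
      apply/measurable_EFinP; apply: measurableT_comp => //; exact: measurable_normal_pdf.
    apply/measurable_EFinP; apply: (measurable_indic mB').
  + by move=> x _; rewrite -EFinM lee_fin mulr_ge0// normal_pdf_ge0.
  + by rewrite lee_fin ltW.
- by apply: emeasurable_funM; apply/measurable_EFinP => //; exact: measurable_normal_pdf.
- by move=> x; rewrite -EFinM lee_fin mulr_ge0// normal_pdf_ge0.
Qed.

Lemma normal_prob_opp B : measurable B -> nu [set x | B (- x)] = nu B.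
Proof.
move=> mB.
have mB' : measurable [set x : measurableTypeR R | B (- x)].
  by rewrite -[X in measurable X]setTI; apply: (_ : measurable_fun setT (-%R : R -> R)).
rewrite !normal_probE// [RHS]ge0_integral_opp.
- apply: eq_integral => x _; congr ((_ * _)%E).
  by rewrite !normal_pdfE ?oner_neq0//= /normal_fun !subr0 sqrrN.
- by apply: emeasurable_funM; apply/measurable_EFinP => //; exact: measurable_normal_pdf.
- by move=> x; rewrite -EFinM lee_fin mulr_ge0// normal_pdf_ge0.
Qed.

Lemma integral_normal_prob (f : R -> \bar R) : measurable_fun setT f ->
  (forall x, (0 <= f x)%E) ->
  (\int[nu]_x f x = \int[mu]_x (f x * (normal_pdf 0 1 x)%:E))%E.
Proof.
move=> mf f0.
apply: ge0_integral_density => //; first exact: measurable_normal_pdf.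
by move=> x; exact: normal_pdf_ge0.
Qed.

(** The exponential converts the standard density into [s] times the centred density of standard
    deviation [s], whose mass is 1. The moments below are read off from this identity, without
    integration by parts. *)
Lemma normal_exp_sqr s : 0 < s ->
  (\int[nu]_x (expR ((1 - s ^- 2) / 2 * x ^+ 2))%:E = s%:E)%E.
Proof.
move=> s0; rewrite integral_normal_prob//; last first.
  by apply/measurable_EFinP; apply: measurableT_comp => //; exact: measurable_funM.
transitivity (s%:E * \int[mu]_x (normal_pdf 0 s x)%:E)%E; last first.
  by rewrite integral_normal_pdf mule1.
rewrite -ge0_integralZl.
- apply: eq_integral => x _; rewrite -!EFinM; congr EFin.
  rewrite !normal_pdfE ?oner_neq0 ?gt_eqF//= /normal_fun !subr0.
  have -> : normal_peak 1 = s * normal_peak s.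
    rewrite /normal_peak expr1n mul1r -mulrnAr sqrtrM ?sqr_ge0// sqrtr_sqr gtr0_norm//.
    by rewrite invfM mulrA mulfV ?gt_eqF// mul1r.
  rewrite mulrCA -expRD -[s * _ * _]mulrA; congr (_ * (_ * expR _)).
  rewrite expr1n -[s ^+ 2 *+ 2]mulr_natr -[1 *+ 2]mulr_natr; field.
  by rewrite gt_eqF.
- exact: measurableT.
- by apply/measurable_EFinP; exact: measurable_normal_pdf.
- by move=> x _; rewrite lee_fin normal_pdf_ge0.
- by rewrite lee_fin ltW.
Qed.

Let meas_expsq (c : R) : measurable_fun setT (fun x : R => (expR (c * x ^+ 2))%:E).
Proof. by apply/measurable_EFinP; apply: measurableT_comp => //; exact: measurable_funM. Qed.

(** For [s = 2] the exponent of [normal_exp_sqr] is 3/8 x^2. With t = 3/16 x^2 one has t^2 <=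
    exp(2t), which is x^4 <= 256/9 exp(3/8 x^2). *)
Lemma normal_moment4_lty : (\int[nu]_x (x ^+ 4)%:E < +oo)%E.
Proof.
have e8 : (1 - 2 ^- 2) / 2 = 3 / 8 :> R by field.
have := @normal_exp_sqr 2 ltac:(by []); rewrite e8 => E.
apply: (@le_lt_trans _ _ ((256 / 9)%:E * (2:R)%:E)%E); last by rewrite -EFinM ltry.
rewrite -E -ge0_integralZl//; last first.
  by first [exact: meas_expsq | move=> x _; rewrite lee_fin expR_ge0 | rewrite lee_fin; lra].
apply: ge0_le_integral => //.
- by move=> x _; rewrite lee_fin exprn_even_ge0.
- exact/measurable_EFinP/measurable_funX.
- by apply: emeasurable_funM => //; exact: meas_expsq.
- move=> x _; rewrite -EFinM lee_fin.
  have := expR_ge1Dx (3 / 16 * x ^+ 2) => h.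
  have -> : 3 / 8 * x ^+ 2 = 3 / 16 * x ^+ 2 + 3 / 16 * x ^+ 2 by field.
  rewrite expRD.
  have h0 : 0 <= 3 / 16 * x ^+ 2 by have := sqr_ge0 x; lra.
  have h1 : (3 / 16 * x ^+ 2) * (3 / 16 * x ^+ 2) <= expR (3 / 16 * x ^+ 2) * expR (3 / 16 * x ^+ 2).
    by apply: ler_pM => //; lra.
  have -> : x ^+ 4 = 256 / 9 * ((3 / 16 * x ^+ 2) * (3 / 16 * x ^+ 2)) by field.
  by rewrite ler_pM2l//; lra.
Qed.

(** A derivative of [normal_exp_sqr] at [s = 1], taken by inequalities: exp(u) >= 1 + u gives 1 + (1
    - s^-2)/2 m <= s for the moment m, hence m <= 2s^2/(s+1) for s > 1 and the reverse for s < 1.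
    Both bounds tend to 1. *)
Lemma normal_moment2 : (\int[nu]_x (x ^+ 2)%:E = 1)%E.
Proof.
have m0 : (0 <= \int[nu]_x (x ^+ 2)%:E)%E.
  by apply: integral_ge0 => x _; rewrite lee_fin sqr_ge0.
have mx2 : measurable_fun setT (fun x : R => (x ^+ 2)%:E).
  exact/measurable_EFinP/measurable_funX.
have up s : 1 < s -> (1 + ((1 - s ^- 2) / 2)%:E * \int[nu]_x (x ^+ 2)%:E <= s%:E)%E.
  move=> s1; have l0 : 0 <= (1 - s ^- 2) / 2.
    by rewrite divr_ge0// subr_ge0 invf_le1 ?exprn_gt0 ?exprn_ege1//; lra.
  rewrite -(@normal_exp_sqr s); last lra.
  rewrite -ge0_integralZl//; last by move=> x _; rewrite lee_fin sqr_ge0.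
  have {1}-> : (1 = \int[nu]_x (cst 1 x) :> \bar R)%E.
    by rewrite integral_cst// mul1e; apply/esym; exact: probability_setT.
  rewrite -ge0_integralD//.
  - apply: ge0_le_integral => //.
    + by move=> x _; rewrite adde_ge0// mule_ge0 ?lee_fin ?sqr_ge0.
    + by apply: emeasurable_funD => //; exact: emeasurable_funM.
    + exact: meas_expsq.
    + by move=> x _; rewrite -EFinM -EFinD lee_fin expR_ge1Dx.
  - by move=> x _; rewrite mule_ge0 ?lee_fin ?sqr_ge0.
  - exact: emeasurable_funM.
have lo s : 0 < s -> s < 1 -> (1 <= s%:E + ((s ^- 2 - 1) / 2)%:E * \int[nu]_x (x ^+ 2)%:E)%E.
  move=> s0 s1; have l0 : 0 <= (s ^- 2 - 1) / 2.
    by rewrite divr_ge0// subr_ge0 invf_ge1 ?exprn_gt0 ?exprn_ile1//; lra.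
  rewrite -(@normal_exp_sqr s)//.
  rewrite -ge0_integralZl//; last by move=> x _; rewrite lee_fin sqr_ge0.
  have {1}-> : (1 = \int[nu]_x (cst 1 x) :> \bar R)%E.
    by rewrite integral_cst// mul1e; apply/esym; exact: probability_setT.
  rewrite -ge0_integralD//.
  - apply: ge0_le_integral => //.
    + apply: emeasurable_funD => //; first exact: meas_expsq.
      exact: emeasurable_funM.
    + move=> x _; rewrite -EFinM -EFinD lee_fin.
      have := expR_ge1Dx ((1 - s ^- 2) / 2 * x ^+ 2); lra.
  - exact: meas_expsq.
  - by move=> x _; rewrite mule_ge0 ?lee_fin ?sqr_ge0.
  - exact: emeasurable_funM.
(* An infinite moment already contradicts the upper estimate at [s = 2]. *)
move: m0 up lo; case: (\int[nu]_x (x ^+ 2)%:E)%E => [m| |]//=; rewrite ?lee_fin => m0 up lo; last first.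
  have := up 2 ltac:(lra); rewrite gt0_muley ?addey// lte_fin.
  have -> : (1 - 2 ^- 2) / 2 = 3 / 8 :> R by field.
  lra.
congr EFin; apply/eqP; rewrite eq_le; apply/andP; split.
- rewrite leNgt; apply/negP => m1.
  (* If m > 1, then m >= 1 + 4t exceeds 2s^2/(s+1) at s = 1 + t. *)
  pose t := Num.min 1 (m - 1) / 4.
  have [t0 t1 tm] : [/\ 0 < t, t <= 1/4 & 4 * t <= m - 1].
    by rewrite /t; have [] := leP 1 (m - 1) => ?; split; lra.
  have := up (1 + t) ltac:(lra); rewrite -EFinM -EFinD lee_fin.
  have p0 : 0 < (1 + t) ^+ 2 by nra.
  rewrite -(ler_pM2l p0) mulrDr mulr1.
  have -> : (1 + t) ^+ 2 * ((1 - (1 + t) ^- 2) / 2 * m) = ((1 + t) ^+ 2 - 1) / 2 * m.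
    by field; rewrite gt_eqF; lra.
  nra.
- rewrite leNgt; apply/negP => m1.
  (* If m < 1, then m = 2s - 1 falls below 2s^2/(s+1). *)
  pose s := (1 + m) / 2.
  have [s0 s1] : 0 < s /\ s < 1 by rewrite /s; split; lra.
  have := lo s s0 s1; rewrite -EFinM -EFinD lee_fin.
  have p0 : 0 < s ^+ 2 by nra.
  rewrite -(ler_pM2l p0) mulrDr mulr1.
  have -> : s ^+ 2 * ((s ^- 2 - 1) / 2 * m) = (1 - s ^+ 2) / 2 * m.
    by field; rewrite gt_eqF.
  have ms : m = 2 * s - 1 by rewrite /s; field.
  rewrite ms; nra.
Qed.

End normal_law.

(** * Gaussian vectors *)

Section tuples.
Context {R : realType} {N : nat}.
Local Open Scope ereal_scope.

(** Tuples carry the product sigma-algebra; joint laws of random row vectors are formed on them. *)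
Definition tup (v : 'rV[R]_N) : N.-tuple R := [tuple v 0%R i | i < N].
Definition row_tup (t : N.-tuple R) : 'rV[R]_N := (\row_i tnth t i)%R.

Lemma tupK v : row_tup (tup v) = v.
Proof. by apply/rowP => i; rewrite mxE tnth_mktuple. Qed.

Lemma measurable_tup d (T : measurableType d) (Y : T -> 'rV[R]_N) :
  (forall i, measurable_fun setT (fun o => Y o 0%R i)) ->
  measurable_fun setT (fun o => tup (Y o)).
Proof.
move=> mY; apply/measurable_fun_tnthP => i.
by apply: eq_measurable_fun (mY i) => x _ /=; rewrite tnth_mktuple.
Qed.

Definition tuple_box (B : 'I_N -> set R) : set (N.-tuple R) :=
  [set t | forall i, B i (tnth t i)].

Lemma measurable_tuple_box B : (forall i, measurable (B i)) ->
  measurable (tuple_box B).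
Proof.
move=> mB; have -> : tuple_box B =
    \bigcap_(i in [set: 'I_N]) ((@tnth N R ^~ i) @^-1` B i).
  by apply/seteqP; split => [t H i _|t H i]; [exact: H|exact: (H i I)].
apply: fin_bigcap_measurable => // i _; rewrite -[X in measurable X]setTI.
exact: measurable_tnth.
Qed.

(** A cylinder is the box whose other sides are the whole line. Boxes are preferred as generators
    because they are stable under intersection. *)
Lemma measurable_tuple_boxes : (measurable : set (set (N.-tuple R))) =
  <<s [set A | exists2 B, (forall i, measurable (B i)) & A = tuple_box B] >>.
Proof.
apply/seteqP; split; last first.
  apply: smallest_sub; first exact: sigma_algebra_measurable.
  by move=> _ [B mB ->]; exact: measurable_tuple_box.
apply: smallest_sub; first exact: smallest_sigma_algebra.
move=> A; rewrite -bigcup_seq/= => -[i _ [B mB <-]]; apply: sub_sigma_algebra.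
exists (fun j => if j == i then B else setT).
  by move=> j; case: ifP.
rewrite setTI; apply/seteqP; split => t /=.
  by move=> H j; case: eqP => // ->.
by move=> /(_ i); rewrite eqxx.
Qed.

(** Uniqueness on a generating family stable under intersection. It fits the definition of Brownian
    motion, which prescribes probabilities of boxes only. *)
Lemma tuple_measure_unique (m1 m2 : {measure set (N.-tuple R) -> \bar R}) :
  m1 setT < +oo ->
  (forall B, (forall i, measurable (B i)) -> m1 (tuple_box B) = m2 (tuple_box B)) ->
  forall A, measurable A -> m1 A = m2 A.
Proof.
move=> m1oo H A mA.
apply: (measure_unique _ (fun=> setT) measurable_tuple_boxes) => //.
- move=> _ _ [B mB ->] [C mC ->]; exists (fun i => B i `&` C i).
    by move=> i; exact: measurableI.
  apply/seteqP; split => t /=.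
    by move=> [tB tC] i; split.
  by move=> tBC; split => i; have [] := tBC i.
- move=> _; exists (fun=> setT) => //.
  by apply/seteqP; split.
- by rewrite bigcup_const//; exists 0%N.
- by move=> _ [B mB ->]; exact: H.
Qed.

End tuples.

Section image_probability.
Local Open Scope ereal_scope.
Context {R : realType} {d1 d2 : measure_display} {T1 : measurableType d1}
  {T2 : measurableType d2}.

(** The image law packed as a probability, so that product measures can be formed from it. *)
Definition pushp (P : probability T1 R) (f : T1 -> T2)
    (mf : measurable_fun setT f) : probability T2 R :=
  let f' : {mfun T1 >-> T2} := HB.pack f (isMeasurableFun.Build _ _ _ _ f mf) in
  distribution P f'.

Lemma ge0_integral_pushp (P : probability T1 R) (f : T1 -> T2)
    (mf : measurable_fun setT f) (g : T2 -> \bar R) :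
  measurable_fun setT g -> (forall y, 0 <= g y) ->
  \int[pushp P mf]_y g y = \int[P]_x g (f x).
Proof. by move=> mg g0; rewrite ge0_integral_pushforward. Qed.

End image_probability.

Section gaussian.
Local Open Scope ereal_scope.
Context {R : realType} {N : nat} {d : measure_display} {T : measurableType d}.
Variable P : probability T R.

(** This is the increment clause of [brownian_motion] for a time step of length 1 and the full
    event. *)
Definition gaussian_vec (W : T -> 'rV[R]_N) : Prop :=
  (forall i, measurable_fun setT (fun o => W o 0%R i)) /\
  forall B, (forall i, measurable (B i)) ->
    P [set o | forall i, B i (W o 0%R i)] = \prod_(i < N) normal_prob 0 1 (B i).

Variable W : T -> 'rV[R]_N.
Hypothesis gW : gaussian_vec W.

Lemma gaussian_coord k (f : R -> \bar R) : measurable_fun setT f ->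
  (forall x, 0 <= f x) ->
  \int[P]_o f (W o 0%R k) = \int[normal_prob 0%R 1%R]_x f x.
Proof.
move=> mf f0; have [mW WE] := gW.
have mWk : measurable_fun setT ((fun o => W o 0%R k) : T -> measurableTypeR R).
  exact: mW.
rewrite -(ge0_integral_pushm P mWk)//.
apply: eq_measure_integral => B mB _.
have := WE (fun i => if i == k then B else setT) _.
rewrite (bigD1 k)//= eqxx big1 ?mule1; last first.
  by move=> i /negbTE ->; exact: probability_setT.
move=> <-; last by move=> i; case: ifP.
have -> : [set o | forall i : 'I_N, (if i == k then B else setT) (W o 0%R i)] =
    (fun o => W o 0%R k) @^-1` B; last by [].
apply/seteqP; split => x /=; last first.
  by move=> H i; case: eqP => // ->.
by move=> /(_ k); rewrite eqxx.
Qed.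

Lemma gaussian_coord2 k : \int[P]_o (W o 0%R k ^+ 2)%:E = 1.
Proof.
rewrite (@gaussian_coord k (fun x => (x ^+ 2)%:E)) ?normal_moment2//.
  exact/measurable_EFinP/measurable_funX.
by move=> x; rewrite lee_fin sqr_ge0.
Qed.

Lemma gaussian_coord4 k : \int[P]_o (W o 0%R k ^+ 4)%:E < +oo.
Proof.
rewrite (@gaussian_coord k (fun x => (x ^+ 4)%:E)) ?normal_moment4_lty//.
  exact/measurable_EFinP/measurable_funX.
by move=> x; rewrite lee_fin exprn_even_ge0.
Qed.

Definition flip_coord (k : 'I_N) (v : 'rV[R]_N) : 'rV[R]_N :=
  (\row_i if i == k then - v 0 i else v 0 i)%R.

(** The flipped vector has the same box probabilities, since one standard normal factor is replaced
    by its mirror image; the laws then coincide on tuples. *)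
Lemma gaussian_flip k (f : 'rV[R]_N -> \bar R) :
  measurable_fun setT (f \o row_tup) -> (forall v, 0 <= f v) ->
  \int[P]_o f (W o) = \int[P]_o f (flip_coord k (W o)).
Proof.
move=> mf f0; have [mW WE] := gW.
have mW' i : measurable_fun setT (fun o => flip_coord k (W o) 0%R i).
  under eq_fun do rewrite mxE.
  have [_|_] := eqVneq i k; last exact: mW.
  by under eq_fun do rewrite -mulN1r; exact: measurable_funM.
under eq_integral do rewrite -[W _]tupK.
under [RHS]eq_integral do rewrite -[flip_coord _ _]tupK.
rewrite -(ge0_integral_pushm P (measurable_tup mW) mf); last by move=> y; exact: f0.
rewrite -(ge0_integral_pushm P (measurable_tup mW') mf); last by move=> y; exact: f0.
apply: eq_measure_integral => A mA _.
apply: tuple_measure_unique mA.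
  rewrite pushmE preimage_setT.
  exact: le_lt_trans (probability_le1 P measurableT) (ltry _).
move=> B mB; rewrite !pushmE.
have -> : (fun x => tup (W x)) @^-1` tuple_box B = [set o | forall i, B i (W o 0%R i)].
  by apply/seteqP; split => x /= H i; have := H i; rewrite tnth_mktuple.
have -> : (fun x => tup (flip_coord k (W x))) @^-1` tuple_box B =
    [set o | forall i, (if i == k then [set x | B i (- x)%R] else B i) (W o 0%R i)].
  apply/seteqP; split => x /= H i; have := H i; rewrite tnth_mktuple mxE;
  by case: eqP.
apply: (etrans (WE B mB)); apply/esym.
apply: (etrans (WE (fun i => if i == k then [set x | B i (- x)%R] else B i) _)).
  move=> i; case: ifP => // _; rewrite -[X in measurable X]setTI.
  by apply: (_ : measurable_fun setT (-%R : R -> R)) => //.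
by apply: eq_bigr => i _; case: eqP => // _; exact: (normal_prob_opp (mB i)).
Qed.

End gaussian.

(** * Independence of the present state and the next increment *)

Section independent_increment.
Local Open Scope ereal_scope.
Context {R : realType} {N : nat} {d : measure_display} {T : measurableType d}.
Variable P : probability T R.
Variables W Y D : T -> 'rV[R]_N.
Hypothesis gW : gaussian_vec P W.
Hypothesis mY : forall i, measurable_fun setT (fun o => Y o 0%R i).
Hypothesis mD : forall i, measurable_fun setT (fun o => D o 0%R i).
Variable s : R.
Hypothesis s0 : (0 < s)%R.
Hypothesis indep : forall (A : set (N.-tuple R)) B, measurable A ->
  (forall i, measurable (B i)) ->
  P ([set o | A (tup (Y o))] `&` [set o | forall i, B i (D o 0%R i)]) =
  P [set o | A (tup (Y o))] * \prod_(i < N) normal_prob 0 s (B i).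

(** The joint law of [Y] and [D] is identified with the product of the law of [Y] and that of
    [s *: W]; Tonelli then freezes the state and averages over a fresh Gaussian vector. *)
Lemma integral_indep (f : 'rV[R]_N -> 'rV[R]_N -> \bar R) :
  measurable_fun setT (fun q : N.-tuple R * N.-tuple R => f (row_tup q.1) (row_tup q.2)) ->
  (forall u v, 0 <= f u v) ->
  \int[P]_o f (Y o) (D o) = \int[P]_o \int[P]_o' f (Y o) (s *: W o').
Proof.
move=> mf f0; have [mW WE] := gW.
have msW i : measurable_fun setT (fun o => (s *: W o)%R 0%R i).
  by under eq_fun do rewrite mxE; exact: measurable_funM.
have mtY := measurable_tup mY; have mtD := measurable_tup mD.
have mtW := measurable_tup msW.
have mp : measurable_fun setT (fun o => (tup (Y o), tup (D o))) by exact: measurable_fun_pair.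
pose F (q : N.-tuple R * N.-tuple R) := f (row_tup q.1) (row_tup q.2).
transitivity (\int[pushp P mtY \x pushp P mtW]_q F q).
  transitivity (\int[pushm P mp]_q F q).
    rewrite ge0_integral_pushm; [|exact: mf|by move=> ?; exact: f0].
    by apply: eq_integral => x _; rewrite /F !tupK.
  apply: eq_measure_integral => X mX _.
  apply/esym; apply: product_measure_unique => // A B mA mB.
  have mEA : measurable [set o | A (tup (Y o))].
    by rewrite -[X in measurable X]setTI; exact: mtY.
  rewrite pushmE.
  have -> : (fun o => (tup (Y o), tup (D o))) @^-1` (A `*` B) =
      (fun o => tup (D o)) @^-1` B `&` [set o | A (tup (Y o))].
    by apply/seteqP; split => x /= [? ?].
  have fE : P [set o | A (tup (Y o))] \is a fin_num by exact: fin_num_measure.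
  pose k : {nonneg R} := NngNum (fine_ge0 (measure_ge0 P [set o | A (tup (Y o))])).
  (* For fixed [A] both sides are finite measures in [B]: the law of [D] under [P] restricted to the
     event on [Y], and a multiple of the law of [s *: W]. By [indep] they agree on boxes. *)
  transitivity (pushm (mrestr P mEA) mtD B) => //.
  transitivity (mscale k (pushm P mtW) B); last first.
    by rewrite /mscale/= fineK.
  apply: tuple_measure_unique => //.
    rewrite pushmE /= /mrestr preimage_setT setTI.
    by rewrite -ge0_fin_numE.
  move=> C mC.
  transitivity (k%:num%:E * P ((fun o => tup (s *: W o)%R) @^-1` tuple_box C)); last by [].
  rewrite /= fineK// /mrestr /pushforward.
  have -> : (fun o => tup (D o)) @^-1` tuple_box C `&` [set o | A (tup (Y o))] =
      [set o | A (tup (Y o))] `&` [set o | forall i, C i (D o 0%R i)].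
    rewrite setIC; congr (_ `&` _).
    by apply/seteqP; split => x /= H i; have := H i; rewrite tnth_mktuple.
  rewrite indep//; congr (_ * _).
  have -> : (fun o => tup (s *: W o)%R) @^-1` tuple_box C =
      [set o | forall i, [set x | C i (s * x)%R] (W o 0%R i)].
    by apply/seteqP; split => x /= H i; have := H i; rewrite tnth_mktuple mxE.
  apply/esym; apply: (etrans (WE (fun i => [set x | C i (s * x)%R]) _)); last first.
    by apply: eq_bigr => i _; exact: (esym (normal_prob_scale s0 (mC i))).
  move=> i; rewrite -[X in measurable X]setTI.
  by apply: (_ : measurable_fun setT (fun x : R => s * x)%R) => //; exact: measurable_funM.
rewrite fubini_tonelli1//; last by move=> x; exact: f0.
rewrite ge0_integral_pushp//; last 2 first.
- by apply: measurable_fun_fubini_tonelli_F => // q; exact: f0.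
- by move=> y; apply: integral_ge0 => ? _; exact: f0.
apply: eq_integral => x _; rewrite /fubini_F ge0_integral_pushp//.
- by apply: eq_integral => y _; rewrite /F !tupK.
- by apply: measurableT_comp mf _; exact: measurable_pair1.
- by move=> y; exact: f0.
Qed.

End independent_increment.

(** * Gaussian means through second differences *)

Section gaussian_expansion.
Local Open Scope ereal_scope.
Context {R : realType} {N : nat} {d : measure_display} {T : measurableType d}.
Variable P : probability T R.
Variable W : T -> 'rV[R]_N.
Hypothesis gW : gaussian_vec P W.
Variable z : 'rV[R]_N -> R.
Hypothesis cz : continuous z.
Hypothesis z0 : forall x, (0 <= z x)%R.
Hypothesis sd0 : forall k a s, (0 <= second_diff z k a s)%R.

(** Raising [n] by one switches a single Gaussian coordinate on. *)
Definition trunc_row (n : nat) (v : 'rV[R]_N) : 'rV[R]_N :=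
  (\row_i if (i < n)%N then v 0 i else 0)%R.

Lemma trunc_row_full v : trunc_row N v = v.
Proof. by apply/rowP => i; rewrite mxE ltn_ord. Qed.

Lemma trunc_row0 v : trunc_row 0 v = 0%R.
Proof. by apply/rowP => i; rewrite !mxE. Qed.

Lemma trunc_rowS (k : 'I_N) v :
  trunc_row k.+1 v = (trunc_row k v + v 0 k *: unitv k)%R.
Proof.
apply/rowP => i; rewrite !mxE eqxx/= ltnS leq_eqVlt.
have [ik|ik] := eqVneq i k.
  by rewrite ik eqxx/= ltnn add0r mulr1.
by rewrite mulr0 addr0 -(inj_eq val_inj) in ik *; rewrite (negbTE ik).
Qed.

Lemma trunc_row_flip (k : 'I_N) v :
  trunc_row k.+1 (flip_coord k v) = (trunc_row k v - v 0 k *: unitv k)%R.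
Proof.
rewrite trunc_rowS mxE eqxx scaleNr; congr (_ - _)%R.
apply/rowP => i; rewrite !mxE; have [->|//] := eqVneq i k.
by rewrite ltnn.
Qed.

Lemma nsq_trunc_row n v : (nsq (trunc_row n v) <= nsq v)%R.
Proof.
apply: ler_sum => i _; rewrite mxE; case: ifP => // _.
by rewrite expr0n sqr_ge0.
Qed.

Lemma measurable_affine_trunc d' (T' : measurableType d') (Y V : T' -> 'rV[R]_N)
    (c : R) (n : nat) :
  (forall i, measurable_fun setT (fun o => Y o 0%R i)) ->
  (forall i, measurable_fun setT (fun o => V o 0%R i)) ->
  forall i, measurable_fun setT (fun o => (Y o + c *: trunc_row n (V o))%R 0%R i).
Proof.
move=> mY mV i; under eq_fun do rewrite !mxE.
by apply: measurable_funD => //; apply: measurable_funM => //; case: (i < n)%N.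
Qed.

Lemma measurable_second_diff d' (T' : measurableType d') (Y : T' -> 'rV[R]_N)
    (u : T' -> R) k :
  (forall i, measurable_fun setT (fun o => Y o 0%R i)) -> measurable_fun setT u ->
  measurable_fun setT (fun o => second_diff z k (Y o) (u o)).
Proof.
move=> mY mu; rewrite /second_diff.
have m1 i : measurable_fun setT (fun o => (Y o + u o *: unitv k)%R 0%R i).
  by under eq_fun do rewrite !mxE; apply: measurable_funD => //; exact: measurable_funM.
have m2 i : measurable_fun setT (fun o => (Y o - u o *: unitv k)%R 0%R i).
  by under eq_fun do rewrite !mxE; apply: measurable_funB => //; exact: measurable_funM.
apply: measurable_funB; last by apply: measurable_funM => //; exact: measurable_fun_row.
by apply: measurable_funD; exact: measurable_fun_row.
Qed.

(** Coordinate [k] and its negative have the same law, so the mean is half the sum over both signs;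
    that half sum is the value with the coordinate switched off plus half a second difference. All
    terms are nonnegative, hence no integrability is at stake. *)
Lemma gaussian_step a c (k : 'I_N) :
  \int[P]_o (z (a + c *: trunc_row k.+1 (W o)))%:E =
  \int[P]_o (z (a + c *: trunc_row k (W o)))%:E +
  \int[P]_o (2^-1 * second_diff z k (a + c *: trunc_row k (W o)) (c * W o 0 k))%:E.
Proof.
have [mW _] := gW.
have ma i : measurable_fun setT (fun o : T => (fun=> a) o 0%R i) by [].
have mz n : measurable_fun setT (fun o => z (a + c *: trunc_row n (W o))%R).
  by apply: measurable_fun_row => //; exact: (measurable_affine_trunc (Y := fun=> a)).
have mf i : measurable_fun setT (fun o => flip_coord k (W o) 0%R i).
  under eq_fun do rewrite mxE.
  have [_|_] := eqVneq i k; last exact: mW.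
  by under eq_fun do rewrite -mulN1r; exact: measurable_funM.
have mzf : measurable_fun setT (fun o => z (a + c *: trunc_row k.+1 (flip_coord k (W o)))%R).
  by apply: measurable_fun_row => //; exact: (measurable_affine_trunc (Y := fun=> a)).
have msd : measurable_fun setT (fun o =>
    second_diff z k (a + c *: trunc_row k (W o))%R (c * W o 0 k)%R).
  apply: measurable_second_diff; last exact: measurable_funM.
  exact: (measurable_affine_trunc (Y := fun=> a)).
have h0 : (0 <= 2^-1 :> R)%R by [].
transitivity (\int[P]_o (2^-1 * z (a + c *: trunc_row k.+1 (W o)))%:E +
    \int[P]_o (2^-1 * z (a + c *: trunc_row k.+1 (flip_coord k (W o))))%:E).
  rewrite -(@gaussian_flip _ _ _ _ P W gW k
    (fun v => (2^-1 * z (a + c *: trunc_row k.+1 v))%:E)).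
  - rewrite -ge0_integralD//.
    + by apply: eq_integral => x _; rewrite -EFinD; congr EFin; field.
    + by move=> x _; rewrite lee_fin mulr_ge0.
    + by apply/measurable_EFinP; exact: measurable_funM.
    + by move=> x _; rewrite lee_fin mulr_ge0.
    + by apply/measurable_EFinP; exact: measurable_funM.
  - apply/measurable_EFinP; apply: measurable_funM => //.
    apply: (@measurable_fun_row _ _ _ _ z (fun t => a + c *: trunc_row k.+1 (row_tup t))%R) => //.
    apply: (measurable_affine_trunc (Y := fun=> a)) => // i.
    by under eq_fun do rewrite mxE; exact: measurable_tnth.
  - by move=> v; rewrite lee_fin mulr_ge0.
rewrite -!ge0_integralD//.
- apply: eq_integral => x _; rewrite -!EFinD; congr EFin.
  rewrite trunc_rowS trunc_row_flip /second_diff scalerDr scalerBr !scalerA !addrA.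
  by field.
- by move=> x _; rewrite lee_fin.
- by apply/measurable_EFinP.
- by move=> x _; rewrite lee_fin mulr_ge0.
- by apply/measurable_EFinP; exact: measurable_funM.
- by move=> x _; rewrite lee_fin mulr_ge0.
- by apply/measurable_EFinP; exact: measurable_funM.
- by move=> x _; rewrite lee_fin mulr_ge0.
- by apply/measurable_EFinP; exact: measurable_funM.
Qed.

(* Switch the coordinates on one after the other; the odd part of each
   increment vanishes by symmetry, leaving a second difference. *)
Lemma gaussian_expand a c :
  \int[P]_o (z (a + c *: W o))%:E = (z a)%:E +
  \sum_(k < N)
    \int[P]_o (2^-1 * second_diff z k (a + c *: trunc_row k (W o)) (c * W o 0 k))%:E.
Proof.
have H n : (n <= N)%N -> \int[P]_o (z (a + c *: trunc_row n (W o)))%:E = (z a)%:E +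
  \sum_(k < N | (k < n)%N)
    \int[P]_o (2^-1 * second_diff z k (a + c *: trunc_row k (W o)) (c * W o 0 k))%:E.
  elim: n => [|n IH] nN.
    rewrite big_pred0// adde0.
    under eq_integral do rewrite trunc_row0 scaler0 addr0.
    by rewrite integral_cst//= probability_setT mule1.
  rewrite (@gaussian_step a c (Ordinal nN))/= IH; last exact: ltnW.
  rewrite [in RHS](bigD1 (Ordinal nN))//= -addeA; congr (_ + _); rewrite addeC; congr (_ + _).
  apply: eq_bigl => k; rewrite ltnS -(inj_eq val_inj)/=.
  by case: ltngtP.
have := H N (leqnn N); under eq_integral do rewrite trunc_row_full.
by move=> ->; congr (_ + _); apply: eq_bigl => k; rewrite ltn_ord.
Qed.

End gaussian_expansion.

(** * Averages at an independent exponential time *)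

Section exponential_time.
Local Open Scope ereal_scope.
Context {R : realType}.
Notation mu := (@lebesgue_measure R).
Variable alpha : R.
Hypothesis alpha0 : (0 < alpha)%R.

(** Set to zero at [t = 0] as well, so that comparisons under the exponential law need be checked at
    strictly positive times only. *)
Definition exp_ker (t : R) : R :=
  if (0 < t)%R then (alpha * expR (- alpha * t))%R else 0%R.

Lemma exp_ker_ge0 t : (0 <= exp_ker t)%R.
Proof.
by rewrite /exp_ker; case: ifP => // _; rewrite mulr_ge0 ?expR_ge0// ltW.
Qed.

Lemma exp_ker_le t : (0 <= t)%R -> (exp_ker t <= alpha)%R.
Proof.
move=> t0; rewrite /exp_ker; case: ifP => [_|_]; last exact: ltW.
rewrite ler_piMr ?(ltW alpha0)// -[leRHS]expR0 ler_expR mulNr oppr_le0.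
by rewrite mulr_ge0// ltW.
Qed.

Lemma exp_ker_ge h t : (0 < t)%R -> (t <= h)%R -> (alpha * expR (- alpha * h) <= exp_ker t)%R.
Proof.
move=> t0 th; rewrite /exp_ker t0 ler_pM2l// ler_expR !mulNr lerN2.
by rewrite ler_pM2l.
Qed.

Lemma measurable_exp_ker : measurable_fun setT exp_ker.
Proof.
have -> : exp_ker = (fun t => (alpha * expR (- alpha * t)) * \1_(`]0%R, +oo[%classic : set R) t)%R.
  apply/funext => t; rewrite /exp_ker indicE.
  have [t0|t0] := ltP 0%R t.
    by rewrite mem_set ?mulr1//= in_itv/= t0.
  by rewrite memNset ?mulr0//= in_itv/= andbT; apply/negP; rewrite -leNgt.
apply: measurable_funM; last exact: measurable_indic.
by apply: measurable_funM => //; apply: measurableT_comp => //; exact: measurable_funM.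
Qed.

Lemma exponential_law : exists rho : probability (measurableTypeR R) R,
  forall f : R -> \bar R, measurable_fun setT f -> (forall t, 0 <= f t) ->
  \int[rho]_t f t = \int[mu]_t (f t * (exp_ker t)%:E).
Proof.
pose rho : probability (measurableTypeR R) R :=
  exponential_distribution_exponential_prob__canonical__probability_measure_Probability alpha0.
exists rho => f mf f0.
have -> : \int[rho]_t f t = \int[mu]_t (f t * (exponential_pdf alpha t)%:E).
  apply: ge0_integral_density => //; first exact: measurable_exponential_pdf.
  by move=> t; apply: exponential_pdf_ge0; exact: ltW.
apply: ge0_ae_eq_integral => //.
- by apply: emeasurable_funM => //; apply/measurable_EFinP; exact: measurable_exponential_pdf.
- by apply: emeasurable_funM => //; apply/measurable_EFinP; exact: measurable_exp_ker.
- by move=> t _; rewrite mule_ge0// lee_fin; apply: exponential_pdf_ge0; exact: ltW.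
- by move=> t _; rewrite mule_ge0// lee_fin exp_ker_ge0.
(* The two versions of the density can differ only at time 0, a null set. *)
exists [set (0%R : R)]; split; first exact: measurable_set1.
  exact: lebesgue_measure_set1.
move=> t /= H; apply/eqP; apply: contra_notT H => t0 _; congr (_ * _%:E).
rewrite /exp_ker; case: ltgtP t0 => // t0 _.
  by rewrite exponential_pdfE ?ltW.
by rewrite lt0_exponential_pdf.
Qed.

Variable rho : probability (measurableTypeR R) R.
Hypothesis rhoE : forall f : R -> \bar R, measurable_fun setT f -> (forall t, 0 <= f t) ->
  \int[rho]_t f t = \int[mu]_t (f t * (exp_ker t)%:E).

Let mker : measurable_fun setT (fun t => (exp_ker t)%:E).
Proof. by apply/measurable_EFinP; exact: measurable_exp_ker. Qed.

Let ker0 t : 0 <= (exp_ker t)%:E.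
Proof. by rewrite lee_fin exp_ker_ge0. Qed.

Lemma exp_time_le (f g : R -> \bar R) :
  measurable_fun setT f -> measurable_fun setT g ->
  (forall t, 0 <= f t) -> (forall t, 0 <= g t) ->
  (forall t, (0 < t)%R -> f t <= g t) -> \int[rho]_t f t <= \int[rho]_t g t.
Proof.
move=> mf mg f0 g0 fg; rewrite !rhoE//; apply: ge0_le_integral => //.
- by move=> t _; rewrite mule_ge0.
- exact: emeasurable_funM.
- exact: emeasurable_funM.
- move=> t _; have [t0|t0] := ltP 0%R t; first by apply: lee_wpmul2r => //; exact: fg.
  by rewrite /exp_ker ltNge t0/= !mule0.
Qed.

(** Lack of memory: translating the variable multiplies the density by exp(alpha h) and moves its
    support to times beyond [h]. *)
Lemma exp_time_shift h (f : R -> \bar R) : (0 <= h)%R ->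
  measurable_fun setT f -> (forall t, 0 <= f t) ->
  \int[rho]_t f (t + h)%R =
    (expR (alpha * h))%:E * \int[rho]_t (f t * (if (h < t)%R then 1 else 0)).
Proof.
move=> h0 mf f0.
have mfh : measurable_fun setT (fun t : R => f (t + h)%R).
  by apply: measurableT_comp mf _; exact: measurable_funD.
have mI : measurable_fun setT (fun t : R => if (h < t)%R then 1 else 0 : \bar R).
  have -> : (fun t : R => if (h < t)%R then 1 else 0 : \bar R) =
      (fun t => (\1_(`]h, +oo[%classic : set R) t)%:E).
    apply/funext => t; rewrite indicE; case: ifPn => ht.
      by rewrite mem_set//= in_itv/= ht.
    by rewrite memNset//= in_itv/= andbT; exact/negP.
  by apply/measurable_EFinP; exact: measurable_indic.
have I0 (t : R) : 0 <= (if (h < t)%R then 1 else 0 : \bar R) by case: ifP.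
rewrite !rhoE//; last 2 first.
- exact: emeasurable_funM.
- by move=> t; rewrite mule_ge0.
rewrite (@ge0_integral_affine R 1 (- h)%R)//; last 2 first.
- exact: emeasurable_funM.
- by move=> t; rewrite mule_ge0.
rewrite mul1e -ge0_integralZl ?lee_fin ?expR_ge0//; last 2 first.
- by do 2 apply: emeasurable_funM => //.
- by move=> t _; rewrite !mule_ge0.
apply: eq_integral => t _; rewrite mul1r subrK /exp_ker subr_gt0.
case: ifPn => ht; last by rewrite !mule0 mul0e mule0.
rewrite mule1 (le_lt_trans h0 ht) muleCA; congr (_ * _).
rewrite -EFinM; congr EFin; rewrite mulrCA -expRD; congr (_ * expR _)%R; ring.
Qed.

(** A given [r] belongs to the window of [t] only for t in [r - h, r], a set of length h on which
    the density is at most exp(alpha h) times its value at [r]. Tonelli puts these together. *)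
Lemma exp_time_window h (f : R -> \bar R) : (0 <= h)%R ->
  measurable_fun setT f -> (forall t, 0 <= f t) ->
  \int[rho]_t \int[mu]_(r in `[t, (t + h)%R]) f r <=
    (h * expR (alpha * h))%:E * \int[rho]_t f t.
Proof.
move=> h0 mf f0.
pose F (q : measurableTypeR R * measurableTypeR R) : \bar R :=
  f q.2 * (\1_[set q : measurableTypeR R * measurableTypeR R | (q.1 <= q.2 <= q.1 + h)%R] q)%:E.
have mE : measurable [set q : measurableTypeR R * measurableTypeR R | (q.1 <= q.2 <= q.1 + h)%R].
  have -> : [set q : measurableTypeR R * measurableTypeR R | (q.1 <= q.2 <= q.1 + h)%R] =
      (fun q => (q.2 - q.1)%R : measurableTypeR R) @^-1` `[0%R, h]%classic.
    by apply/seteqP; split => q /=; rewrite in_itv/= subr_ge0 lerBlDl.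
  rewrite -[X in measurable X]setTI.
  apply: (_ : measurable_fun setT (fun q : measurableTypeR R * measurableTypeR R => (q.2 - q.1)%R)) => //.
  exact: measurable_funB.
have mF : measurable_fun setT F.
  apply: emeasurable_funM; first exact: measurableT_comp.
  by apply/measurable_EFinP; exact: measurable_indic.
have F0 q : 0 <= F q by rewrite mule_ge0// lee_fin.
have E t : \int[mu]_(r in `[t, (t + h)%R]) f r = fubini_F mu F t.
  rewrite integral_mkcond; apply: eq_integral => r _.
  rewrite patchE /F indicE; case: ifPn => rt.
    by rewrite mem_set ?mule1//; move: rt; rewrite inE/= in_itv.
  by rewrite memNset ?mule0//; move: rt; rewrite notin_setE/= in_itv.
have mFF := measurable_fun_fubini_tonelli_F (m2 := mu) F mF F0.
under eq_integral do rewrite E.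
rewrite !rhoE//; last by move=> t; apply: integral_ge0 => r _; exact: F0.
pose F2 (q : measurableTypeR R * measurableTypeR R) : \bar R := F q * (exp_ker q.1)%:E.
have mF2 : measurable_fun setT F2.
  by apply: emeasurable_funM => //; exact: (measurableT_comp mker).
have F20 q : 0 <= F2 q by rewrite mule_ge0.
have -> : \int[mu]_t (fubini_F mu F t * (exp_ker t)%:E) = \int[mu]_t \int[mu]_r F2 (t, r).
  apply: eq_integral => t _.
  rewrite -[RHS]/(\int[mu]_r ((fun r => F (t, r)) r * (exp_ker t)%:E)).
  rewrite ge0_integralZr//.
  exact: measurableT_comp mF (measurable_pair1 _).
rewrite fubini_tonelli// -ge0_integralZl//; last 3 first.
- exact: emeasurable_funM.
- by move=> t _; rewrite mule_ge0.
- by rewrite lee_fin mulr_ge0// expR_ge0.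
apply: ge0_le_integral => //.
- by move=> r _; exact: integral_ge0.
- exact: (measurable_fun_fubini_tonelli_G (m1 := mu) F2).
- by apply: emeasurable_funM => //; exact: emeasurable_funM.
move=> r _.
(* For [0 < t] the density at [t] is exp(alpha (r - t)) times that at [r], and r - t <= h; for the
   other [t] the left side vanishes. *)
have B t : F2 (t, r) <= f r * ((expR (alpha * h))%:E * (exp_ker r)%:E) * (\1_(`[(r - h)%R, r]%classic : set R) t)%:E.
  rewrite /F2 /F indicE /=; case: (boolP (_ \in _)); last by rewrite mule0 mul0e => _; rewrite !mule_ge0// lee_fin ?expR_ge0.
  rewrite inE/= => /andP[tr rt]; rewrite mule1 indicE mem_set/=; last first.
    by rewrite in_itv/= tr lerBlDr rt.
  rewrite mule1; apply: lee_wpmul2l => //; rewrite -EFinM lee_fin.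
  rewrite {1}/exp_ker; case: ifPn => [t0|_]; last by rewrite mulr_ge0 ?expR_ge0 ?exp_ker_ge0.
  rewrite /exp_ker (lt_le_trans t0 tr) mulrCA -expRD ler_pM2l// ler_expR.
  by rewrite !mulNr -mulrBr -mulrN ler_pM2l//; lra.
apply: (@le_trans _ _ (\int[mu]_t (f r * ((expR (alpha * h))%:E * (exp_ker r)%:E) * (\1_(`[(r - h)%R, r]%classic : set R) t)%:E))).
  apply: ge0_le_integral => //.
  - exact: measurableT_comp mF2 (measurable_pair2 _).
  - by apply: emeasurable_funM => //; apply/measurable_EFinP; exact: measurable_indic.
rewrite ge0_integralZl//; last 2 first.
- by apply/measurable_EFinP; exact: measurable_indic.
- by rewrite !mule_ge0// lee_fin expR_ge0.
rewrite integral_indic//= setIT lebesgue_measure_itv/= lte_fin.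
have -> : (if (r - h < r)%R then r%:E - (r - h)%:E else 0) = h%:E.
  case: ifPn => [_|]; first by rewrite -EFinB; congr EFin; ring.
  by rewrite ltrBlDr ltrDl -leNgt => h1; congr EFin; apply/eqP; rewrite eq_le h0 h1.
rewrite -!EFinM -muleA -EFinM muleCA -EFinM.
by have -> : (h * expR (alpha * h) * exp_ker r = expR (alpha * h) * exp_ker r * h)%R by ring.
Qed.

(** Between 0 and [h] the density lies between alpha exp(-alpha h) and alpha. Both bounds are alpha
    h to first order, which suffices for the limit. *)
Lemma exp_time_small h : (0 <= h)%R ->
  (alpha * h * expR (- alpha * h))%:E <=
  \int[rho]_t (if (t <= h)%R then 1 else 0) <= (alpha * h)%:E.
Proof.
move=> h0.
have eqI : (fun t : R => if (t <= h)%R then 1 else 0 : \bar R) =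
    (fun t => (\1_(`]-oo, h]%classic : set R) t)%:E).
  apply/funext => t; rewrite indicE; case: ifPn => ht.
    by rewrite mem_set//= in_itv/= ht.
  by rewrite memNset//= in_itv/=; exact/negP.
have mI : measurable_fun setT (fun t : R => if (t <= h)%R then 1 else 0 : \bar R).
  by rewrite eqI; apply/measurable_EFinP; exact: measurable_indic.
rewrite rhoE//; last by move=> t; case: ifP.
have I0 (c : R) : (0 <= c)%R ->
    (c * h)%:E = \int[mu]_t (c%:E * (\1_(`]0%R, h]%classic : set R) t)%:E).
  move=> c0; rewrite ge0_integralZl//; last first.
    by apply/measurable_EFinP; exact: measurable_indic.
  rewrite integral_indic//= setIT lebesgue_measure_itv/= lte_fin.
  rewrite EFinM; congr (_ * _); case: ifPn => [_|]; first by rewrite -EFinB subr0.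
  by rewrite -leNgt => h1; congr EFin; apply/eqP; rewrite eq_le h0 h1.
have mJ (c : R) : measurable_fun setT (fun t : R => c%:E * (\1_(`]0%R, h]%classic : set R) t)%:E : \bar R).
  by apply: emeasurable_funM => //; apply/measurable_EFinP; exact: measurable_indic.
apply/andP; split.
  rewrite mulrAC I0; last by rewrite mulr_ge0 ?expR_ge0// ltW.
  apply: ge0_le_integral => //.
  - by move=> t _; rewrite -EFinM lee_fin !mulr_ge0 ?expR_ge0// ltW.
  - exact: mJ.
  - exact: emeasurable_funM.
  - move=> t _; rewrite indicE; case: (boolP (_ \in _)); last first.
      by move=> _; rewrite mule0 mule_ge0//; case: ifP.
    rewrite inE/= in_itv/= => /andP[t0 th]; rewrite th mule1 mul1e lee_fin.
    exact: exp_ker_ge.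
rewrite I0; last exact: ltW.
apply: ge0_le_integral => //.
- by move=> t _; rewrite mule_ge0//; case: ifP.
- exact: emeasurable_funM.
- exact: mJ.
- move=> t _; case: ifPn => th; last by rewrite mul0e -EFinM lee_fin mulr_ge0// ltW.
  rewrite mul1e indicE; case: (boolP (_ \in _)) => [_|].
    rewrite mule1 lee_fin; have [t0|t0] := leP 0%R t; first exact: exp_ker_le.
    by rewrite /exp_ker ltNge ltW//= ltW.
  rewrite notin_setE/= in_itv/= th andbT => /negP; rewrite mule0 -leNgt => t0.
  by rewrite /exp_ker ltNge t0.
Qed.

End exponential_time.

(** * Limits of averages *)

Section dominated.
Local Open Scope ereal_scope.
Context {R : realType} {d : measure_display} {T : measurableType d}.
Variable mu : {measure set T -> \bar R}.

Lemma ge0_dominated_cvg (f_ : nat -> T -> R) (f g : T -> R) :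
  (forall n, measurable_fun setT (f_ n)) -> measurable_fun setT f ->
  measurable_fun setT g ->
  (forall x, f_ n x @[n --> \oo] --> f x) ->
  (forall n x, (0 <= f_ n x <= g x)%R) -> \int[mu]_x (g x)%:E < +oo ->
  \int[mu]_x (f_ n x)%:E @[n --> \oo] --> \int[mu]_x (f x)%:E.
Proof.
move=> mf_ mf mg cvf f_g ig.
have g0 x : (0 <= g x)%R by have /andP[] := f_g 0%N x; exact: le_trans.
have [] := @dominated_convergence _ T R mu setT measurableT
  (fun n x => (f_ n x)%:E) (fun x => (f x)%:E) (fun x => (g x)%:E).
- by move=> n; exact/measurable_EFinP.
- exact/measurable_EFinP.
- by apply/aeW => x _; apply/cvg_EFin; [exact: nearW|exact: cvf].
- apply/integrableP; split; first exact/measurable_EFinP.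
  by under eq_integral do rewrite /= ger0_norm//.
- apply/aeW => x n _; rewrite /= lee_fin; have /andP[h1 h2] := f_g n x.
  by rewrite ger0_norm.
- by [].
Qed.

Lemma ge0_integral_lty (f g : T -> R) : measurable_fun setT f -> measurable_fun setT g ->
  (forall x, (0 <= f x <= g x)%R) -> \int[mu]_x (g x)%:E < +oo ->
  \int[mu]_x (f x)%:E < +oo.
Proof.
move=> mf mg fg; apply: le_lt_trans; apply: ge0_le_integral => //.
- by move=> x _; rewrite lee_fin; have /andP[] := fg x.
- exact/measurable_EFinP.
- exact/measurable_EFinP.
- by move=> x _; rewrite lee_fin; have /andP[] := fg x.
Qed.

End dominated.

Section quadratic.
Context {R : realType} {N : nat}.

Lemma continuous_coord (i : 'I_N) : continuous (fun v : 'rV[R]_N => v 0 i).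
Proof. exact: coord_continuous. Qed.

Lemma continuous_nsq : continuous (@nsq R N).
Proof.
move=> v; apply: (@cvg_sumr _ _ (nbhs v) (nbhs_filter v)) => i _.
by apply: (cvg_comp (fun v : 'rV[R]_N => v 0 i) (fun x => x ^+ 2)); [exact: continuous_coord|exact: sqr_continuous].
Qed.

End quadratic.

Ltac nneg := repeat first
  [ done | exact: sqr_ge0 | exact: nsq_ge0 | apply: addr_ge0 | apply: mulr_ge0 ].

(** * Limits averaged over the state and an independent Gaussian vector *)

Section averaged_limits.
Local Open Scope ereal_scope.
Context {R : realType} {N : nat} {d : measure_display} {T : measurableType d}.
Variable P : probability T R.
Variable W : T -> 'rV[R]_N.
Hypothesis gW : gaussian_vec P W.
Context {d' : measure_display} {T' : measurableType d'}.
Variable Q : {sigma_finite_measure set T' -> \bar R}.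
Hypothesis Q1 : Q setT = 1.
Variable Y : T' -> 'rV[R]_N.
Hypothesis mY : forall i, measurable_fun setT (fun q => Y q 0%R i).
Hypothesis Y2 : \int[Q]_q (nsq (Y q))%:E < +oo.
Variable sigma : R.
Variable s : nat -> R.
Hypothesis s0 : forall n, (0 < s n <= 1)%R.
Hypothesis scvg : s n @[n --> \oo] --> 0%R.

Let mW i : measurable_fun setT (fun o => W o 0%R i). Proof. by have [] := gW. Qed.

Let mY2 i : measurable_fun setT (fun q : T' * T => Y q.1 0%R i).
Proof. exact: (measurableT_comp (mY i)). Qed.

Let mW2 i : measurable_fun setT (fun q : T' * T => W q.2 0%R i).
Proof. exact: (measurableT_comp (mW i)). Qed.

Let mnY : measurable_fun setT (fun q : T' * T => nsq (Y q.1)).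
Proof. by apply: measurable_fun_row => //; exact: continuous_nsq. Qed.

Let mnW : measurable_fun setT (fun q : T' * T => nsq (W q.2)).
Proof. by apply: measurable_fun_row => //; exact: continuous_nsq. Qed.

Let mnY1 : measurable_fun setT (fun q => nsq (Y q)).
Proof. by apply: measurable_fun_row => //; exact: continuous_nsq. Qed.

Let mnW1 : measurable_fun setT (fun o => nsq (W o)).
Proof. by apply: measurable_fun_row => //; exact: continuous_nsq. Qed.

Lemma gaussian_nsq : \int[P]_o (nsq (W o))%:E = N%:R%:E.
Proof.
under eq_integral do rewrite -sumEFin.
rewrite ge0_integral_sum//.
- under eq_bigr do rewrite (gaussian_coord2 gW).
  by rewrite (eq_bigr (fun=> (1%R)%:E))// sumEFin sumr_const card_ord.
- by move=> i; apply/measurable_EFinP; exact: measurable_funX.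
- by move=> i o _; rewrite lee_fin sqr_ge0.
Qed.

(** From ab <= a^2 + b^2 with squared coordinates, the bound is by fourth moments. The product
    occurs because the squared random step multiplies a second partial of quadratic growth. *)
Lemma gaussian_sqr_nsq k : \int[P]_o (W o 0%R k ^+ 2 * nsq (W o))%:E < +oo.
Proof.
apply: (@ge0_integral_lty _ _ _ P _ (fun o => \sum_i (W o 0 k ^+ 4 + W o 0 i ^+ 4))%R).
- by apply: measurable_funM => //; exact: measurable_funX.
- by apply: measurable_sum => i; apply: measurable_funD; exact: measurable_funX.
- move=> o; rewrite mulr_ge0 ?sqr_ge0 ?nsq_ge0//= /nsq mulr_sumr; apply: ler_sum => i _.
  have -> : (W o 0 k ^+ 4 = (W o 0 k ^+ 2) ^+ 2)%R by rewrite -exprM.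
  have -> : (W o 0 i ^+ 4 = (W o 0 i ^+ 2) ^+ 2)%R by rewrite -exprM.
  have := sqr_ge0 (W o 0%R k); have := sqr_ge0 (W o 0%R i).
  move: (W o 0%R k ^+ 2)%R (W o 0%R i ^+ 2)%R => a b; nra.
- under eq_integral do rewrite -sumEFin.
  rewrite ge0_integral_sum//.
  + apply: lte_sum_pinfty => i _; under eq_integral do rewrite EFinD.
    rewrite ge0_integralD//; first by rewrite lte_add_pinfty// gaussian_coord4.
    * by move=> o _; rewrite lee_fin exprn_even_ge0.
    * by apply/measurable_EFinP; exact: measurable_funX.
    * by move=> o _; rewrite lee_fin exprn_even_ge0.
    * by apply/measurable_EFinP; exact: measurable_funX.
  + by move=> i; apply/measurable_EFinP; apply: measurable_funD; exact: measurable_funX.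
  + by move=> i o _; rewrite lee_fin addr_ge0// exprn_even_ge0.
Qed.

(** Every dominating function below is affine in |Y|^2 with coefficients depending on [W], so its
    integral splits under the product measure. *)
Let integral_prod_lty (f : T' * T -> R) (h1 h2 : T -> R) :
  measurable_fun setT f ->  (forall q, (0 <= f q)%R) ->
  measurable_fun setT h1 -> measurable_fun setT h2 ->
  (forall o, (0 <= h1 o)%R) -> (forall o, (0 <= h2 o)%R) ->
  \int[P]_o (h1 o)%:E < +oo -> \int[P]_o (h2 o)%:E < +oo ->
  (forall q, (f q <= h1 q.2 * nsq (Y q.1) + h2 q.2)%R) ->
  \int[(Q \x P)]_q (f q)%:E < +oo.
Proof.
move=> mf f0 mh1 mh2 h10 h20 i1 i2 fh.
have mg : measurable_fun setT (fun q : T' * T => h1 q.2 * nsq (Y q.1) + h2 q.2)%R.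
  apply: measurable_funD; last exact: (measurableT_comp mh2).
  by apply: measurable_funM => //; exact: (measurableT_comp mh1).
apply: (@ge0_integral_lty _ _ _ (Q \x P)%E _ _ mf mg).
  by move=> q; rewrite f0 fh.
have g0 q : (0 <= h1 q.2 * nsq (Y q.1) + h2 q.2)%R.
  by rewrite addr_ge0// mulr_ge0// nsq_ge0.
rewrite fubini_tonelli1; [|exact/measurable_EFinP|by move=> q; rewrite lee_fin].
rewrite /fubini_F/=.
have E q : \int[P]_o (h1 o * nsq (Y q) + h2 o)%:E =
    (nsq (Y q))%:E * \int[P]_o (h1 o)%:E + \int[P]_o (h2 o)%:E.
  under eq_integral do rewrite EFinD EFinM muleC.
  rewrite ge0_integralD//.
  - rewrite ge0_integralZl//; [exact/measurable_EFinP|by move=> o _; rewrite lee_fin|].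
    by rewrite lee_fin nsq_ge0.
  - by move=> o _; rewrite -EFinM lee_fin mulr_ge0// nsq_ge0.
  - by apply: emeasurable_funM => //; exact/measurable_EFinP.
  - by move=> o _; rewrite lee_fin.
  - exact/measurable_EFinP.
under eq_integral do rewrite E.
have I10 : 0 <= \int[P]_o (h1 o)%:E by apply: integral_ge0 => o _; rewrite lee_fin.
have I20 : 0 <= \int[P]_o (h2 o)%:E by apply: integral_ge0 => o _; rewrite lee_fin.
rewrite ge0_integralD//; last 2 first.
- by move=> q _; rewrite mule_ge0// lee_fin nsq_ge0.
- by apply: emeasurable_funM => //; exact/measurable_EFinP.
rewrite ge0_integralZr//; last 2 first.
- exact/measurable_EFinP.
- by move=> q _; rewrite lee_fin nsq_ge0.
rewrite lte_add_pinfty//; first by rewrite lte_mul_pinfty// ?ge0_fin_numE// integral_ge0// => q _; rewrite lee_fin nsq_ge0.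
by rewrite integral_cst//= Q1 mule1.
Qed.

Variable g : 'rV[R]_N -> R.
Hypothesis cg : continuous g.
Variable K : R.
Hypothesis gK : forall v, (0 <= g v <= K * (1 + nsq v))%R.

Let K0 : (0 <= K)%R.
Proof.
have /andP[h1 h2] := gK 0%R; have := le_trans h1 h2.
by rewrite pmulr_lge0// ltr_wpDr// nsq_ge0.
Qed.

Lemma integral_quadratic_lty : \int[Q]_q (g (Y q))%:E < +oo.
Proof.
apply: (@ge0_integral_lty _ _ _ Q _ (fun q => K * (1 + nsq (Y q)))%R) => //.
- exact: measurable_fun_row.
- by apply: measurable_funM => //; exact: measurable_funD.
under eq_integral do rewrite EFinM EFinD.
rewrite ge0_integralZl//; last 2 first.
- by apply: emeasurable_funD => //; exact/measurable_EFinP.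
- by move=> q _; rewrite -EFinD lee_fin addr_ge0// nsq_ge0.
rewrite ge0_integralD//; last 2 first.
- by move=> q _; rewrite lee_fin nsq_ge0.
- exact/measurable_EFinP.
rewrite lte_mul_pinfty//; last first.
  by rewrite lte_add_pinfty// integral_cst//= Q1 mule1 ltry.
Qed.

(** Dominated convergence on the product space; since [s n <= 1], the quadratic growth of [g] gives
    a majorant free of [n]. *)
Lemma cvg_integral_perturbed :
  \int[Q]_q \int[P]_o (g (Y q + (s n * sigma) *: W o))%:E @[n --> \oo] -->
  \int[Q]_q (g (Y q))%:E.
Proof.
have mg n : measurable_fun setT (fun q : T' * T => g (Y q.1 + (s n * sigma) *: W q.2)%R).
  apply: measurable_fun_row => // i; under eq_fun do rewrite !mxE.
  by apply: measurable_funD => //; exact: measurable_funM.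
have -> : (fun n => \int[Q]_q \int[P]_o (g (Y q + (s n * sigma) *: W o))%:E) =
    (fun n => \int[(Q \x P)]_q (g (Y q.1 + (s n * sigma) *: W q.2)%R)%:E).
  apply/funext => n; rewrite fubini_tonelli1//; first exact/measurable_EFinP.
  by move=> q; rewrite lee_fin; have /andP[] := gK (Y q.1 + (s n * sigma) *: W q.2)%R.
have -> : \int[Q]_q (g (Y q))%:E = \int[(Q \x P)]_q (g (Y q.1))%:E.
  rewrite fubini_tonelli1//.
  - by apply: eq_integral => q _; rewrite /fubini_F/= integral_cst//= probability_setT mule1.
  - by apply/measurable_EFinP; exact: measurable_fun_row.
  - by move=> q; rewrite lee_fin; have /andP[] := gK (Y q.1).
pose dom (q : T' * T) := (2 * K * nsq (Y q.1) + (K + 2 * K * sigma ^+ 2 * nsq (W q.2)))%R.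
apply: (@ge0_dominated_cvg _ _ _ (Q \x P)%E _ _ dom).
- exact: mg.
- exact: measurable_fun_row.
- apply: measurable_funD; first exact: measurable_funM.
  by apply: measurable_funD => //; exact: measurable_funM.
- move=> q; apply: (cvg_comp (fun n => Y q.1 + (s n * sigma) *: W q.2)%R g); last exact: cg.
  have : (Y q.1 + (s n * sigma) *: W q.2)%R @[n --> \oo] --> (Y q.1 + (0 * sigma) *: W q.2)%R.
    apply: cvgD; first exact: cvg_cst.
    by apply: cvgZr_tmp; exact: cvgMr_tmp.
  by rewrite mul0r scale0r addr0.
- move=> n q; have /andP[-> h2] := gK (Y q.1 + (s n * sigma) *: W q.2)%R.
  apply: (le_trans h2); rewrite /dom.
  have := nsqD (Y q.1) ((s n * sigma) *: W q.2); rewrite nsqZ exprMn.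
  have /andP[sn0 sn1] := s0 n.
  have s2 : (s n ^+ 2 <= 1)%R by nra.
  have : (s n ^+ 2 * sigma ^+ 2 * nsq (W q.2) <= sigma ^+ 2 * nsq (W q.2))%R.
    rewrite -[leRHS]mul1r -mulrA ler_wpM2r//.
    by rewrite mulr_ge0 ?sqr_ge0 ?nsq_ge0.
  move=> h4 h5.
  have h6 : (K * nsq (Y q.1 + (s n * sigma) *: W q.2) <=
      K * (2 * nsq (Y q.1) + 2 * (sigma ^+ 2 * nsq (W q.2))))%R.
    by rewrite ler_wpM2l// (le_trans h5)// lerD2l ler_pM2l.
  lra.
- apply: (@integral_prod_lty dom (fun=> (2 * K)%R) (fun o => (K + 2 * K * sigma ^+ 2 * nsq (W o))%R)) => //.
  + apply: measurable_funD; first exact: measurable_funM.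
    by apply: measurable_funD => //; exact: measurable_funM.
  + by move=> q; rewrite /dom; nneg.
  + by apply: measurable_funD => //; exact: measurable_funM.
  + by move=> _; rewrite mulr_ge0.
  + by move=> o; nneg.
  + by rewrite integral_cst//= probability_setT mule1 ltry.
  + under eq_integral do rewrite EFinD.
    rewrite ge0_integralD//; last 2 first.
    * by move=> o _; rewrite lee_fin; nneg.
    * by apply/measurable_EFinP; exact: measurable_funM.
    rewrite integral_cst//= probability_setT mule1 lte_add_pinfty ?ltry//.
    under eq_integral do rewrite EFinM.
    rewrite ge0_integralZl ?gaussian_nsq -?EFinM ?ltry//.
    * exact/measurable_EFinP.
    * by move=> o _; rewrite lee_fin nsq_ge0.
    * by rewrite lee_fin; nneg.
Qed.

Variables (z : 'rV[R]_N -> R) (k : 'I_N).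
Hypothesis cz : continuous z.
Hypothesis sd0 : forall a t, (0 <= second_diff z k a t)%R.
Hypothesis dz : forall v, derivable z v (unitv k).
Hypothesis ddz : forall v, derivable (partial k z) v (unitv k).
Hypothesis gE : partial k (partial k z) = g.

(** The intermediate point lies within [t] of [a], so its squared norm is at most 2|a|^2 + 2t^2. *)
Let sdK a t : (second_diff z k a t <= t ^+ 2 * (K * (1 + 2 * nsq a + 2 * t ^+ 2)))%R.
Proof.
have [r rt ->] := @second_diff_mean _ _ z k a t dz ddz.
rewrite ler_wpM2l ?sqr_ge0// gE.
have /andP[_ h] := gK (a + r *: unitv k)%R; apply: (le_trans h).
rewrite ler_wpM2l// -addrA lerD2l.
apply: (le_trans (nsqD _ _)); rewrite nsqZ nsq_unitv mulr1 lerD2l ler_pM2l//.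
by rewrite -(real_normK (num_real t)) -(real_normK (num_real r)) lerXn2r ?nnegrE.
Qed.

(** Pointwise, the quotient tends to half of (sigma W_k)^2 times the second partial at [Y];
    independence and the unit second moment of W_k leave sigma^2/2. This replaces the second-order
    term of Itô's formula. *)
Lemma cvg_integral_second_diff :
  \int[Q]_q \int[P]_o (2^-1 * second_diff z k
      (Y q + (s n * sigma) *: trunc_row k (W o)) (s n * sigma * W o 0 k) / s n ^+ 2)%:E
    @[n --> \oo] -->
  (sigma ^+ 2 / 2)%:E * \int[Q]_q (g (Y q))%:E.
Proof.
pose f n (q : T' * T) := (2^-1 * second_diff z k
  (Y q.1 + (s n * sigma) *: trunc_row k (W q.2)) (s n * sigma * W q.2 0 k) / s n ^+ 2)%R.
pose f' (q : T' * T) := (2^-1 * ((sigma * W q.2 0 k) ^+ 2 * g (Y q.1)))%R.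
have g0 v : (0 <= g v)%R by have /andP[] := gK v.
have mf n : measurable_fun setT (f n).
  apply: measurable_funM => //; apply: measurable_funM => //.
  apply: measurable_second_diff => //; last exact: measurable_funM.
  exact: measurable_affine_trunc.
have mf' : measurable_fun setT f'.
  apply: measurable_funM => //; apply: measurable_funM; last exact: measurable_fun_row.
  by apply: measurable_funX; exact: measurable_funM.
have f0 n q : (0 <= f n q)%R.
  by rewrite /f !mulr_ge0// invr_ge0 sqr_ge0.
have -> : (fun n => \int[Q]_q \int[P]_o (2^-1 * second_diff z k
      (Y q + (s n * sigma) *: trunc_row k (W o)) (s n * sigma * W o 0 k) / s n ^+ 2)%:E) =
    (fun n => \int[(Q \x P)]_q (f n q)%:E).
  apply/funext => n; rewrite fubini_tonelli1//; first exact/measurable_EFinP.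
  by move=> q; rewrite lee_fin.
have -> : (sigma ^+ 2 / 2)%:E * \int[Q]_q (g (Y q))%:E = \int[(Q \x P)]_q (f' q)%:E.
  rewrite fubini_tonelli1.
  - rewrite -ge0_integralZl//; last 3 first.
    + by apply/measurable_EFinP; exact: measurable_fun_row.
    + by move=> q _; rewrite lee_fin.
    + by rewrite lee_fin divr_ge0// sqr_ge0.
    apply: eq_integral => q _; rewrite /fubini_F /f'/=.
    transitivity (\int[P]_o ((sigma ^+ 2 / 2 * g (Y q))%:E * (W o 0%R k ^+ 2)%:E)).
      rewrite ge0_integralZl ?(gaussian_coord2 gW) ?mule1//.
      + by apply/measurable_EFinP; exact: measurable_funX.
      + by move=> o _; rewrite lee_fin sqr_ge0.
      + by rewrite lee_fin mulr_ge0// divr_ge0// sqr_ge0.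
    by apply: eq_integral => o _; rewrite -EFinM; congr EFin; field.
  - exact/measurable_EFinP.
  - by move=> q; rewrite lee_fin mulr_ge0// mulr_ge0// sqr_ge0.
(* [C] is large enough for the majorant minus the bound from [sdK] to be an explicit sum of
   nonnegative terms, displayed at the end of this estimate. *)
pose C := (K * (1 + 4 * sigma ^+ 2) * sigma ^+ 2 * 2)%R.
pose dom (q : T' * T) := (C * W q.2 0 k ^+ 2 * nsq (Y q.1) + C * (W q.2 0 k ^+ 2 + W q.2 0 k ^+ 2 * nsq (W q.2)))%R.
have C0 : (0 <= C)%R.
  by rewrite /C; nneg.
have mdom : measurable_fun setT dom.
  apply: measurable_funD; apply: measurable_funM => //.
    by apply: measurable_funM => //; exact: measurable_funX.
  by apply: measurable_funD; [|apply: measurable_funM => //]; exact: measurable_funX.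
apply: (@ge0_dominated_cvg _ _ _ (Q \x P)%E _ _ dom) => //.
- move=> q; rewrite /f /f'.
  under eq_fun do rewrite -!mulrA.
  apply: cvgMl_tmp.
  have := @cvg_second_diff _ _ z k (fun n => Y q.1 + (s n * sigma) *: trunc_row k (W q.2))%R
    (Y q.1) s (sigma * W q.2 0%R k)%R dz ddz _ _ scvg _.
  rewrite gE; apply.
  + exact: cg.
  + have : (Y q.1 + (s n * sigma) *: trunc_row k (W q.2))%R @[n --> \oo] -->
      (Y q.1 + (0 * sigma) *: trunc_row k (W q.2))%R.
      apply: cvgD; first exact: cvg_cst.
      by apply: cvgZr_tmp; exact: cvgMr_tmp.
    by rewrite mul0r scale0r addr0.
  + by move=> n; have /andP[h _] := s0 n; rewrite gt_eqF.
- move=> n q; rewrite f0/=.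
  have /andP[sn0 sn1] := s0 n.
  have s2 : (0 < s n ^+ 2)%R by rewrite exprn_gt0.
  have s21 : (s n ^+ 2 <= 1)%R by nra.
  rewrite /f; set A := (Y q.1 + _)%R; set t := (s n * sigma * _)%R.
  have := sdK A t; set D := second_diff _ _ _ _ => DK.
  have W2 : (W q.2 0%R k ^+ 2 <= nsq (W q.2))%R by exact: nsq_coord.
  have shrink (c : R) : (0 <= c -> s n ^+ 2 * c <= c)%R.
    by move=> c0; rewrite -[leRHS]mul1r ler_wpM2r.
  have tE : (t ^+ 2 = s n ^+ 2 * (sigma ^+ 2 * W q.2 0 k ^+ 2))%R by rewrite /t !exprMn mulrA.
  have t2 : (t ^+ 2 <= sigma ^+ 2 * nsq (W q.2))%R.
    rewrite tE; apply: (le_trans (shrink _ _)); first by nneg.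
    by rewrite ler_wpM2l ?sqr_ge0.
  have A2 : (nsq A <= 2 * nsq (Y q.1) + 2 * (sigma ^+ 2 * nsq (W q.2)))%R.
    apply: (le_trans (nsqD _ _)); rewrite lerD2l ler_pM2l// nsqZ exprMn -mulrA.
    apply: (le_trans (shrink _ _)); first by nneg.
    by rewrite ler_wpM2l ?sqr_ge0// nsq_trunc_row.
  have h1 : (t ^+ 2 * (K * (1 + 2 * nsq A + 2 * t ^+ 2)) <=
      t ^+ 2 * (K * (1 + 4 * nsq (Y q.1) + 6 * (sigma ^+ 2 * nsq (W q.2)))))%R.
    by rewrite ler_wpM2l ?sqr_ge0// ler_wpM2l//; lra.
  have {DK h1} := le_trans DK h1; rewrite tE => DK.
  rewrite ler_pdivrMr// /dom.
  apply: (@le_trans _ _ (2^-1 * (s n ^+ 2 * (sigma ^+ 2 * W q.2 0 k ^+ 2) *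
    (K * (1 + 4 * nsq (Y q.1) + 6 * (sigma ^+ 2 * nsq (W q.2)))))))%R.
    by rewrite ler_pM2l.
  rewrite -subr_ge0.
  have -> : ((C * W q.2 0 k ^+ 2 * nsq (Y q.1) + C * (W q.2 0 k ^+ 2 + W q.2 0 k ^+ 2 * nsq (W q.2))) * s n ^+ 2 -
    2^-1 * (s n ^+ 2 * (sigma ^+ 2 * W q.2 0 k ^+ 2) *
    (K * (1 + 4 * nsq (Y q.1) + 6 * (sigma ^+ 2 * nsq (W q.2))))))%R =
    (s n ^+ 2 * (sigma ^+ 2 * W q.2 0 k ^+ 2) * K *
      (3 / 2 + 8 * sigma ^+ 2 * nsq (Y q.1) + 8 * sigma ^+ 2 + 2 * nsq (W q.2) + 5 * sigma ^+ 2 * nsq (W q.2)))%R.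
    by rewrite /C; field.
  by nneg.
- apply: (@integral_prod_lty dom (fun o => C * W o 0 k ^+ 2)%R
    (fun o => C * (W o 0 k ^+ 2 + W o 0 k ^+ 2 * nsq (W o)))%R) => //.
  + by move=> q; rewrite /dom; nneg.
  + by apply: measurable_funM => //; exact: measurable_funX.
  + apply: measurable_funM => //.
    by apply: measurable_funD; [|apply: measurable_funM => //]; exact: measurable_funX.
  + by move=> o; rewrite mulr_ge0// sqr_ge0.
  + by move=> o; nneg.
  + under eq_integral do rewrite EFinM.
    rewrite ge0_integralZl ?(gaussian_coord2 gW) ?mule1 ?ltry//.
    * by apply/measurable_EFinP; exact: measurable_funX.
    * by move=> o _; rewrite lee_fin sqr_ge0.
  + under eq_integral do rewrite EFinM EFinD.
    rewrite ge0_integralZl//; last 2 first.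
    * apply: emeasurable_funD; apply/measurable_EFinP; first exact: measurable_funX.
      by apply: measurable_funM => //; exact: measurable_funX.
    * by move=> o _; rewrite -EFinD lee_fin; nneg.
    rewrite ge0_integralD//; last 4 first.
    * by move=> o _; rewrite lee_fin sqr_ge0.
    * by apply/measurable_EFinP; exact: measurable_funX.
    * by move=> o _; rewrite lee_fin mulr_ge0 ?sqr_ge0 ?nsq_ge0.
    * by apply/measurable_EFinP; apply: measurable_funM => //; exact: measurable_funX.
    rewrite (gaussian_coord2 gW) lte_mul_pinfty//.
    by rewrite lte_add_pinfty ?ltry// gaussian_sqr_nsq.
Qed.

End averaged_limits.

(** * One-step inequalities *)

Section interval_integrals.
Local Open Scope ereal_scope.
Context {R : realType}.
Notation mu := (@lebesgue_measure R).

Lemma lebesgue_window (t h : R) : (0 <= h)%R -> mu `[t, (t + h)%R] = h%:E.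
Proof.
move=> h0; rewrite lebesgue_measure_itv/= lte_fin.
case: ifPn => [_|]; first by rewrite -EFinB; congr EFin; ring.
by rewrite ltrDl -leNgt => h1; congr EFin; apply/eqP; rewrite eq_le h0 h1.
Qed.

(** Cauchy-Schwarz on a window, by integrating (f - c)^2 >= 0 with [c] the mean value of [f]. *)
Lemma sqr_Rintegral_le (t h : R) (f : R -> R) : (0 < h)%R ->
  mu.-integrable `[t, (t + h)%R] (EFin \o f) ->
  ((\int[mu]_(r in `[t, (t + h)%R]) f r) ^+ 2 / h)%:E <=
  \int[mu]_(r in `[t, (t + h)%R]) (f r ^+ 2)%:E.
Proof.
move=> h0 fi; set A := `[t, _]%classic.
have mA : measurable A by exact: measurable_itv.
have mf : measurable_fun A f by apply/measurable_EFinP; exact: measurable_int fi.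
have muA : mu A = h%:E by rewrite lebesgue_window// ltW.
(* Only [f] is assumed integrable; for an infinite integral of the square there is nothing to
   prove. *)
have [->|fin] := eqVneq (\int[mu]_(r in A) (f r ^+ 2)%:E) +oo; first exact: leey.
have f2i : mu.-integrable A (EFin \o (fun r => f r ^+ 2)%R).
  apply/integrableP; split; first by apply/measurable_EFinP; exact: measurable_funX.
  under eq_integral do rewrite /= ger0_norm ?sqr_ge0//.
  by rewrite ltey.
have ci (c : R) : mu.-integrable A (EFin \o cst c).
  apply/integrableP; split; first exact/measurable_EFinP.
  rewrite (eq_integral (cst (`|c|%:E)))// integral_cst//=.
  by rewrite [X in _ * X](_ : _ = h%:E)// -EFinM ltry.
rewrite -[leRHS]fineK; last first.
  by rewrite fin_numE fin andbT gt_eqF// (lt_le_trans ltNy0)// integral_ge0// => r _; rewrite lee_fin sqr_ge0.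
rewrite lee_fin -/(Rintegral mu A (fun r => f r ^+ 2)%R).
set I := Rintegral mu A f.
pose c := (I / h)%R.
have H : (\int[mu]_(r in A) (2 * c * f r) <= \int[mu]_(r in A) (f r ^+ 2 + c ^+ 2))%R.
  apply: le_Rintegral => //.
  - rewrite (_ : _ \o _ = (fun r => (2 * c)%:E * (EFin \o f) r)); first exact: integrableZl.
    by apply/funext => r /=; rewrite EFinM.
  - rewrite (_ : _ \o _ = (EFin \o (fun r => f r ^+ 2)%R) \+ (EFin \o cst (c ^+ 2)%R)).
      exact: integrableD.
    by apply/funext => r /=; rewrite EFinD.
  - by move=> r _; have := sqr_ge0 (f r - c)%R; nra.
rewrite RintegralZl// RintegralD// in H; last exact: (ci (c ^+ 2)%R).
have cE : (\int[mu]_(r in A) c ^+ 2 = c ^+ 2 * h)%R by rewrite Rintegral_cst//= -[in RHS](_ : fine (mu A) = h)// muA.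
rewrite cE -/I in H.
have e1 : (2 * c * I = 2 * (I ^+ 2 / h))%R by rewrite /c; field; rewrite gt_eqF.
have e2 : (c ^+ 2 * h = I ^+ 2 / h)%R by rewrite /c; field; rewrite gt_eqF.
lra.
Qed.

Context {d : measure_display} {T : measurableType d}.
Variable P : probability T R.

Variable F : measurableTypeR R * T -> \bar R.
Hypothesis mF : measurable_fun setT F.
Hypothesis F0 : forall q, 0 <= F q.

Let windowF t h (q : measurableTypeR R * T) : \bar R :=
  F q * (\1_(`[t, (t + h)%R]%classic : set R) q.1)%:E.

Let mwF t h : measurable_fun setT (windowF t h).
Proof.
apply: emeasurable_funM => //; apply/measurable_EFinP.
have -> : (fun q : measurableTypeR R * T => \1_(`[t, (t + h)%R]%classic : set R) q.1 : R) =
    \1_(fst @^-1` (`[t, (t + h)%R]%classic : set (measurableTypeR R))).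
  by apply/funext => q; rewrite !indicE; congr (_%:R); apply/idP/idP; rewrite !inE.
apply: measurable_indic; rewrite -[X in measurable X]setTI.
exact: (measurable_fst measurableT).
Qed.

Let wF0 t h q : 0 <= windowF t h q.
Proof. by rewrite mule_ge0// lee_fin. Qed.

Let wFE t h o :
  \int[mu]_(r in `[t, (t + h)%R]) F (r, o) = \int[mu]_r windowF t h (r, o).
Proof.
rewrite integral_mkcond; apply: eq_integral => r _; rewrite patchE /windowF indicE/=.
by case: ifPn => _; rewrite ?mule1 ?mule0.
Qed.

(** The domain of integration moves with [q]; coding it as a section of a measurable set [S] reduces
    measurability in [q] to Tonelli. *)
Lemma measurable_integral_section (S : set ((measurableTypeR R * T) * measurableTypeR R)) :
  measurable S -> measurable_fun setT (fun q : measurableTypeR R * T =>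
    \int[mu]_(r in [set r | S (q, r)]) F (r, q.2)).
Proof.
move=> mS; pose G (x : (measurableTypeR R * T) * measurableTypeR R) := F (x.2, x.1.2) * (\1_S x)%:E.
have mG : measurable_fun setT G.
  apply: emeasurable_funM; last by apply/measurable_EFinP; exact: measurable_indic.
  apply: (measurableT_comp mF); apply: measurable_fun_pair => //.
  exact: (measurableT_comp measurable_snd).
have G0 x : 0 <= G x by rewrite mule_ge0// lee_fin.
have := measurable_fun_fubini_tonelli_F (m2 := mu) G mG G0.
apply: eq_measurable_fun => q _; rewrite [RHS]integral_mkcond.
apply: eq_integral => r _; rewrite patchE /G indicE; case: ifPn => rt.
  by rewrite mem_set ?mule1//; move: rt; rewrite inE.
by rewrite memNset ?mule0//; move: rt; rewrite notin_setE.
Qed.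

Lemma window_swap t h :
  \int[P]_o \int[mu]_(r in `[t, (t + h)%R]) F (r, o) =
  \int[mu]_(r in `[t, (t + h)%R]) \int[P]_o F (r, o).
Proof.
under eq_integral do rewrite wFE.
rewrite -(fubini_tonelli (m1 := mu) (m2 := P) (windowF t h))// [RHS]integral_mkcond.
apply: eq_integral => r _; rewrite patchE; case: ifPn => rA.
  by apply: eq_integral => o _; rewrite /windowF indicE/= rA mule1.
by apply: integral0_eq => o _; rewrite /windowF indicE/= (negbTE rA) mule0.
Qed.

Lemma measurable_mean : measurable_fun setT (fun t : R => \int[P]_o F (t, o)).
Proof. exact: (measurable_fun_fubini_tonelli_F (m2 := P) F). Qed.

End interval_integrals.

Lemma window_sectionE {R : realType} {d : measure_display} {T : measurableType d} (h : R) :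
  exists2 S : set ((measurableTypeR R * T) * measurableTypeR R), measurable S &
  forall q, (`[q.1, (q.1 + h)]%classic : set R) = [set r | S (q, r)].
Proof.
pose f (x : (measurableTypeR R * T) * measurableTypeR R) : measurableTypeR R := x.2 - x.1.1.
have mf : measurable_fun setT f.
  by apply: measurable_funB => //; exact: (measurableT_comp measurable_fst).
exists (f @^-1` `[0, h]%classic); first by rewrite -[X in measurable X]setTI; exact: mf.
by move=> q; apply/seteqP; split => r /=; rewrite !in_itv/= subr_ge0 lerBlDl.
Qed.

Lemma initial_sectionE {R : realType} {d : measure_display} {T : measurableType d} :
  exists2 S : set ((measurableTypeR R * T) * measurableTypeR R), measurable S &
  forall q, (`[0, q.1]%classic : set R) = [set r | S (q, r)].
Proof.
pose f (x : (measurableTypeR R * T) * measurableTypeR R) : measurableTypeR R := x.1.1 - x.2.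
have mf : measurable_fun setT f.
  by apply: measurable_funB => //; exact: (measurableT_comp measurable_fst).
pose g (x : (measurableTypeR R * T) * measurableTypeR R) : measurableTypeR R := x.2.
have mg : measurable_fun setT g by exact: measurable_snd.
exists (g @^-1` `[0, +oo[%classic `&` f @^-1` `[0, +oo[%classic).
  by apply: measurableI; rewrite -[X in measurable X]setTI; [exact: mg|exact: mf].
by move=> q; apply/seteqP; split => r /=; rewrite !in_itv/= !andbT subr_ge0; [move/andP|move=> ?; apply/andP].
Qed.

Lemma measurable_window {R : realType} {d : measure_display} {T : measurableType d}
    (F : measurableTypeR R * T -> \bar R) (h : R) : measurable_fun setT F ->
  (forall q, 0 <= F q)%E -> measurable_fun setT (fun q : measurableTypeR R * T =>
  \int[@lebesgue_measure R]_(r in `[q.1, (q.1 + h)%R]) F (r, q.2))%E.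
Proof.
move=> mF F0; have [S mS SE] := @window_sectionE R _ T h.
have := measurable_integral_section mF F0 mS.
by apply: eq_measurable_fun => q _; rewrite -SE.
Qed.

Lemma measurable_Rintegral_section {R : realType} {d : measure_display} {T : measurableType d}
    (f : measurableTypeR R * T -> R) (S : set ((measurableTypeR R * T) * measurableTypeR R)) :
  measurable_fun setT f -> measurable S ->
  measurable_fun setT (fun q : measurableTypeR R * T =>
    Rintegral (@lebesgue_measure R) [set r | S (q, r)] (fun r => f (r, q.2))).
Proof.
move=> mf mS; have mfE : measurable_fun setT (EFin \o f) by exact/measurable_EFinP.
apply: measurableT_comp => //.
under eq_fun do rewrite integralE.
apply: emeasurable_funB.
  have H := measurable_integral_section (measurable_funepos mfE) (funepos_ge0 _) mS.
  apply: eq_measurable_fun H => q _; apply: eq_integral => r _.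
  by rewrite !funeposE.
have H := measurable_integral_section (measurable_funeneg mfE) (funeneg_ge0 _) mS.
apply: eq_measurable_fun H => q _; apply: eq_integral => r _.
by rewrite !funenegE.
Qed.

Lemma measurable_Rwindow {R : realType} {d : measure_display} {T : measurableType d}
    (f : measurableTypeR R * T -> R) (h : R) : measurable_fun setT f ->
  measurable_fun setT (fun q : measurableTypeR R * T =>
    Rintegral (@lebesgue_measure R) `[q.1, (q.1 + h)%R] (fun r => f (r, q.2))).
Proof.
move=> mf; have [S mS SE] := @window_sectionE R _ T h.
have := measurable_Rintegral_section mf mS.
by apply: eq_measurable_fun => q _; rewrite -SE.
Qed.

Lemma measurable_Rinitial {R : realType} {d : measure_display} {T : measurableType d}
    (f : measurableTypeR R * T -> R) : measurable_fun setT f ->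
  measurable_fun setT (fun q : measurableTypeR R * T =>
    Rintegral (@lebesgue_measure R) `[0%R, q.1] (fun r => f (r, q.2))).
Proof.
move=> mf; have [S mS SE] := @initial_sectionE R _ T.
have := measurable_Rintegral_section mf mS.
by apply: eq_measurable_fun => q _; rewrite -SE.
Qed.

(** * Passage to the limit in the two averaged inequalities *)

Section limits.
Context {R : realType}.

Lemma expR_window (a h : R) : 0 <= a * h ->
  a * h <= expR (a * h) - 1 <= a * h * expR (a * h).
Proof.
move=> ah; apply/andP; split; first by have := expR_ge1Dx (a * h); lra.
have := expR_ge1Dx (- (a * h)); rewrite expRN.
have e0 := expR_gt0 (a * h); move=> H.
have : (1 - a * h) * expR (a * h) <= 1.
  by rewrite -ler_pdivlMr// mul1r; lra.
lra.
Qed.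

Lemma cvg_expR_window (a : R) (s : nat -> R) : s n @[n --> \oo] --> 0 ->
  expR (a * s n ^+ 2) @[n --> \oo] --> (1 : R).
Proof.
move=> s0; rewrite -[X in _ --> X]expR0; apply: continuous_cvg; first exact: continuous_expR.
rewrite -[X in _ --> X](mulr0 a); apply: cvgMl_tmp.
rewrite -[X in _ --> X](mulr0 0).
under eq_fun do rewrite expr2.
exact: cvgM.
Qed.

Lemma cvg_sume_fin (I : finType) (f : I -> nat -> \bar R) (l : I -> R) :
  (forall k, f k n @[n --> \oo] --> (l k)%:E) ->
  (\sum_k f k n)%E @[n --> \oo] --> (\sum_k l k)%:E.
Proof.
move=> H; rewrite -sumEFin; elim: (index_enum _) => [|k r IH].
  by under eq_fun do rewrite big_nil; rewrite big_nil; exact: cvg_cst.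
by under eq_fun do rewrite big_cons; rewrite big_cons; apply: cvgeD => //; rewrite sumEFin.
Qed.

Lemma limn_einf_ge0 (u : nat -> \bar R) : (forall n, (0 <= u n)%E) -> (0 <= limn_einf u)%E.
Proof.
move=> u0; rewrite limn_einf_lim; apply: lime_ge; first exact: is_cvg_einfs.
by near=> n; apply: le_ereal_inf_tmp => _ [k /= nk <-].
Unshelve. all: by end_near. Qed.

Lemma measurable_limn_einf d (U : measurableType d) (f : nat -> U -> \bar R) :
  (forall n, measurable_fun setT (f n)) ->
  measurable_fun setT (fun u => limn_einf (f^~ u)).
Proof.
move=> mf; have -> : (fun u => limn_einf (f^~ u)) = (fun u => - limn_esup (fun n => - f n u))%E.
  apply/funext => u; rewrite -[RHS]limn_einfN; congr limn_einf.
  by apply/funext => n /=; rewrite oppeK.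
apply: measurableT_comp; first exact: oppe_measurable.
by apply: measurable_fun_limn_esup => n; apply: measurableT_comp => //; exact: oppe_measurable.
Qed.

Lemma le_limn_einf (u v : nat -> \bar R) :
  (forall n, (u n <= v n)%E) -> (limn_einf u <= limn_einf v)%E.
Proof.
move=> uv; rewrite !limn_einf_lim; apply: lee_lim; [exact: is_cvg_einfs|exact: is_cvg_einfs|].
near=> n; apply: le_ereal_inf_tmp => _ [k /= nk <-].
by apply: le_trans (uv k); apply: ereal_inf_lbound; exists k.
Unshelve. all: by end_near. Qed.

(** Intended reading: [a] and [c] are the means of z and |grad z|^2 at the exponential time, [g] is
    sigma^2/2 times the mean Laplacian and [zeta] is z(x). With h = [s n ^+ 2], [G n] collects the
    second differences divided by h and [B n] the contribution of times up to h, whose relative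
    error is of order [s n * M]. *)
Variables (alpha a c g zeta M : R) (s : nat -> R) (B G : nat -> \bar R).
Hypotheses (alpha0 : 0 < alpha) (a0 : 0 <= a).
Hypothesis s0 : forall n, 0 < s n.
Hypothesis scvg : s n @[n --> \oo] --> 0.
Hypothesis Gcvg : G n @[n --> \oo] --> g%:E.
Hypothesis Bub : forall n, (B n <= ((zeta + s n * M) * (alpha * s n ^+ 2))%:E)%E.
Hypothesis B0 : forall n, (0 <= B n)%E.
Hypothesis G0 : forall n, (0 <= G n)%E.

Let e n : R := expR (alpha * s n ^+ 2).
Let ecvg : e n @[n --> \oo] --> (1 : R).
Proof. exact: cvg_expR_window. Qed.
Let Bfin n : B n \is a fin_num.
Proof. by rewrite ge0_fin_numE// (le_lt_trans (Bub n))// ltry. Qed.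

(** After division by h the difference (e n - 1) a is at most alpha e n a, and [B n] contributes
    alpha zeta; [pp] is the mean of |p|^2. *)
Lemma lower_limit (pp : R) (C : nat -> \bar R) :
  C n @[n --> \oo] --> c%:E -> 0 <= pp ->
  (forall n, ((zeta * (alpha * s n ^+ 2 * expR (- alpha * s n ^+ 2)))%:E <=
     B n + (s n * M * (alpha * s n ^+ 2))%:E)%E) ->
  (forall n, (a%:E + (s n ^+ 2)%:E * G n + (e n)%:E * B n <=
    (e n)%:E * a%:E + (s n ^+ 2 / 4)%:E * C n + (s n ^+ 2 * e n)%:E * pp%:E)%E) ->
  g + alpha * zeta <= alpha * a + c / 4 + pp.
Proof.
move=> /fine_cvgP[Cfin Ccvg] pp0 Blb H; have [Gfin gcvg] := (fine_cvgP _ _).1 Gcvg.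
have L : (fun n => fine (G n) + alpha * zeta - alpha * (e n * (s n * M))) n @[n --> \oo] -->
   g + alpha * zeta - alpha * (1 * (0 * M)).
  apply: cvgB; first by apply: cvgD => //; exact: cvg_cst.
  by apply: cvgMl_tmp; apply: cvgM => //; exact: cvgMr_tmp.
have U : (fun n => alpha * e n * a + fine (C n) / 4 + e n * pp) n @[n --> \oo] -->
   alpha * 1 * a + c / 4 + 1 * pp.
  apply: cvgD; last exact: cvgMr_tmp.
  by apply: cvgD; apply: cvgMr_tmp => //; exact: cvgMl_tmp.
rewrite mul0r mulr0 mulr0 subr0 in L; rewrite mulr1 mul1r in U.
apply: (ler_cvg_to L U); near=> n.
have fG : G n \is a fin_num by near: n.
have fC : C n \is a fin_num by near: n.
have := H n; have := Blb n.
rewrite -(fineK fG) -(fineK fC) -(fineK (Bfin n)) -!EFinM -!EFinD !lee_fin /=.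
move: (fine _) (fine _) (fine _) => Cr Gr Br.
set h := s n ^+ 2; have h0 : 0 < h by rewrite exprn_gt0.
have /andP[_ e2] := @expR_window alpha h (mulr_ge0 (ltW alpha0) (ltW h0)).
rewrite -/h -/(e n) in e2; have e0 : 0 < e n by exact: expR_gt0.
rewrite mulNr expRN -/h -/(e n) => b1 b2.
(* Multiplying the lower bound of [B n] by [e n] cancels its factor exp(-alpha h) and matches the
   term [e n * B n] of the main inequality. *)
have b3 : zeta * (alpha * h) <= e n * Br + e n * (s n * M * (alpha * h)).
  have -> : zeta * (alpha * h) = e n * (zeta * (alpha * h / e n)) by field; rewrite gt_eqF.
  by rewrite -mulrDr ler_pM2l.
have b4 := ler_wpM2r a0 e2.
by rewrite -(ler_pM2l h0); lra.
Unshelve. all: by end_near. Qed.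

(** [D n] is controlled from below only through its lower limit, so the inequality is solved for
    [D n]: this gives [r n + 4 * G n], using e n - 1 >= alpha h, and the right side converges. *)
Lemma upper_limit (D : nat -> \bar R) :
  (forall n, (0 <= D n)%E) -> ((4 * c)%:E <= limn_einf D)%E ->
  (forall n, ((e n)%:E * a%:E + (s n ^+ 2 / 4)%:E * D n <=
    a%:E + (e n)%:E * B n + (s n ^+ 2)%:E * G n + (s n ^+ 2 / 2 * e n)%:E * c%:E)%E) ->
  alpha * a + c / 2 <= alpha * zeta + g.
Proof.
move=> D0 Dl H.
pose r n := (4 * (e n * (alpha * (zeta + s n * M)) + e n * (c / 2) - alpha * a))%:E.
have rcvg : (r n + 4%:E * G n)%E @[n --> \oo] -->
   ((4 * (1 * (alpha * (zeta + 0 * M)) + 1 * (c / 2) - alpha * a))%:E + 4%:E * g%:E)%E.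
  apply: cvgeD => //; last exact: cvgeZl.
  apply: cvg_EFin; first exact: nearW.
  apply: cvgMl_tmp; apply: cvgB; last exact: cvg_cst.
  apply: cvgD; last exact: cvgMr_tmp.
  apply: cvgM => //; apply: cvgMl_tmp; apply: cvgD; first exact: cvg_cst.
  exact: cvgMr_tmp.
have Dr n : (D n <= r n + 4%:E * G n)%E.
  have := H n; have := G0 n; have := D0 n; have := Bub n.
  rewrite -(fineK (Bfin n)); move: (fine (B n)) => Br.
  have h0 : 0 < s n ^+ 2 by rewrite exprn_gt0.
  case: (G n) => [Gr| |//]; last first.
    by move=> _ _ _ _; rewrite gt0_muley ?lte_fin// addey// leey.
  case: (D n) => [Dr| |//]; last first.
    by move=> _ _ _; rewrite gt0_muley ?lte_fin ?divr_gt0// -!EFinM addey.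
  rewrite /r -!EFinM -!EFinD !lee_fin.
  set h := s n ^+ 2 in h0 *.
  have /andP[e1 _] := @expR_window alpha h (mulr_ge0 (ltW alpha0) (ltW h0)).
  rewrite -/(e n) in e1; have e0 : 0 < e n by exact: expR_gt0.
  move=> b1 _ _ b2.
  have b3 := ler_wpM2r a0 e1; have b4 := ler_wpM2l (ltW e0) b1.
  by rewrite -(ler_pM2l h0); lra.
have := le_trans Dl (le_limn_einf Dr).
rewrite (cvg_limn_einf_sup rcvg).1 -EFinM -EFinD lee_fin; lra.
Qed.

End limits.

(** * A controlled system observed over short windows *)

Section system.
Local Open Scope ereal_scope.
Context {R : realType} {N : nat} {d : measure_display} {T : measurableType d}.
Notation mu := (@lebesgue_measure R).
Variables alpha sigma : R.
Hypothesis alpha0 : (0 < alpha)%R.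
Variable rho : probability (measurableTypeR R) R.
Hypothesis rhoE : forall f : R -> \bar R, measurable_fun setT f -> (forall t, 0 <= f t) ->
  \int[rho]_t f t = \int[mu]_t (f t * (exp_ker alpha t)%:E).

Variable z : 'rV[R]_N -> R.
Definition gsq v : R := \sum_i partial i z v ^+ 2.
Hypothesis cz : continuous z.
Hypothesis cg : forall i, continuous (partial i z).
Hypothesis z0 : forall v, (0 <= z v)%R.
Hypothesis subg : forall a b : 'rV[R]_N, (z a + \sum_i partial i z a * (b 0 i - a 0 i) <= z b)%R.
Hypothesis sd0 : forall k a s, (0 <= second_diff z k a s)%R.

Variable P : probability T R.
Variable W : T -> 'rV[R]_N.
Hypothesis gW : gaussian_vec P W.
Variables Y p w : R -> T -> 'rV[R]_N.
Hypothesis mY : forall i, measurable_fun setT (fun q : measurableTypeR R * T => Y q.1 q.2 0%R i).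
Hypothesis mp : forall i, measurable_fun setT (fun q : measurableTypeR R * T => p q.1 q.2 0%R i).
Hypothesis mw : forall t i, (0 <= t)%R -> measurable_fun setT (fun o => w t o 0%R i).
Hypothesis indep : forall t s, (0 <= t)%R -> (0 < s)%R ->
  forall f : 'rV[R]_N -> 'rV[R]_N -> \bar R,
  measurable_fun setT (fun q : N.-tuple R * N.-tuple R => f (row_tup q.1) (row_tup q.2)) ->
  (forall u v, 0 <= f u v) ->
  \int[P]_o f (Y t o) (w (t + s ^+ 2)%R o - w t o)%R =
  \int[P]_o \int[P]_o' f (Y t o) (s *: W o').
Hypothesis incr : forall t h, (0 <= t)%R -> (0 < h)%R ->
  {ae P, forall o, forall i,
    mu.-integrable `[t, (t + h)%R] (fun r => (p r o 0%R i)%:E) /\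
    (Y (t + h) o 0 i = Y t o 0 i + \int[mu]_(r in `[t, (t + h)%R]) p r o 0 i
      + sigma * (w (t + h) o 0 i - w t o 0 i))%R}.

Let mW i : measurable_fun setT (fun o => W o 0%R i). Proof. by have [] := gW. Qed.

Let mYt t i : measurable_fun setT (fun o => Y t o 0%R i).
Proof. exact: (measurableT_comp (mY i) (pair1_measurable t)). Qed.

Lemma continuous_gsq : continuous gsq.
Proof.
move=> v; apply: (@cvg_sumr _ _ (nbhs v) (nbhs_filter v)) => i _.
by apply: (cvg_comp (partial i z) (fun x => x ^+ 2)%R); [exact: cg|exact: sqr_continuous].
Qed.

Lemma gsq_ge0 v : (0 <= gsq v)%R.
Proof. by apply: sumr_ge0 => i _; exact: sqr_ge0. Qed.

Definition drift_energy t h : \bar R :=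
  \int[mu]_(r in `[t, (t + h)%R]) \int[P]_o (nsq (p r o))%:E.

Let D t h o : 'rV[R]_N := (w (t + h) o - w t o)%R.

Let mD t h i : (0 <= t)%R -> (0 < h)%R -> measurable_fun setT (fun o => D t h o 0%R i).
Proof.
move=> t0 h0; under eq_fun do rewrite !mxE.
by apply: measurable_funB; apply: mw => //; rewrite addr_ge0// ltW.
Qed.

Let mYD t h : (0 <= t)%R -> (0 < h)%R ->
  forall i, measurable_fun setT (fun o => (Y t o + sigma *: D t h o)%R 0%R i).
Proof.
move=> t0 h0 i; under eq_fun do rewrite mxE [X in (_ + X)%R]mxE.
by apply: measurable_funD => //; apply: measurable_funM => //; exact: mD.
Qed.

Let meas_pair (g : 'rV[R]_N -> R) : continuous g ->
  measurable_fun setT (fun q : N.-tuple R * N.-tuple R =>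
    (g (row_tup q.1 + sigma *: row_tup q.2))%:E).
Proof.
move=> cg'; apply/measurable_EFinP; apply: measurable_fun_row => // i.
under eq_fun do rewrite !mxE.
apply: measurable_funD; last apply: measurable_funM => //.
  exact: (measurableT_comp (measurable_tnth i)).
exact: (measurableT_comp (measurable_tnth i)).
Qed.

Lemma noise_mean (g : 'rV[R]_N -> R) t s : continuous g -> (forall v, (0 <= g v)%R) ->
  (0 <= t)%R -> (0 < s)%R ->
  \int[P]_o (g (Y t o + sigma *: D t (s ^+ 2) o))%:E =
  \int[P]_o \int[P]_o' (g (Y t o + (s * sigma) *: W o'))%:E.
Proof.
move=> cg' g0 t0 s0.
rewrite (@indep t s t0 s0 (fun u v => (g (u + sigma *: v))%:E)).
- apply: eq_integral => o _; apply: eq_integral => o' _.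
  by rewrite scalerA [(sigma * s)%R]mulrC.
- exact: meas_pair.
- by move=> u v; rewrite lee_fin.
Qed.

Definition mean_second_diff t s (k : 'I_N) : \bar R :=
  \int[P]_o \int[P]_o' (2^-1 * second_diff z k
      (Y t o + (s * sigma) *: trunc_row k (W o')) (s * sigma * W o' 0 k))%:E.

Lemma noise_expand t s : (0 <= t)%R -> (0 < s)%R ->
  \int[P]_o (z (Y t o + sigma *: D t (s ^+ 2) o))%:E =
  \int[P]_o (z (Y t o))%:E + \sum_(k < N) mean_second_diff t s k.
Proof.
move=> t0 s0; rewrite noise_mean//.
under eq_integral do rewrite (gaussian_expand gW cz z0 sd0).
have msd k : measurable_fun setT (fun o => \int[P]_o' (2^-1 * second_diff z k
      (Y t o + (s * sigma) *: trunc_row k (W o')) (s * sigma * W o' 0 k))%:E).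
  apply: (measurable_fun_fubini_tonelli_F (m2 := P) (fun q : T * T => (2^-1 * second_diff z k
      (Y t q.1 + (s * sigma) *: trunc_row k (W q.2)) (s * sigma * W q.2 0 k))%:E)).
    apply/measurable_EFinP; apply: measurable_funM => //; apply: measurable_second_diff => //.
      apply: measurable_affine_trunc => i.
        exact: (measurableT_comp (mYt t i)).
      exact: (measurableT_comp (mW i)).
    by apply: measurable_funM => //; exact: (measurableT_comp (mW k)).
  by move=> q; rewrite lee_fin mulr_ge0.
have sd00 k o : 0 <= \int[P]_o' (2^-1 * second_diff z k
      (Y t o + (s * sigma) *: trunc_row k (W o')) (s * sigma * W o' 0 k))%:E.
  by apply: integral_ge0 => o' _; rewrite lee_fin mulr_ge0.
rewrite ge0_integralD//.
- by rewrite ge0_integral_sum.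
- by move=> o _; rewrite lee_fin.
- by apply/measurable_EFinP; exact: measurable_fun_row.
- by move=> o _; exact: sume_ge0.
- exact: emeasurable_sum.
Qed.

Lemma mean_drift_energy t h : \int[P]_o \int[mu]_(r in `[t, (t + h)%R]) (nsq (p r o))%:E =
  drift_energy t h.
Proof.
rewrite (@window_swap _ _ _ P (fun q => (nsq (p q.1 q.2))%:E))//.
  by apply/measurable_EFinP; apply: measurable_fun_row => //; exact: continuous_nsq.
by move=> q; rewrite lee_fin nsq_ge0.
Qed.

Lemma drift_sum_le t h o : (0 < h)%R ->
  (forall i, mu.-integrable `[t, (t + h)%R] (fun r => (p r o 0%R i)%:E)) ->
  ((\sum_i (\int[mu]_(r in `[t, (t + h)%R]) p r o 0 i) ^+ 2) / h)%:E <=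
  \int[mu]_(r in `[t, (t + h)%R]) (nsq (p r o))%:E.
Proof.
move=> h0 pi.
have -> : \int[mu]_(r in `[t, (t + h)%R]) (nsq (p r o))%:E =
    \sum_i \int[mu]_(r in `[t, (t + h)%R]) (p r o 0%R i ^+ 2)%:E.
  under eq_integral do rewrite -sumEFin.
  rewrite ge0_integral_sum// => [i|i r _]; last by rewrite lee_fin sqr_ge0.
  apply/measurable_EFinP; apply: measurable_funX; apply/measurable_EFinP.
  exact: measurable_int (pi i).
rewrite mulr_suml -sumEFin; apply: lee_sum => i _.
by apply: sqr_Rintegral_le => //; exact: pi.
Qed.

Let mnp : measurable_fun setT (fun q : measurableTypeR R * T => (nsq (p q.1 q.2))%:E).
Proof.
by apply/measurable_EFinP; apply: measurable_fun_row => //; exact: continuous_nsq.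
Qed.

Let mpw t h : measurable_fun setT (fun o => \int[mu]_(r in `[t, (t + h)%R]) (nsq (p r o))%:E).
Proof.
have H := @measurable_window _ _ _ _ h mnp (fun q => nsq_ge0 _).
exact: (measurableT_comp H (pair1_measurable t)).
Qed.

(** With a = Y(t) + sigma D and b = Y(t+h), the difference b - a is the integral I of the drift. In
    each coordinate u I is at least -(h/4 u^2 + I^2/h), u the partial derivative at a, and I^2/h is
    at most the drift energy by Cauchy-Schwarz. *)
Lemma lower_step t s : (0 <= t)%R -> (0 < s)%R ->
  \int[P]_o (z (Y t o))%:E + \sum_(k < N) mean_second_diff t s k <=
  \int[P]_o (z (Y (t + s ^+ 2)%R o))%:E +
  (s ^+ 2 / 4)%:E * \int[P]_o \int[P]_o' (gsq (Y t o + (s * sigma) *: W o'))%:E +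
  drift_energy t (s ^+ 2).
Proof.
move=> t0 s0; have h0 : (0 < s ^+ 2)%R by rewrite exprn_gt0.
rewrite -noise_expand// -noise_mean//; [|exact: continuous_gsq|exact: gsq_ge0].
have mg : measurable_fun setT (fun o => (gsq (Y t o + sigma *: D t (s ^+ 2) o))%:E).
  by apply/measurable_EFinP; apply: measurable_fun_row; [exact: continuous_gsq|exact: mYD].
have mz : measurable_fun setT (fun o => (z (Y (t + s ^+ 2)%R o))%:E).
  by apply/measurable_EFinP; exact: measurable_fun_row.
rewrite -mean_drift_energy -ge0_integralZl//; last 2 first.
- by move=> o _; rewrite lee_fin gsq_ge0.
- by rewrite lee_fin divr_ge0// sqr_ge0.
have g0 o : 0 <= (s ^+ 2 / 4)%:E * (gsq (Y t o + sigma *: D t (s ^+ 2) o))%:E.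
  by rewrite -EFinM lee_fin mulr_ge0 ?gsq_ge0// divr_ge0// sqr_ge0.
have p0 o : 0 <= \int[mu]_(r in `[t, (t + s ^+ 2)%R]) (nsq (p r o))%:E.
  by apply: integral_ge0 => r _; rewrite lee_fin nsq_ge0.
rewrite -ge0_integralD//; last 2 first.
- by move=> o _; rewrite lee_fin.
- exact: emeasurable_funM.
rewrite -ge0_integralD//; last 2 first.
- by move=> o _; rewrite adde_ge0// lee_fin.
- by apply: emeasurable_funD => //; exact: emeasurable_funM.
apply: ae_ge0_le_integral => //.
- by move=> o _; rewrite lee_fin.
- by apply/measurable_EFinP; apply: measurable_fun_row => //; exact: mYD.
- by move=> o _; rewrite adde_ge0 ?p0// adde_ge0 ?g0// lee_fin z0.
- by apply: emeasurable_funD => //; apply: emeasurable_funD => //; exact: emeasurable_funM.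
have [A [mA PA sA]] := @incr t (s ^+ 2)%R t0 h0.
exists A; split => //; apply: subset_trans sA => o /= H1 H2; apply: H1 => _.
have dl := @drift_sum_le t (s ^+ 2)%R o h0 (fun i => (H2 i).1).
apply: le_trans (leeD2l _ dl); rewrite -EFinM -!EFinD lee_fin.
set a := (Y t o + _)%R; set b := Y _ o.
have := subg a b.
have ba i : (b 0 i - a 0 i = \int[mu]_(r in `[t, (t + s ^+ 2)%R]) p r o 0 i)%R.
  by rewrite /a /b (H2 i).2 !mxE; ring.
under eq_bigr do rewrite ba.
rewrite /gsq mulr_suml mulr_sumr -addrA -big_split/=.
move=> h1; apply: le_trans (lerD h1 (lexx _)).
rewrite -addrA -big_split/= lerDl sumr_ge0// => i _.
set u := partial i z a; set I := Rintegral _ _ _.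
(* This square is all that is discarded; it vanishes exactly when I = -h u/2. *)
have -> : (u * I + (s ^+ 2 / 4 * u ^+ 2 + I ^+ 2 / s ^+ 2) = (s / 2 * u + I / s) ^+ 2)%R.
  by field; rewrite gt_eqF.
exact: sqr_ge0.
Qed.

Hypothesis pfb : forall t o i, p t o 0%R i = (- 2^-1 * partial i z (Y t o))%R.

(** For the feedback drift this is u - 2I/h, with u the partial derivative at the end of the window
    and I the drift integral: the linear form whose square completes the cross term in
    [upper_step]. *)
Definition grad_avg t h o (i : 'I_N) : R :=
  (partial i z (Y (t + h) o) + (\int[mu]_(r in `[t, (t + h)%R]) partial i z (Y r o)) / h)%R.

Lemma measurable_grad_avg h : measurable_fun setT (fun q : measurableTypeR R * T =>
  (\sum_i grad_avg q.1 h q.2 i ^+ 2)%:E).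
Proof.
apply/measurable_EFinP; apply: measurable_sum => i; apply: measurable_funX.
have mg : measurable_fun setT (fun q : measurableTypeR R * T => partial i z (Y q.1 q.2)).
  by apply: measurable_fun_row => //; exact: cg.
apply: measurable_funD.
  apply: (measurableT_comp mg (_ : measurable_fun setT
    (fun q : measurableTypeR R * T => ((q.1 + h)%R : measurableTypeR R, q.2)))).
  by apply: measurable_fun_pair => //; exact: measurable_funD.
by apply: measurable_funM => //; exact: (measurable_Rwindow h mg).
Qed.

(** Now the base point is Y(t+h), and -u I = h/4 (u - 2I/h)^2 - h/4 u^2 - I^2/h is an identity. The
    square stays on the left because it does not become small: [grad_avg] approaches twice the
    gradient. *)
Lemma upper_step t s : (0 <= t)%R -> (0 < s)%R ->
  \int[P]_o (z (Y (t + s ^+ 2)%R o))%:E +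
  (s ^+ 2 / 4)%:E * \int[P]_o (\sum_i grad_avg t (s ^+ 2) o i ^+ 2)%:E <=
  \int[P]_o (z (Y t o))%:E + \sum_(k < N) mean_second_diff t s k +
  (s ^+ 2 / 4)%:E * \int[P]_o (gsq (Y (t + s ^+ 2)%R o))%:E +
  drift_energy t (s ^+ 2).
Proof.
move=> t0 s0; have h0 : (0 < s ^+ 2)%R by rewrite exprn_gt0.
rewrite -noise_expand//.
have c0 : (0 <= s ^+ 2 / 4)%R by rewrite divr_ge0// sqr_ge0.
have mz : measurable_fun setT (fun o => (z (Y (t + s ^+ 2)%R o))%:E).
  by apply/measurable_EFinP; exact: measurable_fun_row.
have mzD : measurable_fun setT (fun o => (z (Y t o + sigma *: D t (s ^+ 2) o))%:E).
  by apply/measurable_EFinP; apply: measurable_fun_row => //; exact: mYD.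
have mga : measurable_fun setT (fun o => (\sum_i grad_avg t (s ^+ 2) o i ^+ 2)%:E).
  have H := measurable_grad_avg (s ^+ 2)%R.
  exact: (measurableT_comp H (pair1_measurable t)).
have mgs : measurable_fun setT (fun o => (gsq (Y (t + s ^+ 2)%R o))%:E).
  by apply/measurable_EFinP; apply: measurable_fun_row => //; exact: continuous_gsq.
have ga0 o : 0 <= (\sum_i grad_avg t (s ^+ 2) o i ^+ 2)%:E.
  by rewrite lee_fin sumr_ge0// => i _; exact: sqr_ge0.
have p0 o : 0 <= \int[mu]_(r in `[t, (t + s ^+ 2)%R]) (nsq (p r o))%:E.
  by apply: integral_ge0 => r _; rewrite lee_fin nsq_ge0.
rewrite -mean_drift_energy -!ge0_integralZl//; last first.
  by move=> o _; rewrite lee_fin gsq_ge0.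
have E2 o : 0 <= (s ^+ 2 / 4)%:E * (gsq (Y (t + s ^+ 2)%R o))%:E.
  by rewrite -EFinM lee_fin mulr_ge0// gsq_ge0.
have E1 o : 0 <= (s ^+ 2 / 4)%:E * (\sum_i grad_avg t (s ^+ 2) o i ^+ 2)%:E.
  by rewrite mule_ge0.
have mE1 : measurable_fun setT (fun o => (s ^+ 2 / 4)%:E * (\sum_i grad_avg t (s ^+ 2) o i ^+ 2)%:E).
  exact: emeasurable_funM.
have mE2 : measurable_fun setT (fun o => (s ^+ 2 / 4)%:E * (gsq (Y (t + s ^+ 2)%R o))%:E).
  exact: emeasurable_funM.
have zz v : 0 <= (z v)%:E by rewrite lee_fin.
rewrite -ge0_integralD// -ge0_integralD//.
rewrite -ge0_integralD//; last 2 first.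
- by move=> o _; exact: adde_ge0.
- exact: emeasurable_funD.
apply: ae_ge0_le_integral => //.
- by move=> o _; exact: adde_ge0.
- exact: emeasurable_funD.
- by move=> o _; rewrite adde_ge0// adde_ge0.
- by apply: emeasurable_funD => //; exact: emeasurable_funD.
have [A [mA PA sA]] := @incr t (s ^+ 2)%R t0 h0.
exists A; split => //; apply: subset_trans sA => o /= H1 H2; apply: H1 => _.
have dl := @drift_sum_le t (s ^+ 2)%R o h0 (fun i => (H2 i).1).
apply: le_trans (leeD2l _ dl); rewrite -!EFinM -!EFinD lee_fin.
set a := (Y t o + _)%R; set b := Y _ o.
have := subg b a.
have ba i : (a 0 i - b 0 i = - \int[mu]_(r in `[t, (t + s ^+ 2)%R]) p r o 0 i)%R.
  by rewrite /a /b (H2 i).2 !mxE; ring.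
have gaE i : (grad_avg t (s ^+ 2) o i =
    partial i z b - 2 * (\int[mu]_(r in `[t, (t + s ^+ 2)%R]) p r o 0 i) / s ^+ 2)%R.
  rewrite /grad_avg -/b; congr (_ + _)%R; rewrite -mulNr; congr (_ / _)%R.
  transitivity (\int[mu]_(r in `[t, (t + s ^+ 2)%R]) (- 2 * p r o 0 i))%R.
    by apply: eq_Rintegral => r _; rewrite pfb; field.
  by rewrite RintegralZl ?mulNr//; exact: (H2 i).1.
under [X in (_ + X <= _)%R -> _]eq_bigr do rewrite ba.
rewrite /gsq mulr_suml !mulr_sumr.
move=> h1; rewrite -[leRHS]addrA -big_split/= -lerBlDr; apply: le_trans h1.
rewrite -addrA lerD2l -sumrB; apply: ler_sum => i _; rewrite gaE.
set u := partial i z b; set I := Rintegral _ _ _.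
rewrite le_eqVlt; apply/orP; left; apply/eqP; field.
by rewrite gt_eqF.
Qed.

Let mz : measurable_fun setT (fun q : measurableTypeR R * T => (z (Y q.1 q.2))%:E).
Proof. by apply/measurable_EFinP; exact: measurable_fun_row. Qed.

Let EZ t : \bar R := \int[P]_o (z (Y t o))%:E.

Let mEZ : measurable_fun setT EZ.
Proof. by apply: (measurable_mean P mz) => q; rewrite lee_fin. Qed.

Let EZ0 t : 0 <= EZ t.
Proof. by apply: integral_ge0 => o _; rewrite lee_fin. Qed.

Let small h (t : R) : \bar R := if (t <= h)%R then 1 else 0.

Let msmall h : measurable_fun setT (small h).
Proof.
have -> : small h = (fun t => (\1_(`]-oo, h]%classic : set R) t)%:E).
  apply/funext => t; rewrite /small indicE; case: ifPn => ht.
    by rewrite mem_set//= in_itv/= ht.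
  by rewrite memNset//= in_itv/=; exact/negP.
by apply/measurable_EFinP; exact: measurable_indic.
Qed.

Let small0 h t : 0 <= small h t. Proof. by rewrite /small; case: ifP. Qed.

(** Isolates the times up to [h], the source of z(x), from the mean of the shifted process. *)
Lemma shift_split h : (0 <= h)%R ->
  (expR (alpha * h))%:E * \int[rho]_t EZ t =
  \int[rho]_t EZ (t + h)%R + (expR (alpha * h))%:E * \int[rho]_t (EZ t * small h t).
Proof.
move=> h0; rewrite (exp_time_shift alpha0 rhoE)//.
have e0 : 0 <= (expR (alpha * h))%:E by rewrite lee_fin expR_ge0.
have mI : measurable_fun setT (fun t : R => if (h < t)%R then 1 else 0 : \bar R).
  have -> : (fun t : R => if (h < t)%R then 1 else 0 : \bar R) =
      (fun t => (\1_(`]h, +oo[%classic : set R) t)%:E).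
    apply/funext => t; rewrite indicE; case: ifPn => ht.
      by rewrite mem_set//= in_itv/= ht.
    by rewrite memNset//= in_itv/= andbT; exact/negP.
  by apply/measurable_EFinP; exact: measurable_indic.
rewrite -ge0_muleDr; last 2 first.
- by apply: integral_ge0 => t _; rewrite mule_ge0//; case: ifP.
- by apply: integral_ge0 => t _; rewrite mule_ge0.
congr (_ * _); rewrite -ge0_integralD//.
- apply: eq_integral => t _; rewrite /small; case: ltP => _.
    by rewrite mule1 mule0 adde0.
  by rewrite mule1 mule0 add0e.
- by move=> t _; rewrite mule_ge0//; case: ifP.
- exact: emeasurable_funM.
- by move=> t _; rewrite mule_ge0.
- by apply: emeasurable_funM; [exact: mEZ|exact: msmall].
Qed.

(** Joint law of the exponential time and the outcome; as a product it makes the two independent. *)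
Definition discounted_measure := (rho \x P)%E.

Lemma discounted_measure_setT : discounted_measure setT = 1.
Proof.
rewrite /discounted_measure -setXTT; apply: (etrans (product_measure1E rho P measurableT measurableT)).
by transitivity ((1 : \bar R) * 1); [congr (_ * _); exact: probability_setT|rewrite mule1].
Qed.

Lemma iterated_discounted (F : measurableTypeR R * T -> \bar R) : measurable_fun setT F -> (forall q, 0 <= F q) ->
  \int[rho]_t \int[P]_o F (t, o) = \int[discounted_measure]_q F q.
Proof. by move=> mF F0; rewrite /discounted_measure fubini_tonelli1. Qed.

Definition state_at (q : measurableTypeR R * T) := Y q.1 q.2.

Let mYY i : measurable_fun setT (fun q => state_at q 0%R i). Proof. exact: mY. Qed.

Let msd2 s k : measurable_fun setT (fun q : (measurableTypeR R * T) * T => (2^-1 * second_diff z k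
      (state_at q.1 + (s * sigma) *: trunc_row k (W q.2)) (s * sigma * W q.2 0 k))%:E).
Proof.
apply/measurable_EFinP; apply: measurable_funM => //; apply: measurable_second_diff => //.
  apply: measurable_affine_trunc => i; first exact: (measurableT_comp (mY i)).
  exact: (measurableT_comp (mW i)).
by apply: measurable_funM => //; exact: (measurableT_comp (mW k)).
Qed.

Let msd1 s k : measurable_fun setT (fun q => \int[P]_o' (2^-1 * second_diff z k
      (state_at q + (s * sigma) *: trunc_row k (W o')) (s * sigma * W o' 0 k))%:E).
Proof.
apply: (measurable_fun_fubini_tonelli_F (m2 := P) _ (msd2 s k)).
by move=> q; rewrite lee_fin mulr_ge0.
Qed.

Let sd1_ge0 s k q : 0 <= \int[P]_o' (2^-1 * second_diff z k
      (state_at q + (s * sigma) *: trunc_row k (W o')) (s * sigma * W o' 0 k))%:E.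
Proof. by apply: integral_ge0 => o' _; rewrite lee_fin mulr_ge0. Qed.

Let mmsd s k : measurable_fun setT (fun t => mean_second_diff t s k).
Proof. exact: (measurable_mean P (msd1 s k) (sd1_ge0 s k)). Qed.

Let msum s : measurable_fun setT (fun t : R => \sum_(k < N) mean_second_diff t s k).
Proof. by apply: emeasurable_sum => k; exact: mmsd. Qed.

Let msd_ge0 t s k : 0 <= mean_second_diff t s k.
Proof. by apply: integral_ge0 => o _; exact: (sd1_ge0 s k (t, o)). Qed.

Let Gn s : \bar R := \sum_(k < N) \int[discounted_measure]_q \int[P]_o (2^-1 * second_diff z k
      (state_at q + (s * sigma) *: trunc_row k (W o)) (s * sigma * W o 0 k) / s ^+ 2)%:E.

Lemma second_diff_total s : (0 < s)%R ->
  \int[rho]_t \sum_(k < N) mean_second_diff t s k = (s ^+ 2)%:E * Gn s.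
Proof.
move=> s0; rewrite ge0_integral_sum//; last by move=> k; exact: mmsd.
rewrite /Gn ge0_sume_distrr; last first.
  move=> k _; apply: integral_ge0 => q _; apply: integral_ge0 => o _.
  by rewrite lee_fin !mulr_ge0// invr_ge0 sqr_ge0.
apply: eq_bigr => k _.
rewrite (iterated_discounted (msd1 s k) (sd1_ge0 s k)).
rewrite -ge0_integralZl//; last 3 first.
- apply: (measurable_fun_fubini_tonelli_F (m2 := P) (fun q : (measurableTypeR R * T) * T => (2^-1 * second_diff z k
      (state_at q.1 + (s * sigma) *: trunc_row k (W q.2)) (s * sigma * W q.2 0 k) / s ^+ 2)%:E)).
    apply/measurable_EFinP; apply: measurable_funM => //.
    by apply/measurable_EFinP; exact: msd2.
  by move=> q; rewrite lee_fin !mulr_ge0// invr_ge0 sqr_ge0.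
- move=> q _; apply: integral_ge0 => o _.
  by rewrite lee_fin !mulr_ge0// invr_ge0 sqr_ge0.
- by rewrite lee_fin sqr_ge0.
apply: eq_integral => q _; rewrite -ge0_integralZl//; last 3 first.
- apply/measurable_EFinP; apply: measurable_funM => //; apply/measurable_EFinP.
  exact: (measurableT_comp (msd2 s k) (pair1_measurable q)).
- by move=> o _; rewrite lee_fin !mulr_ge0// invr_ge0 sqr_ge0.
- by rewrite lee_fin sqr_ge0.
apply: eq_integral => o _; rewrite -EFinM; congr EFin; field.
by rewrite gt_eqF.
Qed.

Let mgY : measurable_fun setT (fun q => (gsq (state_at q))%:E).
Proof. by apply/measurable_EFinP; apply: measurable_fun_row => //; exact: continuous_gsq. Qed.

Let Cn s : \bar R := \int[discounted_measure]_q \int[P]_o (gsq (state_at q + (s * sigma) *: W o))%:E.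

Let mdrift h : measurable_fun setT (fun t => drift_energy t h).
Proof.
have := @measurable_window _ _ _ _ h mnp (fun q => nsq_ge0 _).
move=> H; have := measurable_mean P H (fun q => _).
move=> H2; apply: eq_measurable_fun (H2 _).
  by move=> t _; exact: mean_drift_energy.
by move=> q; apply: integral_ge0 => r _; rewrite lee_fin nsq_ge0.
Qed.

Let drift0 t h : 0 <= drift_energy t h.
Proof. by apply: integral_ge0 => r _; apply: integral_ge0 => o _; rewrite lee_fin nsq_ge0. Qed.

Let PP : \bar R := \int[discounted_measure]_q (nsq (p q.1 q.2))%:E.

Lemma drift_total h : (0 <= h)%R ->
  \int[rho]_t drift_energy t h <= (h * expR (alpha * h))%:E * PP.
Proof.
move=> h0; rewrite /PP -(iterated_discounted mnp (fun q => nsq_ge0 _)).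
apply: (exp_time_window alpha0 rhoE) => //.
  by apply: (measurable_mean P mnp) => q; rewrite lee_fin nsq_ge0.
by move=> t; apply: integral_ge0 => o _; rewrite lee_fin nsq_ge0.
Qed.

(** [lower_step] averaged over the exponential time, the shifted term rewritten by [shift_split] and
    the drift energy bounded by [drift_total]. The initial layer is added on the left instead of
    subtracted on the right, as the means may be infinite here. *)
Lemma lower_total s : (0 < s)%R ->
  \int[rho]_t EZ t + (s ^+ 2)%:E * Gn s +
    (expR (alpha * s ^+ 2))%:E * \int[rho]_t (EZ t * small (s ^+ 2)%R t) <=
  (expR (alpha * s ^+ 2))%:E * \int[rho]_t EZ t + (s ^+ 2 / 4)%:E * Cn s +
    (s ^+ 2 * expR (alpha * s ^+ 2))%:E * PP.
Proof.
move=> s0; have h0 : (0 <= s ^+ 2)%R by exact: sqr_ge0.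
have c0 : 0 <= (s ^+ 2 / 4)%:E by rewrite lee_fin divr_ge0.
have mC2 : measurable_fun setT (fun q : (measurableTypeR R * T) * T => (gsq (state_at q.1 + (s * sigma) *: W q.2))%:E).
  apply/measurable_EFinP; apply: measurable_fun_row => [|i]; first exact: continuous_gsq.
  under eq_fun do rewrite !mxE.
  apply: measurable_funD; first exact: (measurableT_comp (mY i)).
  by apply: measurable_funM => //; exact: (measurableT_comp (mW i)).
have C20 q : 0 <= (gsq (state_at q.1 + (s * sigma) *: W q.2))%:E by rewrite lee_fin gsq_ge0.
have mC1 := measurable_fun_fubini_tonelli_F (m2 := P) _ mC2 C20.
have C10 q : 0 <= fubini_F P (fun q : (measurableTypeR R * T) * T => (gsq (state_at q.1 + (s * sigma) *: W q.2))%:E) q.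
  by apply: integral_ge0 => o _; exact: (C20 (q, o)).
have mCt : measurable_fun setT (fun t : R => \int[P]_o \int[P]_o' (gsq (Y t o + (s * sigma) *: W o'))%:E).
  exact: (measurable_mean P mC1 C10).
have Ct0 t : 0 <= \int[P]_o \int[P]_o' (gsq (Y t o + (s * sigma) *: W o'))%:E.
  by apply: integral_ge0 => o _; apply: integral_ge0 => o' _; rewrite lee_fin gsq_ge0.
have CE : Cn s = \int[rho]_t \int[P]_o \int[P]_o' (gsq (Y t o + (s * sigma) *: W o'))%:E.
  by rewrite /Cn (iterated_discounted mC1 C10).
have mEZh : measurable_fun setT (fun t : R => EZ (t + s ^+ 2)%R).
  by apply: (measurableT_comp mEZ); exact: measurable_funD.
have H : \int[rho]_t (EZ t + \sum_(k < N) mean_second_diff t s k) <=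
   \int[rho]_t (EZ (t + s ^+ 2)%R +
    (s ^+ 2 / 4)%:E * \int[P]_o \int[P]_o' (gsq (Y t o + (s * sigma) *: W o'))%:E +
    drift_energy t (s ^+ 2)).
  apply: (exp_time_le alpha0 rhoE).
  - by apply: emeasurable_funD => //; exact: msum.
  - by apply: emeasurable_funD => //; apply: emeasurable_funD => //; exact: emeasurable_funM.
  - by move=> t; rewrite adde_ge0// sume_ge0.
  - by move=> t; rewrite adde_ge0// adde_ge0// mule_ge0.
  - by move=> t t0; apply: lower_step => //; exact: ltW.
have mdh := mdrift (s ^+ 2)%R; have ms1 := msum s.
have sum0 t : 0 <= \sum_(k < N) mean_second_diff t s k by apply: sume_ge0 => k _; exact: msd_ge0.
have mcC : measurable_fun setT (fun t : R =>
    (s ^+ 2 / 4)%:E * \int[P]_o \int[P]_o' (gsq (Y t o + (s * sigma) *: W o'))%:E).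
  exact: emeasurable_funM.
have cC0 t : 0 <= (s ^+ 2 / 4)%:E * \int[P]_o \int[P]_o' (gsq (Y t o + (s * sigma) *: W o'))%:E.
  exact: mule_ge0.
have ms2 : measurable_fun setT (fun t : R => EZ (t + s ^+ 2)%R +
    (s ^+ 2 / 4)%:E * \int[P]_o \int[P]_o' (gsq (Y t o + (s * sigma) *: W o'))%:E).
  exact: emeasurable_funD.
have s20 t : 0 <= EZ (t + s ^+ 2)%R +
    (s ^+ 2 / 4)%:E * \int[P]_o \int[P]_o' (gsq (Y t o + (s * sigma) *: W o'))%:E.
  exact: adde_ge0.
rewrite (@ge0_integralD _ _ _ rho _ measurableT EZ)// in H.
rewrite second_diff_total// in H.
rewrite [in X in _ <= X]ge0_integralD// in H.
rewrite [in X in _ <= X]ge0_integralD// in H.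
rewrite (@ge0_integralZl _ _ _ rho _ measurableT (fun t : R => \int[P]_o \int[P]_o' (gsq (Y t o + (s * sigma) *: W o'))%:E))// -CE in H.
rewrite (shift_split h0).
apply: (le_trans (leeD2r _ H)).
rewrite [X in _ <= X + _]addeAC [leLHS]addeAC; apply: leeD; [exact: lexx|exact: drift_total].
Qed.

Let CC : \bar R := \int[discounted_measure]_q (gsq (state_at q))%:E.

Let Dn s : \bar R := \int[rho]_t \int[P]_o (\sum_i grad_avg t (s ^+ 2) o i ^+ 2)%:E.

Let mDt s : measurable_fun setT (fun t : R => \int[P]_o (\sum_i grad_avg t (s ^+ 2) o i ^+ 2)%:E).
Proof.
apply: (measurable_mean P (measurable_grad_avg (s ^+ 2)%R)) => q.
by rewrite lee_fin sumr_ge0// => i _; exact: sqr_ge0.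
Qed.

Let Dt0 s t : 0 <= \int[P]_o (\sum_i grad_avg t (s ^+ 2) o i ^+ 2)%:E.
Proof.
apply: integral_ge0 => o _; rewrite lee_fin sumr_ge0// => i _; exact: sqr_ge0.
Qed.

Let EG t : \bar R := \int[P]_o (gsq (Y t o))%:E.

Let mEG : measurable_fun setT EG.
Proof. by apply: (measurable_mean P mgY) => q; rewrite lee_fin gsq_ge0. Qed.

Let EG0 t : 0 <= EG t.
Proof. by apply: integral_ge0 => o _; rewrite lee_fin gsq_ge0. Qed.

Let EGC : \int[rho]_t EG t = CC.
Proof. by apply: (iterated_discounted mgY) => q; rewrite lee_fin gsq_ge0. Qed.

Let PPE : PP = 4^-1%:E * CC.
Proof.
rewrite /PP /CC -ge0_integralZl//; last by move=> q _; rewrite lee_fin gsq_ge0.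
apply: eq_integral => q _; rewrite -EFinM; congr EFin.
by rewrite /nsq /gsq mulr_sumr; apply: eq_bigr => i _; rewrite pfb; field.
Qed.

Lemma upper_total s : (0 < s)%R ->
  (expR (alpha * s ^+ 2))%:E * \int[rho]_t EZ t + (s ^+ 2 / 4)%:E * Dn s <=
  \int[rho]_t EZ t + (expR (alpha * s ^+ 2))%:E * \int[rho]_t (EZ t * small (s ^+ 2)%R t) +
    (s ^+ 2)%:E * Gn s + (s ^+ 2 / 2 * expR (alpha * s ^+ 2))%:E * CC.
Proof.
move=> s0; have h0 : (0 <= s ^+ 2)%R by exact: sqr_ge0.
have c0 : 0 <= (s ^+ 2 / 4)%:E by rewrite lee_fin divr_ge0.
have e0 : 0 <= (expR (alpha * s ^+ 2))%:E by rewrite lee_fin expR_ge0.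
have mEZh : measurable_fun setT (fun t : R => EZ (t + s ^+ 2)%R).
  by apply: (measurableT_comp mEZ); exact: measurable_funD.
have mEGh : measurable_fun setT (fun t : R => EG (t + s ^+ 2)%R).
  by apply: (measurableT_comp mEG); exact: measurable_funD.
have mcD : measurable_fun setT (fun t : R => (s ^+ 2 / 4)%:E * \int[P]_o (\sum_i grad_avg t (s ^+ 2) o i ^+ 2)%:E).
  by apply: emeasurable_funM => //; exact: mDt.
have mcG : measurable_fun setT (fun t : R => (s ^+ 2 / 4)%:E * EG (t + s ^+ 2)%R).
  by apply: emeasurable_funM.
have cD0 t : 0 <= (s ^+ 2 / 4)%:E * \int[P]_o (\sum_i grad_avg t (s ^+ 2) o i ^+ 2)%:E.
  by rewrite mule_ge0.
have cG0 t : 0 <= (s ^+ 2 / 4)%:E * EG (t + s ^+ 2)%R by rewrite mule_ge0.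
have mdh := mdrift (s ^+ 2)%R; have mDs := mDt s.
have sum0 t : 0 <= \sum_(k < N) mean_second_diff t s k by apply: sume_ge0 => k _; exact: msd_ge0.
have H : \int[rho]_t (EZ (t + s ^+ 2)%R +
      (s ^+ 2 / 4)%:E * \int[P]_o (\sum_i grad_avg t (s ^+ 2) o i ^+ 2)%:E) <=
    \int[rho]_t (EZ t + \sum_(k < N) mean_second_diff t s k +
      (s ^+ 2 / 4)%:E * EG (t + s ^+ 2)%R + drift_energy t (s ^+ 2)).
  apply: (exp_time_le alpha0 rhoE).
  - exact: emeasurable_funD.
  - apply: emeasurable_funD => //; apply: emeasurable_funD => //.
    by apply: emeasurable_funD => //; exact: msum.
  - by move=> t; rewrite adde_ge0.
  - by move=> t; rewrite adde_ge0// adde_ge0// adde_ge0.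
  - by move=> t t0; apply: upper_step => //; exact: ltW.
rewrite (@ge0_integralD _ _ _ rho _ measurableT (fun t : R => EZ (t + s ^+ 2)%R))// in H.
rewrite (@ge0_integralZl _ _ _ rho _ measurableT (fun t : R => \int[P]_o (\sum_i grad_avg t (s ^+ 2) o i ^+ 2)%:E))// in H.
have ms2 : measurable_fun setT (fun t : R => EZ t + \sum_(k < N) mean_second_diff t s k).
  by apply: emeasurable_funD => //; exact: msum.
have ms3 : measurable_fun setT (fun t : R => EZ t + \sum_(k < N) mean_second_diff t s k +
    (s ^+ 2 / 4)%:E * EG (t + s ^+ 2)%R).
  exact: emeasurable_funD.
have s20 t : 0 <= EZ t + \sum_(k < N) mean_second_diff t s k by rewrite adde_ge0.
have s30 t : 0 <= EZ t + \sum_(k < N) mean_second_diff t s k + (s ^+ 2 / 4)%:E * EG (t + s ^+ 2)%R.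
  by rewrite adde_ge0.
have ms1 := msum s.
rewrite [in X in _ <= X]ge0_integralD// in H.
rewrite [in X in _ <= X]ge0_integralD// in H.
rewrite [in X in _ <= X]ge0_integralD// in H.
rewrite second_diff_total// in H.
rewrite (@ge0_integralZl _ _ _ rho _ measurableT (fun t : R => EG (t + s ^+ 2)%R))// in H.
(* The shift formula restricts to times beyond h; dropping this restriction only enlarges the
   mean. *)
have HG : \int[rho]_t EG (t + s ^+ 2)%R <= (expR (alpha * s ^+ 2))%:E * CC.
  rewrite (exp_time_shift alpha0 rhoE)// lee_wpmul2l// -EGC.
  have mI : measurable_fun setT (fun t : R => if (s ^+ 2 < t)%R then 1 else 0 : \bar R).
    have -> : (fun t : R => if (s ^+ 2 < t)%R then 1 else 0 : \bar R) =
        (fun t => (\1_(`](s ^+ 2)%R, +oo[%classic : set R) t)%:E).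
      apply/funext => t; rewrite indicE; case: ifPn => ht.
        by rewrite mem_set//= in_itv/= ht.
      by rewrite memNset//= in_itv/= andbT; exact/negP.
    by apply/measurable_EFinP; exact: measurable_indic.
  apply: (exp_time_le alpha0 rhoE) => //.
  - by apply: emeasurable_funM; [exact: mEG|exact: mI].
  - by move=> t; apply: mule_ge0; [exact: EG0|case: ifP].
  - by move=> t _; case: ifP => _; rewrite ?mule1// mule0.
have HD := @drift_total (s ^+ 2)%R h0.
rewrite PPE in HD.
rewrite (shift_split h0).
rewrite [X in X + _ <= _]addeC -[X in X <= _]addeA.
apply: (le_trans (leeD2l _ H)).
have C0 : 0 <= CC by apply: integral_ge0 => q _; rewrite lee_fin gsq_ge0.
(* One half of this term bounds the gradient at the end of the window, the other half the drift
   energy, since |p|^2 = |grad z|^2 / 4. *)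
have -> : (s ^+ 2 / 2 * expR (alpha * s ^+ 2))%:E * CC =
    (s ^+ 2 / 4)%:E * ((expR (alpha * s ^+ 2))%:E * CC) +
    (s ^+ 2 * expR (alpha * s ^+ 2))%:E * (4^-1%:E * CC).
  rewrite !muleA -!EFinM -ge0_muleDl ?lee_fin.
  - by rewrite -EFinD; congr (_%:E * _); field.
  - by rewrite mulr_ge0 ?expR_ge0// divr_ge0.
  - by rewrite mulr_ge0 ?expR_ge0// mulr_ge0 ?expR_ge0.
rewrite [leLHS]addeA [leRHS]addeA; apply: leeD; last exact: HD.
rewrite [leLHS]addeA; apply: leeD; last by rewrite lee_wpmul2l.
by rewrite [leLHS]addeA [X in X + _ <= _]addeC.
Qed.

(** * Behaviour of the state near time zero *)

Variable x : 'rV[R]_N.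
Variable K0 : R.
Hypothesis zK : forall v, (z v <= nsq v + K0)%R.
Hypothesis gK : forall v, (gsq v <= 16 * nsq v + 8 * K0)%R.
Hypothesis Y0 : {ae P, forall o, Y 0 o = x}.
Hypothesis PPfin : PP < +oo.

Let PP0 : 0 <= PP. Proof. by apply: integral_ge0 => q _; rewrite lee_fin nsq_ge0. Qed.

Let EP t : \bar R := \int[P]_o (nsq (p t o))%:E.

Let mEP : measurable_fun setT EP.
Proof. by apply: (measurable_mean P mnp) => q; rewrite lee_fin nsq_ge0. Qed.

Let EP0 t : 0 <= EP t.
Proof. by apply: integral_ge0 => o _; rewrite lee_fin nsq_ge0. Qed.

(** On times up to 1 the exponential density is at least alpha exp(-alpha), so undiscounted energy
    costs at most the inverse factor. *)
Lemma initial_energy t : (0 < t <= 1)%R ->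
  drift_energy 0 t <= (expR alpha / alpha)%:E * PP.
Proof.
move=> /andP[t0 t1]; rewrite /drift_energy add0r.
rewrite /PP -(iterated_discounted mnp (fun q => nsq_ge0 _)) (rhoE mEP EP0).
have mP' : measurable_fun setT (fun r : R => EP r * (exp_ker alpha r)%:E).
  by apply: emeasurable_funM => //; apply/measurable_EFinP; exact: measurable_exp_ker.
have k0 r : 0 <= (exp_ker alpha r)%:E by rewrite lee_fin exp_ker_ge0.
rewrite -ge0_integralZl//; last 2 first.
- by move=> r _; rewrite mule_ge0.
- by rewrite lee_fin divr_ge0 ?expR_ge0// ltW.
(* Time 0 is removed because the kernel vanishes there and the lower bound on it fails. *)
rewrite -integral_itv_obnd_cbnd; last exact: measurable_funTS.
rewrite [leLHS]integral_mkcond; apply: ge0_le_integral => //.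
- by move=> r _; rewrite patchE; case: ifP => // _; exact: EP0.
- by apply/(measurable_restrictT _ (measurable_itv _)); exact: measurable_funTS.
- exact: emeasurable_funM.
move=> r _; rewrite patchE; case: ifPn => [|_]; last first.
  by rewrite !mule_ge0// lee_fin divr_ge0 ?expR_ge0// ltW.
rewrite inE/= in_itv/= => /andP[r0 rt].
rewrite -/(EP r) muleCA -EFinM; apply: (@le_trans _ _ (EP r * 1)); first by rewrite mule1.
apply: lee_wpmul2l; [exact: EP0|rewrite lee_fin].
have := @exp_ker_ge _ alpha alpha0 1%R r r0 (le_trans rt t1); rewrite mulr1 => h.
have e0 : (0 < expR alpha / alpha)%R by rewrite divr_gt0// expR_gt0.
apply: le_trans (ler_wpM2l (ltW e0) h).
by rewrite mulrA divfK ?gt_eqF// -expRD subrr expR0.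
Qed.

Let M1 : R := (2 * (expR alpha / alpha * fine PP) + 2 * sigma ^+ 2 * N%:R)%R.

Let M10 : (0 <= M1)%R.
Proof.
have f0 : (0 <= fine PP)%R by exact: fine_ge0.
have e0 : (0 <= expR alpha / alpha)%R by rewrite divr_ge0 ?expR_ge0// ltW.
apply: addr_ge0; apply: mulr_ge0 => //; first exact: mulr_ge0.
by apply: mulr_ge0 => //; exact: sqr_ge0.
Qed.

(** The displacement is a drift part, of mean square at most t times the energy by Cauchy-Schwarz,
    plus sigma times an increment of mean square t N; [M1] adds the two with a factor 2 for the
    square of a sum. *)
Lemma initial_displacement t : (0 < t <= 1)%R ->
  \int[P]_o (nsq (Y t o - x))%:E <= (M1 * t)%:E.
Proof.
move=> /[dup] t01 /andP[t0 t1].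
set s := Num.sqrt t; have s0 : (0 < s)%R by rewrite sqrtr_gt0.
have st : (s ^+ 2 = t)%R by rewrite sqr_sqrtr// ltW.
have mnD : measurable_fun setT (fun o => (nsq (D 0 t o))%:E).
  by apply/measurable_EFinP; apply: measurable_fun_row; [exact: continuous_nsq|move=> i; exact: mD].
have ED : \int[P]_o (nsq (D 0 t o))%:E = (t * N%:R)%:E.
  have -> : \int[P]_o (nsq (D 0 t o))%:E = \int[P]_o \int[P]_o' (nsq (s *: W o'))%:E.
    rewrite /D -st (@indep 0%R s (lexx _) s0 (fun u v => (nsq v)%:E))//.
      apply/measurable_EFinP; apply: measurable_fun_row; first exact: continuous_nsq.
      by move=> i; under eq_fun do rewrite !mxE; exact: (measurableT_comp (measurable_tnth i)).
    by move=> u v; rewrite lee_fin nsq_ge0.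
  rewrite integral_cst//=; rewrite [X in _ * X](_ : _ = 1); last exact: probability_setT.
  rewrite mule1; transitivity (\int[P]_o (t%:E * (nsq (W o))%:E)).
    by apply: eq_integral => o _; rewrite nsqZ st EFinM.
  rewrite ge0_integralZl//.
  - by rewrite (gaussian_nsq gW) -EFinM.
  - by apply/measurable_EFinP; apply: measurable_fun_row; [exact: continuous_nsq|exact: mW].
  - by move=> o _; rewrite lee_fin nsq_ge0.
  - by rewrite lee_fin ltW.
apply: (@le_trans _ _ (\int[P]_o ((2 * t)%:E * \int[mu]_(r in `[0%R, (0 + t)%R]) (nsq (p r o))%:E +
    (2 * sigma ^+ 2)%:E * (nsq (D 0 t o))%:E))).
  have p0 o : 0 <= \int[mu]_(r in `[0%R, (0 + t)%R]) (nsq (p r o))%:E.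
    by apply: integral_ge0 => r _; rewrite lee_fin nsq_ge0.
  have t20 : (0 <= 2 * t)%R by rewrite mulr_ge0// ltW.
  have s20 : (0 <= 2 * sigma ^+ 2)%R by rewrite mulr_ge0// sqr_ge0.
  apply: ae_ge0_le_integral => //.
  - by move=> o _; rewrite lee_fin nsq_ge0.
  - apply/measurable_EFinP; apply: measurable_fun_row; first exact: continuous_nsq.
    by move=> i; under eq_fun do rewrite !mxE; exact: measurable_funB.
  - by move=> o _; rewrite adde_ge0// mule_ge0// lee_fin// nsq_ge0.
  - by apply: emeasurable_funD; exact: emeasurable_funM.
  have I1 := @incr 0%R t (lexx _) t0.
  move: Y0 I1; apply: filterS2 => o Y0o H _.
  have dl := @drift_sum_le 0%R t o t0 (fun i => (H i).1).
  have dl' : (2 * t)%:E * ((\sum_i (\int[mu]_(r in `[0%R, (0 + t)%R]) p r o 0 i) ^+ 2) / t)%:E <=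
     (2 * t)%:E * \int[mu]_(r in `[0%R, (0 + t)%R]) (nsq (p r o))%:E by rewrite lee_wpmul2l.
  apply: le_trans (leeD2r _ dl'); rewrite -!EFinM -EFinD lee_fin.
  pose I : 'rV[R]_N := (\row_i \int[mu]_(r in `[0%R, (0 + t)%R]) p r o 0 i)%R.
  have -> : (Y t o - x = I + sigma *: D 0 t o)%R.
    apply/rowP => i; rewrite !mxE -[in LHS]Y0o.
    by have [_] := H i; rewrite add0r => ->; ring.
  apply: (le_trans (nsqD _ _)); rewrite nsqZ.
  have -> : ((\sum_i (\int[mu]_(r in `[0, 0 + t]) p r o 0 i) ^+ 2) = nsq I)%R.
    by apply: eq_bigr => i _; rewrite mxE.
  by rewrite le_eqVlt; apply/orP; left; apply/eqP; field; rewrite gt_eqF.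
have p0 o : 0 <= \int[mu]_(r in `[0%R, (0 + t)%R]) (nsq (p r o))%:E.
  by apply: integral_ge0 => r _; rewrite lee_fin nsq_ge0.
have t20 : 0 <= (2 * t)%:E by rewrite lee_fin mulr_ge0// ltW.
have s20 : 0 <= (2 * sigma ^+ 2)%:E by rewrite lee_fin mulr_ge0// sqr_ge0.
have d0 o : 0 <= (nsq (D 0 t o))%:E by rewrite lee_fin nsq_ge0.
have tp0 o : 0 <= (2 * t)%:E * \int[mu]_(r in `[0%R, (0 + t)%R]) (nsq (p r o))%:E.
  exact: mule_ge0.
have sd0' o : 0 <= (2 * sigma ^+ 2)%:E * (nsq (D 0 t o))%:E by exact: mule_ge0.
rewrite ge0_integralD//; [|exact: emeasurable_funM|exact: emeasurable_funM].
rewrite !ge0_integralZl//.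
rewrite ED mean_drift_energy.
have h : (2 * t)%:E * drift_energy 0 t <= (2 * t)%:E * ((expR alpha / alpha)%:E * PP).
  by rewrite lee_wpmul2l ?lee_fin ?mulr_ge0 ?(ltW t0)//; exact: initial_energy.
apply: (le_trans (leeD2r _ h)).
have -> : PP = (fine PP)%:E by rewrite fineK// ge0_fin_numE.
by rewrite -!EFinM -EFinD lee_fin /M1 le_eqVlt; apply/orP; left; apply/eqP; ring.
Qed.

(** One constant for both one-sided estimates: the lower one needs gsq(x)/2 + M1/2, the upper one
    16|x|^2 + 4 K0 + 16 M1 + M1/2. *)
Let M : R := (gsq x + 16 * nsq x + 4 * K0 + 17 * M1)%R.

Let K00 : (0 <= K0)%R.
Proof. by have := le_trans (z0 0%R) (zK 0%R); rewrite /nsq big1 ?add0r// => i _; rewrite mxE expr0n. Qed.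

Let mYx t : measurable_fun setT (fun o => (nsq (Y t o - x))%:E).
Proof.
apply/measurable_EFinP; apply: measurable_fun_row => [|i]; first exact: continuous_nsq.
by under eq_fun do rewrite !mxE; apply: measurable_funB => //; exact: mYt.
Qed.

Let mzt t : measurable_fun setT (fun o => (z (Y t o))%:E).
Proof. by apply/measurable_EFinP; exact: measurable_fun_row. Qed.

(** Young's inequality with weight [s]. Since E|Y(t) - x|^2 is of order s^2 for t <= s^2, both
    resulting terms are of order [s]. *)
Lemma pairing_le (a b : 'rV[R]_N) s : (0 < s)%R ->
  (\sum_i partial i z a * (b 0 i - a 0 i) <= s / 2 * gsq a + (2 * s)^-1 * nsq (b - a))%R.
Proof.
move=> s0; rewrite /gsq /nsq !mulr_sumr -big_split/=; apply: ler_sum => i _.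
rewrite !mxE; set g := partial i z a; set v := (b 0 i - a 0 i)%R.
rewrite -subr_ge0.
have -> : (s / 2 * g ^+ 2 + (2 * s)^-1 * v ^+ 2 - g * v = (2 * s)^-1 * (s * g - v) ^+ 2)%R.
  by field; rewrite gt_eqF.
by rewrite mulr_ge0 ?sqr_ge0// invr_ge0 mulr_ge0// ltW.
Qed.

Lemma initial_value_ge s t : (0 < s <= 1)%R -> (0 < t <= s ^+ 2)%R ->
  (z x)%:E <= EZ t + (s * M)%:E.
Proof.
move=> /andP[s0 s1] /andP[t0 ts].
have t1 : (0 < t <= 1)%R by rewrite t0 (le_trans ts)// expr_le1// ltW.
have c0 : (0 <= s / 2 * gsq x)%R by rewrite mulr_ge0 ?gsq_ge0// divr_ge0// ltW.
have i0 : (0 <= (2 * s)^-1)%R by rewrite invr_ge0 mulr_ge0// ltW.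
have n0 o : 0 <= (nsq (Y t o - x))%:E by rewrite lee_fin nsq_ge0.
have zz o : 0 <= (z (Y t o))%:E by rewrite lee_fin.
apply: (@le_trans _ _ (\int[P]_o ((z (Y t o))%:E + ((s / 2 * gsq x)%:E + (2 * s)^-1%:E * (nsq (Y t o - x))%:E)))).
  have -> : (z x)%:E = \int[P]_o (z x)%:E.
    by rewrite integral_cst//= [X in _ * X](_ : _ = 1) ?mule1//; exact: probability_setT.
  apply: ge0_le_integral => //.
  - by move=> o _; rewrite lee_fin.
  - by apply: emeasurable_funD => //; apply: emeasurable_funD => //; exact: emeasurable_funM.
  move=> o _; rewrite -EFinM -!EFinD lee_fin.
  have := subg x (Y t o).
  (* The reflected point reverses the sign of the pairing and keeps the distance, which turns the
     upper bound into the lower bound required. *)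
  have := pairing_le x (2 *: x - Y t o) s0.
  have -> : (\sum_i partial i z x * ((2 *: x - Y t o) 0 i - x 0 i) = - \sum_i partial i z x * (Y t o 0 i - x 0 i))%R.
    by rewrite -sumrN; apply: eq_bigr => i _; rewrite !mxE; ring.
  have -> : nsq (2 *: x - Y t o - x) = nsq (Y t o - x).
    by apply: eq_bigr => i _; rewrite !mxE; ring.
  by move=> h1 h2; lra.
have mc : measurable_fun setT (fun o => (s / 2 * gsq x)%:E + (2 * s)^-1%:E * (nsq (Y t o - x))%:E).
  by apply: emeasurable_funD => //; exact: emeasurable_funM.
have mi : measurable_fun setT (fun o => (2 * s)^-1%:E * (nsq (Y t o - x))%:E) by exact: emeasurable_funM.
have c0' o : 0 <= (s / 2 * gsq x)%:E + (2 * s)^-1%:E * (nsq (Y t o - x))%:E.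
  by rewrite -EFinM -EFinD lee_fin addr_ge0// mulr_ge0// nsq_ge0.
have i0' o : 0 <= (2 * s)^-1%:E * (nsq (Y t o - x))%:E by rewrite mule_ge0// lee_fin.
rewrite (ge0_integralD _ _ (fun o _ => zz o) (mzt t) (fun o _ => c0' o) mc)//.
rewrite (ge0_integralD _ _ _ _ (fun o _ => i0' o) mi)//.
rewrite (ge0_integralZl _ _ (mYx t) (fun o _ => n0 o))// integral_cst//= [X in _ * X + _](_ : _ = 1); last exact: probability_setT.
apply: leeD2l; rewrite mule1.
have h : (2 * s)^-1%:E * \int[P]_o (nsq (Y t o - x))%:E <= (2 * s)^-1%:E * (M1 * t)%:E.
  by rewrite lee_wpmul2l ?lee_fin//; exact: initial_displacement.
apply: (le_trans (leeD2l _ h)); rewrite -EFinM -EFinD lee_fin.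
have h2 : ((2 * s)^-1 * (M1 * t) <= (2 * s)^-1 * (M1 * s ^+ 2))%R.
  by rewrite ler_wpM2l// ler_wpM2l.
have h3 : ((2 * s)^-1 * (M1 * s ^+ 2) = s * M1 / 2)%R by field; rewrite gt_eqF.
have := nsq_ge0 x; have := gsq_ge0 x; rewrite /M.
move=> g0 nx; rewrite h3 in h2.
have := mulr_ge0 (ltW s0) g0; have := mulr_ge0 (ltW s0) nx.
have := mulr_ge0 (ltW s0) K00; have := mulr_ge0 (ltW s0) M10.
by move=> ? ? ? ?; lra.
Qed.

(** Here the subgradient is taken at the random state, so its square is first bounded by the
    quadratic growth [gK] and |Y|^2 by 2|x|^2 + 2|Y - x|^2. *)
Lemma initial_value_le s t : (0 < s <= 1)%R -> (0 < t <= s ^+ 2)%R ->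
  EZ t <= (z x + s * M)%:E.
Proof.
move=> /andP[s0 s1] /andP[t0 ts].
have t1 : (0 < t <= 1)%R by rewrite t0 (le_trans ts)// expr_le1// ltW.
have x0 := nsq_ge0 x.
pose c := (z x + s * (16 * nsq x + 4 * K0))%R.
pose k := (16 * s + (2 * s)^-1)%R.
have c0 : (0 <= c)%R by rewrite addr_ge0// mulr_ge0 ?(ltW s0)// addr_ge0// mulr_ge0.
have k0 : (0 <= k)%R by rewrite addr_ge0 ?invr_ge0 ?mulr_ge0// ltW.
have n0 o : 0 <= (nsq (Y t o - x))%:E by rewrite lee_fin nsq_ge0.
apply: (@le_trans _ _ (\int[P]_o (c%:E + k%:E * (nsq (Y t o - x))%:E))).
  apply: ge0_le_integral => //.
  - by move=> o _; rewrite lee_fin.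
  - by apply: emeasurable_funD => //; exact: emeasurable_funM.
  move=> o _; rewrite -EFinM -!EFinD lee_fin /c /k.
  set y := Y t o.
  have h1 := subg y x.
  have h2 : (- (\sum_i partial i z y * (x 0 i - y 0 i)) <= s / 2 * gsq y + (2 * s)^-1 * nsq (y - x))%R.
    have := pairing_le y (2 *: y - x) s0.
    have -> : (\sum_i partial i z y * ((2 *: y - x) 0 i - y 0 i) = - \sum_i partial i z y * (x 0 i - y 0 i))%R.
      by rewrite -sumrN; apply: eq_bigr => i _; rewrite !mxE; ring.
    have -> // : nsq (2 *: y - x - y) = nsq (y - x).
    by apply: eq_bigr => i _; rewrite !mxE; ring.
  have h3 := gK y.
  have h4 : (nsq y <= 2 * nsq x + 2 * nsq (y - x))%R.
    by have := nsqD x (y - x); rewrite addrC subrK.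
  have h5 : (s / 2 * gsq y <= s / 2 * (16 * (2 * nsq x + 2 * nsq (y - x)) + 8 * K0))%R.
    by rewrite ler_wpM2l ?divr_ge0 ?(ltW s0)//; lra.
  rewrite [leRHS](_ : _ = z x + (s / 2 * (16 * (2 * nsq x + 2 * nsq (y - x)) + 8 * K0)) + (2 * s)^-1 * nsq (y - x))%R; last first.
    by field; rewrite gt_eqF.
  lra.
have i0' o : 0 <= k%:E * (nsq (Y t o - x))%:E by rewrite mule_ge0// lee_fin.
have mi : measurable_fun setT (fun o => k%:E * (nsq (Y t o - x))%:E) by exact: emeasurable_funM.
rewrite (ge0_integralD _ _ _ _ (fun o _ => i0' o) mi)//.
rewrite (ge0_integralZl _ _ (mYx t) (fun o _ => n0 o))// integral_cst//= [X in _ * X + _](_ : _ = 1); last exact: probability_setT.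
rewrite mule1.
have h : k%:E * \int[P]_o (nsq (Y t o - x))%:E <= k%:E * (M1 * t)%:E.
  by rewrite lee_wpmul2l ?lee_fin//; exact: initial_displacement.
apply: (le_trans (leeD2l _ h)); rewrite -EFinM -EFinD lee_fin.
have h2 : (k * (M1 * t) <= k * (M1 * s ^+ 2))%R by rewrite ler_wpM2l// ler_wpM2l.
have h3 : (k * (M1 * s ^+ 2) = 16 * M1 * s ^+ 3 + s * M1 / 2)%R by rewrite /k; field; rewrite gt_eqF.
have h4 : (s ^+ 3 <= s)%R by rewrite exprS ler_piMr ?(ltW s0)// expr_le1// ltW.
have h5 : (16 * M1 * s ^+ 3 <= 16 * M1 * s)%R by rewrite ler_wpM2l// mulr_ge0.
have := gsq_ge0 x; rewrite /M /c => g0; rewrite h3 in h2.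
have := mulr_ge0 (ltW s0) g0; have := mulr_ge0 (ltW s0) x0.
have := mulr_ge0 (ltW s0) M10.
by move=> ? ? ?; lra.
Qed.

Let BB s : \bar R := \int[rho]_t (EZ t * small (s ^+ 2)%R t).

Let M0 : (0 <= M)%R.
Proof. by rewrite !addr_ge0 ?gsq_ge0 ?mulr_ge0// nsq_ge0. Qed.

Let mEZs h : measurable_fun setT (fun t : R => EZ t * small h t).
Proof. by apply: emeasurable_funM; [exact: mEZ|exact: msmall]. Qed.

Let EZs0 h t : 0 <= EZ t * small h t.
Proof. exact: mule_ge0. Qed.

Lemma initial_layer_le s : (0 < s <= 1)%R ->
  BB s <= ((z x + s * M) * (alpha * s ^+ 2))%:E.
Proof.
move=> /[dup] s01 /andP[s0 s1].
have k0 : (0 <= z x + s * M)%R by rewrite addr_ge0// mulr_ge0// ltW.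
have ms := msmall (s ^+ 2)%R.
apply: (@le_trans _ _ (\int[rho]_t ((z x + s * M)%:E * small (s ^+ 2)%R t))).
  apply: (exp_time_le alpha0 rhoE) => //.
  - exact: emeasurable_funM.
  - by move=> t; rewrite mule_ge0// lee_fin.
  move=> t t0; rewrite /small; case: ifPn => ts; last by rewrite !mule0.
  by rewrite !mule1; apply: initial_value_le => //; rewrite t0.
rewrite (@ge0_integralZl _ _ _ rho _ measurableT (small (s ^+ 2)%R))//.
rewrite EFinM lee_wpmul2l ?lee_fin//.
by have /andP[] := exp_time_small alpha0 rhoE (sqr_ge0 s).
Qed.

(** With [initial_layer_le], this says that the initial layer is alpha h z(x) up to a relative error
    that vanishes with [s]. *)
Lemma initial_layer_ge s : (0 < s <= 1)%R ->
  (z x * (alpha * s ^+ 2 * expR (- alpha * s ^+ 2)))%:E <=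
  BB s + (s * M * (alpha * s ^+ 2))%:E.
Proof.
move=> /[dup] s01 /andP[s0 s1].
have k0 : (0 <= s * M)%R by rewrite mulr_ge0// ltW.
have zx0 : 0 <= (z x)%:E by rewrite lee_fin.
have ms := msmall (s ^+ 2)%R.
have /andP[q1 q2] := exp_time_small alpha0 rhoE (sqr_ge0 s).
apply: (@le_trans _ _ (\int[rho]_t ((z x)%:E * small (s ^+ 2)%R t))).
  rewrite (@ge0_integralZl _ _ _ rho _ measurableT (small (s ^+ 2)%R))//.
  by rewrite EFinM lee_wpmul2l ?lee_fin.
have mk : measurable_fun setT (fun t : R => (s * M)%:E * small (s ^+ 2)%R t) by exact: emeasurable_funM.
have kk0 t : 0 <= (s * M)%:E * small (s ^+ 2)%R t by rewrite mule_ge0// lee_fin.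
apply: (@le_trans _ _ (\int[rho]_t (EZ t * small (s ^+ 2)%R t + (s * M)%:E * small (s ^+ 2)%R t))).
  apply: (exp_time_le alpha0 rhoE) => //.
  - exact: emeasurable_funM.
  - exact: emeasurable_funD.
  - by move=> t; rewrite mule_ge0// lee_fin.
  - by move=> t; rewrite adde_ge0.
  move=> t t0; rewrite /small; case: ifPn => ts; last by rewrite !mule0 adde0.
  by rewrite !mule1; apply: initial_value_ge => //; rewrite t0.
have mE := mEZs (s ^+ 2)%R.
rewrite (@ge0_integralD _ _ _ rho _ measurableT (fun t : R => EZ t * small (s ^+ 2)%R t))//.
apply: leeD2l; rewrite (@ge0_integralZl _ _ _ rho _ measurableT (small (s ^+ 2)%R))//.
by rewrite [leRHS]EFinM lee_wpmul2l ?lee_fin.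
Qed.

(** * The averaged HJB equation and the two bounds on the cost *)

Variable KH : R.
Hypothesis dz : forall k v, derivable z v (unitv k).
Hypothesis ddz : forall k v, derivable (partial k z) v (unitv k).
Hypothesis cH : forall k, continuous (partial k (partial k z)).
Hypothesis HK : forall k v, (0 <= partial k (partial k z) v <= KH * (1 + nsq v))%R.
Hypothesis hjb : forall v,
  (- (2 * sigma ^+ 2) * \sum_k partial k (partial k z) v + gsq v + 4 * alpha * z v = 4 * nsq v)%R.
Hypothesis Y2 : \int[discounted_measure]_q (nsq (state_at q))%:E < +oo.

Let SS : \bar R := \int[discounted_measure]_q (nsq (state_at q))%:E.
Let AA : \bar R := \int[discounted_measure]_q (z (state_at q))%:E.
Let LL : \bar R := \sum_k \int[discounted_measure]_q (partial k (partial k z) (state_at q))%:E.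

Let SFQ : {sigma_finite_measure set (measurableTypeR R * T)%type -> \bar R} :=
  lebesgue_integral_fubini_product_measure1__canonical__probability_measure_Probability rho P.

Let EZA : \int[rho]_t EZ t = AA.
Proof. by apply: (iterated_discounted mz) => q; rewrite lee_fin. Qed.

Let mS : measurable_fun setT (fun q => (nsq (state_at q))%:E).
Proof. by apply/measurable_EFinP; apply: measurable_fun_row => //; exact: continuous_nsq. Qed.

Let mH k : measurable_fun setT (fun q => (partial k (partial k z) (state_at q))%:E).
Proof. by apply/measurable_EFinP; apply: measurable_fun_row. Qed.

Let growth (g : 'rV[R]_N -> R) K : continuous g ->
  (forall v, 0 <= g v <= K * (1 + nsq v))%R -> \int[discounted_measure]_q (g (state_at q))%:E < +oo.
Proof. by move=> cg' gK'; exact: (@integral_quadratic_lty _ _ _ _ SFQ discounted_measure_setT state_at mYY Y2 g cg' K gK'). Qed.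

Let zK' v : (0 <= z v <= (1 + K0) * (1 + nsq v))%R.
Proof.
rewrite z0/=; apply: le_trans (zK v) _; rewrite mulrDl mul1r mulrDr mulr1.
have := mulr_ge0 K00 (nsq_ge0 v); lra.
Qed.

Let gK' v : (0 <= gsq v <= (16 + 8 * K0) * (1 + nsq v))%R.
Proof.
rewrite gsq_ge0/=; apply: le_trans (gK v) _.
have := mulr_ge0 K00 (nsq_ge0 v); lra.
Qed.

Let AAfin : AA \is a fin_num.
Proof.
rewrite ge0_fin_numE; first exact: (growth cz zK').
by apply: integral_ge0 => q _; rewrite lee_fin.
Qed.

Let CCfin : CC \is a fin_num.
Proof.
rewrite ge0_fin_numE; first exact: (growth continuous_gsq gK').
by apply: integral_ge0 => q _; rewrite lee_fin gsq_ge0.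
Qed.

Let H0 k v : (0 <= partial k (partial k z) v)%R.
Proof. by have /andP[] := HK k v. Qed.

Let LLfin : LL \is a fin_num.
Proof.
rewrite ge0_fin_numE; last first.
  by apply: sume_ge0 => k _; apply: integral_ge0 => q _; rewrite lee_fin.
by apply: lte_sum_pinfty => k _; exact: (@growth (partial k (partial k z)) KH (@cH k) (HK k)).
Qed.

Let SSfin : SS \is a fin_num.
Proof. by rewrite ge0_fin_numE//; apply: integral_ge0 => q _; rewrite lee_fin nsq_ge0. Qed.

(** The equation is averaged with its negative term moved to the other side. Quadratic growth makes
    the four means finite, so the result can be read in the reals, divided by 4. *)
Lemma integrated_hjb :
  (alpha * fine AA + fine CC / 4 = fine SS + sigma ^+ 2 / 2 * fine LL)%R.
Proof.
have a4 : (0 <= 4 * alpha)%R by rewrite mulr_ge0// ltW.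
have s2 : (0 <= 2 * sigma ^+ 2)%R by rewrite mulr_ge0// sqr_ge0.
have E : CC + (4 * alpha)%:E * AA = 4%:E * SS + (2 * sigma ^+ 2)%:E * LL.
  have g0 q : 0 <= (gsq (state_at q))%:E by rewrite lee_fin gsq_ge0.
  have zz q : 0 <= (z (state_at q))%:E by rewrite lee_fin.
  have n0 q : 0 <= (nsq (state_at q))%:E by rewrite lee_fin nsq_ge0.
  have HH0 k q : 0 <= (partial k (partial k z) (state_at q))%:E by rewrite lee_fin.
  have mHs : measurable_fun setT (fun q => \sum_k (partial k (partial k z) (state_at q))%:E).
    exact: emeasurable_sum.
  have Hs0 q : 0 <= \sum_k (partial k (partial k z) (state_at q))%:E by apply: sume_ge0.
  have -> : LL = \int[discounted_measure]_q \sum_k (partial k (partial k z) (state_at q))%:E.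
    by rewrite ge0_integral_sum.
  rewrite /CC /AA /SS -!ge0_integralZl//; [|by rewrite lee_fin..].
  rewrite -ge0_integralD//; last 2 first.
  - by move=> q _; rewrite mule_ge0.
  - exact: emeasurable_funM.
  rewrite -ge0_integralD//; last 4 first.
  - by move=> q _; rewrite mule_ge0.
  - exact: emeasurable_funM.
  - by move=> q _; rewrite mule_ge0.
  - exact: emeasurable_funM.
  apply: eq_integral => q _; rewrite sumEFin -!EFinM -!EFinD; congr EFin.
  by have := hjb (state_at q); lra.
move: E; move: AAfin CCfin LLfin SSfin.
move: AA CC LL SS => [a||//] [c||//] [l||//] [s'||//]// _ _ _ _ [] /=; lra.
Qed.

Let s_ n : R := harmonic n.
Let s01 n : (0 < s_ n <= 1)%R.
Proof. by rewrite harmonic_gt0/= invf_le1 ?ler1n. Qed.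

Let Gcvg : Gn (s_ n) @[n --> \oo] --> (sigma ^+ 2 / 2 * fine LL)%:E.
Proof.
have Hfin k : \int[discounted_measure]_q (partial k (partial k z) (state_at q))%:E \is a fin_num.
  rewrite ge0_fin_numE; first exact: (@growth (partial k (partial k z)) KH (@cH k) (HK k)).
  by apply: integral_ge0 => q _; rewrite lee_fin.
have -> : (sigma ^+ 2 / 2 * fine LL = \sum_k sigma ^+ 2 / 2 * fine (\int[discounted_measure]_q (partial k (partial k z) (state_at q))%:E))%R.
  rewrite -mulr_sumr /LL; congr (_ * _)%R; rewrite [in LHS](eq_bigr (fun k =>
    (fine (\int[discounted_measure]_q (partial k (partial k z) (state_at q))%:E))%:E)) ?sumEFin//.
  by move=> k _; rewrite fineK.
apply: cvg_sume_fin => k; rewrite EFinM fineK//.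
exact: (@cvg_integral_second_diff _ _ _ _ P W gW _ _ SFQ discounted_measure_setT state_at mYY Y2 sigma s_ s01 cvg_harmonic (partial k (partial k z)) (@cH k) KH (HK k) z k cz (@sd0 k) (@dz k) (@ddz k) erefl).
Qed.

Let Ccvg : Cn (s_ n) @[n --> \oo] --> (fine CC)%:E.
Proof.
rewrite fineK//.
exact: (@cvg_integral_perturbed _ _ _ _ P W gW _ _ SFQ discounted_measure_setT state_at mYY Y2 sigma s_ s01 cvg_harmonic gsq continuous_gsq _ gK').
Qed.

(** The limit inequality is sigma^2/2 L + alpha z(x) <= alpha A + C/4 + E|p|^2, with A, C, L the
    means of z, |grad z|^2 and the Laplacian; by the averaged equation alpha A + C/4 is sigma^2/2 L
    plus the mean of |y|^2. *)
Lemma value_le_cost : (alpha * z x)%:E <= SS + PP.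
Proof.
have PPf : PP \is a fin_num by rewrite ge0_fin_numE.
rewrite -(fineK SSfin) -(fineK PPf) -EFinD lee_fin.
have A0 : (0 <= fine AA)%R by apply: fine_ge0; apply: integral_ge0 => q _; rewrite lee_fin.
have := @lower_limit R alpha (fine AA) (fine CC) (sigma ^+ 2 / 2 * fine LL)%R (z x) M s_
  (fun n => BB (s_ n)) (fun n => Gn (s_ n)) alpha0 A0 (fun n => (andP (s01 n)).1) cvg_harmonic Gcvg
  (fun n => initial_layer_le (s01 n)) (fun n => _) (fine PP) (fun n => Cn (s_ n)) Ccvg (fine_ge0 PP0)
  (fun n => initial_layer_ge (s01 n)) _.
move=> H; have := integrated_hjb.
suff : (sigma ^+ 2 / 2 * fine LL + alpha * z x <= alpha * fine AA + fine CC / 4 + fine PP)%R by lra.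
apply: H.
- by move=> n; apply: integral_ge0 => t _; exact: EZs0.
- move=> n; rewrite !fineK// -EZA; apply: lower_total.
  by have /andP[] := s01 n.
Qed.

Hypothesis path : forall t, (0 < t)%R ->
  {ae P, forall o, forall i, grad_avg t (s_ n ^+ 2)%R o i @[n --> \oo] --> (2 * partial i z (Y t o))%R}.

(** Fatou is applied twice, over outcomes at fixed time and then over time, because the almost sure
    convergence [path] is given separately for each [t]. *)
Lemma fatou_grad : (4 * fine CC)%:E <= limn_einf (fun n => Dn (s_ n)).
Proof.
have mga n : measurable_fun setT (fun q : measurableTypeR R * T => (\sum_i grad_avg q.1 (s_ n ^+ 2) q.2 i ^+ 2)%:E).
  exact: measurable_grad_avg.
have mgt n t : measurable_fun setT (fun o => (\sum_i grad_avg t (s_ n ^+ 2) o i ^+ 2)%:E).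
  exact: (measurableT_comp (mga n) (pair1_measurable t)).
have g0 n t o : 0 <= (\sum_i grad_avg t (s_ n ^+ 2) o i ^+ 2)%:E.
  by rewrite lee_fin sumr_ge0// => i _; exact: sqr_ge0.
rewrite EFinM fineK// -EGC.
apply: (@le_trans _ _ (\int[rho]_t limn_einf (fun n => \int[P]_o (\sum_i grad_avg t (s_ n ^+ 2) o i ^+ 2)%:E))); last first.
  exact: (fatou rho measurableT (fun n => mDt (s_ n)) (fun n t _ => Dt0 (s_ n) t)).
rewrite -(@ge0_integralZl _ _ _ rho _ measurableT EG)//.
apply: (exp_time_le alpha0 rhoE).
- by apply: emeasurable_funM => //; exact: mEG.
- exact: (measurable_limn_einf (fun n => mDt (s_ n))).
- by move=> t; rewrite mule_ge0//; exact: EG0.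
- by move=> t; apply: limn_einf_ge0 => n; exact: Dt0.
move=> t t0.
apply: (@le_trans _ _ (\int[P]_o limn_einf (fun n => (\sum_i grad_avg t (s_ n ^+ 2) o i ^+ 2)%:E))); last first.
  exact: (fatou P measurableT (fun n => mgt n t) (fun n o _ => g0 n t o)).
have mgY' : measurable_fun setT (fun o => (gsq (Y t o))%:E).
  by apply/measurable_EFinP; apply: measurable_fun_row => //; exact: continuous_gsq.
rewrite -ge0_integralZl//; last by move=> o _; rewrite lee_fin gsq_ge0.
apply: ae_ge0_le_integral => //.
- by move=> o _; rewrite mule_ge0// lee_fin gsq_ge0.
- exact: emeasurable_funM.
- by move=> o _; apply: limn_einf_ge0.
- exact: (measurable_limn_einf (fun n => mgt n t)).
move: (path t0); apply: filterS => o H _.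
have C : (\sum_i grad_avg t (s_ n ^+ 2) o i ^+ 2)%:E @[n --> \oo] --> (4 * gsq (Y t o))%:E.
  apply: cvg_EFin; first exact: nearW.
  have -> : (4 * gsq (Y t o) = \sum_i (2 * partial i z (Y t o)) ^+ 2)%R.
    by rewrite /gsq mulr_sumr; apply: eq_bigr => i _; ring.
  apply: cvg_sumr => i _.
  by apply: (cvg_comp (fun n => grad_avg t (s_ n ^+ 2)%R o i) (fun x => x ^+ 2)%R); [exact: H|exact: sqr_continuous].
by rewrite (cvg_limn_einf_sup C).1 EFinM.
Qed.

(** The limit gives alpha A + C/2 <= alpha z(x) + sigma^2/2 L; subtracting the averaged equation
    leaves the mean of |y|^2 plus C/4 on the left, and C/4 is the control energy of the feedback. *)
Lemma cost_le_value : SS + PP <= (alpha * z x)%:E.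
Proof.
have PPf : PP \is a fin_num by rewrite ge0_fin_numE.
have C4 : (fine PP = fine CC / 4)%R by rewrite PPE -(fineK CCfin) -EFinM /= mulrC.
rewrite -(fineK SSfin) -(fineK PPf) -EFinD lee_fin C4.
have A0 : (0 <= fine AA)%R by apply: fine_ge0; apply: integral_ge0 => q _; rewrite lee_fin.
have H := @upper_limit R alpha (fine AA) (fine CC) (sigma ^+ 2 / 2 * fine LL)%R (z x) M s_
  (fun n => BB (s_ n)) (fun n => Gn (s_ n)) alpha0 A0 (fun n => (andP (s01 n)).1) cvg_harmonic Gcvg
  (fun n => initial_layer_le (s01 n)).
have := integrated_hjb.
suff : (alpha * fine AA + fine CC / 2 <= alpha * z x + sigma ^+ 2 / 2 * fine LL)%R by lra.
apply: (H _ _ (fun n => Dn (s_ n)) _ fatou_grad).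
- by move=> n; apply: integral_ge0 => t _; exact: EZs0.
- move=> n; apply: sume_ge0 => k _; apply: integral_ge0 => q _; apply: integral_ge0 => o _.
  by rewrite lee_fin !mulr_ge0// invr_ge0 sqr_ge0.
- by move=> n; apply: integral_ge0 => t _; exact: Dt0.
- move=> n; rewrite !fineK// -EZA; apply: upper_total.
  by have /andP[] := s01 n.
Qed.

End system.

(** * The value function and the controlled systems *)

Section value_bounds.
Context {R : realType} {N : nat}.
Variables alpha sigma : R.
Hypotheses (alpha0 : 0 < alpha) (sigma0 : 0 < sigma) (N0 : (0 < N)%N).
Variable z : 'rV[R]_N -> R.
Hypothesis zC2 : is_C2 setT z.
Hypothesis zconstr : constructed_by_balls alpha sigma z.
Hypothesis zpos : forall x, 0 < z x.
Hypothesis zconv : convex_function setT z.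
Hypothesis zeq : forall x, hjb_equation alpha sigma z x.

Definition growth_const : R := 1 + N%:R * sigma ^+ 2 / alpha.

Lemma C2_continuous : continuous z.
Proof. by move=> v; have [] := zC2 (x := v) I. Qed.

Lemma C2_partial_continuous i : continuous (partial i z).
Proof. by move=> v; have [_ H _] := zC2 (x := v) I; have [] := H i. Qed.

Lemma C2_derivable i v : derivable z v (unitv i).
Proof. by have [_ H _] := zC2 (x := v) I; have [] := H i. Qed.

Lemma C2_partial_derivable i v : derivable (partial i z) v (unitv i).
Proof. by have [_ _ H] := zC2 (x := v) I; have [] := H i i. Qed.

Lemma C2_second_continuous i : continuous (partial i (partial i z)).
Proof. by move=> v; have [_ _ H] := zC2 (x := v) I; have [] := H i i. Qed.

Lemma value_subgradient (a b : 'rV[R]_N) : z a + \sum_i partial i z a * (b 0 i - a 0 i) <= z b.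
Proof. by apply: convex_subgradient => // v k; exact: C2_derivable. Qed.

Lemma growth_const_ge0 : 0 <= growth_const.
Proof. by rewrite addr_ge0// divr_ge0 ?mulr_ge0 ?sqr_ge0// ltW. Qed.

(** Comes from u >= [u_sub]: -2 sigma^2 ln of [u_sub] is |x|^2 + 1 + N sigma^2/alpha. *)
Lemma value_quadratic v : z v <= nsq v + growth_const.
Proof.
have [u [_ [_ [_ _ _ ueq zu]]]] := zconstr.
have [_ /andP[ul u1]] := ueq v.
have s2 : 0 < sigma ^+ 2 by rewrite exprn_gt0.
have us0 : 0 < u_sub alpha sigma v by exact: expR_gt0.
have : ln (u_sub alpha sigma v) <= ln (u v) by rewrite ler_ln// posrE (lt_le_trans us0).
rewrite /u_sub expRK enorm_sqr zu /growth_const => h.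
have h2 := ler_wpM2l (mulr_ge0 (ler0n R 2) (ltW s2)) h.
rewrite [X in X <= _](_ : _ = - (nsq v + (1 + N%:R * sigma ^+ 2 / alpha))) in h2; last first.
  by field; rewrite !gt_eqF.
by rewrite mulNr lerNl.
Qed.

Lemma gradient_quadratic v : gsq z v <= 16 * nsq v + 8 * growth_const.
Proof.
apply: convex_quadratic_grad => //; first by move=> u k; exact: C2_derivable.
by move=> u; rewrite (ltW (zpos u)) value_quadratic.
Qed.

Lemma hjb_sum v : - (2 * sigma ^+ 2) * \sum_k partial k (partial k z) v + gsq z v +
  4 * alpha * z v = 4 * nsq v.
Proof.
have := zeq v; rewrite /hjb_equation /laplacian !enorm_sqr => <-.
by congr (_ + _ + _); apply: eq_bigr => i _; rewrite mxE.
Qed.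

Lemma second_partial_ge0 k v : 0 <= partial k (partial k z) v.
Proof.
apply: convex_second_partial_ge0 => //.
- by move=> u i; exact: C2_derivable.
- by move=> u; exact: C2_partial_derivable.
- exact: C2_second_continuous.
Qed.

Definition hessian_const : R :=
  (16 + 8 * growth_const + 4 * alpha * (1 + growth_const)) / (2 * sigma ^+ 2).

(** Convexity makes every pure second partial nonnegative, so each is at most the Laplacian, and the
    HJB equation expresses the Laplacian through |grad z|^2 and z, both of quadratic growth. *)
Lemma second_partial_quadratic k v :
  0 <= partial k (partial k z) v <= hessian_const * (1 + nsq v).
Proof.
rewrite second_partial_ge0/=.
have s2 : 0 < 2 * sigma ^+ 2 by rewrite mulr_gt0// exprn_gt0.
have h1 : partial k (partial k z) v <= \sum_i partial i (partial i z) v.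
  by rewrite (bigD1 k)//= lerDl sumr_ge0// => i _; exact: second_partial_ge0.
apply: (le_trans h1); rewrite /hessian_const mulrAC ler_pdivlMr//.
have := hjb_sum v; have := gradient_quadratic v; have := value_quadratic v.
have g0 := growth_const_ge0; have n0 := nsq_ge0 v => h2 h3 h4.
have h5 := ler_wpM2l (mulr_ge0 (ler0n R 4) (ltW alpha0)) h2.
have h6 := mulr_ge0 g0 n0; have h7 := mulr_ge0 (ltW alpha0) h6.
move: (\sum_i _) growth_const (nsq v) (z v) (gsq z v) h2 h3 h4 h5 h6 h7 g0 n0.
move: (sigma ^+ 2) alpha alpha0 => s a a0 S g n u G h2 h3 h4 h5 h6 h7 g0 n0.
by lra.
Qed.

End value_bounds.

(** * What a controlled system provides *)

Section driven_system.
Local Open Scope ereal_scope.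
Context {R : realType} {N : nat} {d : measure_display} {T : measurableType d}.
Notation mu := (@lebesgue_measure R).
Variables (alpha sigma : R) (x : 'rV[R]_N).
Hypothesis alpha0 : (0 < alpha)%R.
Variable P : probability T R.

(* Constant extension to negative times: it is jointly measurable on the whole
   line, where the library measures live. *)
Definition from0 (y : R -> T -> 'rV[R]_N) (t : R) : T -> 'rV[R]_N := y (Num.max 0%R t).

Lemma from0E y t : (0 <= t)%R -> from0 y t = y t.
Proof. by move=> t0; rewrite /from0 max_r. Qed.

Lemma measurable_from0 y : measurable_process y ->
  forall i, measurable_fun setT (fun q : measurableTypeR R * T => from0 y q.1 q.2 0%R i).
Proof.
move=> my i; have m0 : measurable ((`[0%R, +oo[%classic : set R) `*` [set: T] : set (measurableTypeR R * T)).
  by apply: measurableX => //; exact: measurable_itv.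
apply: (@measurable_comp _ _ _ _ _ _ _
  (fun q : measurableTypeR R * T => y q.1 q.2 0%R i) setT
  (fun q : measurableTypeR R * T => (Num.max 0%R q.1 : measurableTypeR R, q.2)) m0).
- by move=> _ [q _ <-] /=; split=> //=; rewrite in_itv/= andbT le_max lexx.
- exact: my.
- apply: measurable_fun_pair => //.
  apply: (measurable_maxr (measurable_cst _)); exact: measurable_fst.
Qed.

Variable F : R -> set (set T).
Variables w p y : R -> T -> 'rV[R]_N.
Hypothesis BM : brownian_motion P F w.
Hypothesis CS : controlled_system P F w sigma x p y.

Let mY := @measurable_from0 y (let: And5 _ _ h _ _ := CS in h).
Let mp := @measurable_from0 p (let: And5 h _ _ _ _ := CS in h).

Lemma measurable_at (v : R -> T -> 'rV[R]_N) t i : measurable_process v -> (0 <= t)%R ->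
  measurable_fun setT (fun o => v t o 0%R i).
Proof.
move=> /measurable_from0 mv t0.
have := measurableT_comp (mv i) (pair1_measurable t).
by apply: eq_measurable_fun => o _ /=; rewrite from0E.
Qed.

(* The sets of the completed filtration are not known to be measurable before
   the noise is; completeness lets the state equation provide it. *)
Lemma noise_measurable_complete : measure_is_complete P -> (0 < sigma)%R ->
  forall t i, (0 <= t)%R -> measurable_fun setT (fun o => w t o 0%R i).
Proof.
move=> Pc s0 t i t0; have [hp _ hy _ sys] := CS.
pose g o := (sigma^-1 * (y t o 0 i - x 0 i - \int[mu]_(r in `[0, (0 + t)]) from0 p r o 0 i))%R.
have mg : measurable_fun setT g.
  apply: measurable_funM => //; apply: measurable_funB.
    by apply: measurable_funB => //; exact: measurable_at.
  have H := measurable_Rwindow t (mp i).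
  have := measurableT_comp H (pair1_measurable (0%R : measurableTypeR R)).
  by apply: eq_measurable_fun.
apply/measurable_EFinP; apply: (ae_measurable_fun Pc (f := EFin \o g)); last exact/measurable_EFinP.
move: sys; apply: filterS => o H _ /=; congr EFin.
rewrite /g; have [_ ->] := H t i t0.
have -> : (\int[mu]_(r in `[0, (0 + t)]) from0 p r o 0 i = \int[mu]_(s in `[0, t]) p s o 0 i)%R.
  rewrite add0r; apply: eq_Rintegral => r; rewrite inE/= in_itv/= => /andP[r0 _].
  by rewrite from0E.
by field; rewrite gt_eqF.
Qed.

Hypothesis mw : forall t i, (0 <= t)%R -> measurable_fun setT (fun o => w t o 0%R i).
Hypothesis FS : forall t, (0 <= t)%R -> sigma_algebra setT (F t).

Let W o : 'rV[R]_N := (w 1 o - w 0 o)%R.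

Lemma unit_increment_gaussian : gaussian_vec P W.
Proof.
split=> [i|B mB].
  by under eq_fun do rewrite !mxE; apply: measurable_funB; exact: mw.
have [_ _ _ H] := BM.
have F0 : F 0%R setT.
  have [f0 fC _] := FS (lexx (0 : R)%R).
  by have := fC _ f0; rewrite setD0.
have := H 0%R 1%R setT B (lexx _) ltr01 F0 mB.
rewrite setTI subr0 sqrtr1 => h.
have -> : [set o | forall i, B i (W o 0%R i)] = [set o | forall i, B i (w 1 o 0 i - w 0 o 0 i)%R].
  by apply/seteqP; split => o /= Ho i; have := Ho i; rewrite !mxE.
rewrite h; rewrite [X in X * _](_ : _ = 1) ?mul1e//; exact: probability_setT.
Qed.

(** Adaptedness is given coordinate by coordinate, while independence is used for events of the
    whole state vector. Boxes are finite intersections of coordinate events, and they generate. *)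
Lemma adapted_tuple t (A : set (N.-tuple R)) : (0 <= t)%R -> measurable A ->
  F t [set o | A (tup (y t o))].
Proof.
move=> t0; have [_ _ _ ay _] := CS; have sF := FS t0.
suff H : (measurable : set (set (N.-tuple R))) `<=`
    image_set_system setT (fun o => tup (y t o)) (F t).
  by move=> /H; rewrite /image_set_system/= setTI.
rewrite measurable_tuple_boxes; apply: smallest_sub.
  exact: sigma_algebra_image.
move=> _ [B mB ->]; rewrite /image_set_system /= setTI.
have -> : (fun o => tup (y t o)) @^-1` tuple_box B = \bigcap_(i in [set: 'I_N]) [set o | B i (y t o 0%R i)].
  apply/seteqP; split => [q /= Ho i _|q /= Ho i]; first by have := Ho i; rewrite tnth_mktuple.
  by rewrite tnth_mktuple; exact: (Ho i I).
have -> : \bigcap_(i in [set: 'I_N]) [set o | B i (y t o 0%R i)] =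
    ~` \bigcup_(i in [set: 'I_N]) ~` [set o | B i (y t o 0%R i)].
  by rewrite setC_bigcup; apply: eq_bigcapr => i _; rewrite setCK.
have [f0 fC fU] := sF.
have fC' A' : F t A' -> F t (~` A') by move=> /fC; rewrite setTD.
apply: (fC').
(* The finite union is padded with empty sets to a sequence, since a sigma-algebra is closed under
   countable unions. *)
pose A' (n : nat) := if insub n is Some i then ~` [set o | B (i : 'I_N) (y t o 0%R i)] else set0.
have -> : \bigcup_(i in [set: 'I_N]) ~` [set o | B i (y t o 0%R i)] = \bigcup_n A' n.
  apply/seteqP; split => [q [i _ Hi]|q [n _]].
    by exists (val i) => //; rewrite /A' valK.
  by rewrite /A'; case: insubP => // i _ _ Hi; exists i.
apply: fU => n; rewrite /A'; case: insubP => // i _ _.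
by apply: fC'; exact: ay.
Qed.

(** Over a step of length [s ^+ 2] the prescribed standard deviation is the square root of that
    length, namely [s]. *)
Lemma increment_independent t s : (0 <= t)%R -> (0 < s)%R ->
  forall f : 'rV[R]_N -> 'rV[R]_N -> \bar R,
  measurable_fun setT (fun q : N.-tuple R * N.-tuple R => f (row_tup q.1) (row_tup q.2)) ->
  (forall u v, 0 <= f u v) ->
  \int[P]_o f (from0 y t o) (w (t + s ^+ 2)%R o - w t o)%R =
  \int[P]_o \int[P]_o' f (from0 y t o) (s *: W o').
Proof.
move=> t0 s0 f mf f0; rewrite from0E//.
have h0 : (0 < s ^+ 2)%R by rewrite exprn_gt0.
have [_ _ hy _ _] := CS.
apply: (@integral_indep _ _ _ _ P W (y t) (fun o => (w (t + s ^+ 2)%R o - w t o)%R)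
  unit_increment_gaussian _ _ s s0 _ f mf f0).
- by move=> i; exact: measurable_at.
- move=> i; under eq_fun do rewrite !mxE.
  by apply: measurable_funB; apply: mw => //; rewrite addr_ge0// ltW.
move=> A B mA mB; have [_ _ _ H] := BM.
have := H t (t + s ^+ 2)%R [set o | A (tup (y t o))] B t0 _ (adapted_tuple t0 mA) mB.
rewrite ltrDl => /(_ h0).
have -> : (Num.sqrt (t + s ^+ 2 - t) = s)%R by rewrite addrAC subrr add0r sqrtr_sqr gtr0_norm.
move=> <-; congr (P (_ `&` _)).
by apply/seteqP; split => o /= Ho i; have := Ho i; rewrite !mxE.
Qed.

Lemma noise_second_moment t : (0 <= t)%R ->
  \int[P]_o (nsq (w t o - w 0 o))%:E = (t * N%:R)%:E.
Proof.
rewrite le_eqVlt => /predU1P[<-|t0].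
  rewrite mul0r; apply: integral0_eq => o _.
  by rewrite subrr /nsq big1// => i _; rewrite mxE expr0n.
set s := Num.sqrt t; have s0 : (0 < s)%R by rewrite sqrtr_gt0.
have st : (s ^+ 2 = t)%R by rewrite sqr_sqrtr// ltW.
have := @increment_independent 0%R s (lexx _) s0 (fun u v => (nsq v)%:E).
rewrite add0r st => ->.
- have mW i : measurable_fun setT (fun o => W o 0%R i) by have [] := unit_increment_gaussian.
  rewrite integral_cst//= [X in _ * X](_ : _ = 1); last exact: probability_setT.
  rewrite mule1; transitivity (\int[P]_o (t%:E * (nsq (W o))%:E)).
    by apply: eq_integral => o _; rewrite nsqZ st EFinM.
  rewrite ge0_integralZl//.
  + by rewrite (gaussian_nsq unit_increment_gaussian) -EFinM.
  + by apply/measurable_EFinP; apply: measurable_fun_row; [exact: continuous_nsq|exact: mW].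
  + by move=> o _; rewrite lee_fin nsq_ge0.
  + by rewrite lee_fin ltW.
- apply/measurable_EFinP; apply: measurable_fun_row; first exact: continuous_nsq.
  by move=> i; under eq_fun do rewrite !mxE; exact: (measurableT_comp (measurable_tnth i)).
- by move=> u v; rewrite lee_fin nsq_ge0.
Qed.

Lemma state_increment t h : (0 <= t)%R -> (0 < h)%R ->
  {ae P, forall o, forall i,
    mu.-integrable `[t, (t + h)%R] (fun r => (from0 p r o 0%R i)%:E) /\
    (from0 y (t + h) o 0 i = from0 y t o 0 i + \int[mu]_(r in `[t, (t + h)%R]) from0 p r o 0 i
      + sigma * (w (t + h) o 0 i - w t o 0 i))%R}.
Proof.
move=> t0 h0; have [_ _ _ _ sys] := CS; move: sys; apply: filterS => o H i.
have th0 : (0 <= t + h)%R by rewrite addr_ge0// ltW.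
have [i1 e1] := H t i t0; have [i2 e2] := H (t + h)%R i th0.
have sub : `[t, (t + h)%R] `<=` `[0%R, (t + h)%R].
  by move=> r /=; rewrite !in_itv/= => /andP[tr ->]; rewrite (le_trans t0).
have pE r : r \in (`[t, (t + h)%R]%classic : set R) -> from0 p r o 0%R i = p r o 0%R i.
  by rewrite inE/= in_itv/= => /andP[tr _]; rewrite from0E// (le_trans t0).
have i3 : mu.-integrable `[t, (t + h)%R] (fun r => (p r o 0%R i)%:E).
  by apply: integrableS i2 => //; exact: measurable_itv.
split.
  by apply: eq_integrable i3 => [|r rt]; [exact: measurable_itv|rewrite pE].
rewrite !from0E// e1 e2.
have -> : (\int[mu]_(r in `[t, (t + h)]) from0 p r o 0 i = \int[mu]_(r in `[t, (t + h)]) p r o 0 i)%R.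
  by apply: eq_Rintegral => r rt; rewrite pE.
(* The difference lives on the half-open window; its left end point is negligible. *)
have B : (\int[mu]_(s in `[0, (t + h)]) p s o 0 i - \int[mu]_(s in `[0, t]) p s o 0 i =
   \int[mu]_(s in `[t, (t + h)]) p s o 0 i)%R.
  rewrite (Rintegral_itvB i2) ?bnd_simp//; last by rewrite lerDl ltW.
  apply: Rintegral_itv_obnd_cbnd; apply: integrableS i3; [exact: measurable_itv|exact: measurable_itv|].
  by move=> r /=; rewrite !in_itv/= => /andP[/ltW -> ->].
by rewrite -B; ring.
Qed.

Lemma initial_state : {ae P, forall o, from0 y 0 o = x}.
Proof.
have [_ _ _ _ sys] := CS; have [_ w0 _ _] := BM.
move: sys w0; apply: filterS2 => o H w0; apply/rowP => i.
have [_] := H 0%R i (lexx _); rewrite from0E// => ->.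
by rewrite w0 mxE set_itv1 Rintegral_set1 mulr0 !addr0.
Qed.

Variable rho : probability (measurableTypeR R) R.
Hypothesis rhoE : forall f : R -> \bar R, measurable_fun setT f -> (forall t, 0 <= f t) ->
  \int[rho]_t f t = \int[mu]_t (f t * (exp_ker alpha t)%:E).

(** The density of [rho] on positive times is alpha exp(-alpha t), which explains the factor
    [alpha]; Tonelli accounts for [cost] integrating over time first. *)
Lemma cost_discounted :
  alpha%:E * cost P alpha p y =
  \int[discounted_measure rho P]_q (nsq (state_at (from0 y) q))%:E + \int[discounted_measure rho P]_q (nsq (from0 p q.1 q.2))%:E.
Proof.
pose f q := (nsq (state_at (from0 y) q))%:E + (nsq (from0 p q.1 q.2))%:E.
have m1 : measurable_fun setT (fun q => (nsq (state_at (from0 y) q))%:E).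
  by apply/measurable_EFinP; apply: measurable_fun_row; [exact: continuous_nsq|exact: mY].
have m2 : measurable_fun setT (fun q : measurableTypeR R * T => (nsq (from0 p q.1 q.2))%:E).
  by apply/measurable_EFinP; apply: measurable_fun_row; [exact: continuous_nsq|exact: mp].
have mf : measurable_fun setT f by exact: emeasurable_funD.
have f0 q : 0 <= f q by rewrite adde_ge0// lee_fin nsq_ge0.
rewrite -ge0_integralD//; last 2 first.
- by move=> q _; rewrite lee_fin nsq_ge0.
- by move=> q _; rewrite lee_fin nsq_ge0.
rewrite -(iterated_discounted rho P mf f0).
have mft : measurable_fun setT (fun t : R => \int[P]_o f (t, o)) by exact: measurable_mean.
have ft0 t : 0 <= \int[P]_o f (t, o) by apply: integral_ge0 => o _; exact: f0.
rewrite (rhoE mft ft0).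
have mk : measurable_fun setT (fun q : measurableTypeR R * T => (exp_ker alpha q.1)%:E).
  by apply/measurable_EFinP; exact: (measurableT_comp (measurable_exp_ker alpha)).
have k0 (t : R) : 0 <= (exp_ker alpha t)%:E by rewrite lee_fin exp_ker_ge0.
pose G (q : measurableTypeR R * T) := f q * (exp_ker alpha q.1)%:E.
have mG : measurable_fun setT G by exact: emeasurable_funM.
have G0 q : 0 <= G q by rewrite mule_ge0.
transitivity (\int[mu]_t \int[P]_o G (t, o)); last first.
  apply: eq_integral => t _.
  rewrite (eq_integral (fun o => f (t, o) * (exp_ker alpha t)%:E))//.
  by rewrite ge0_integralZr//; exact: (measurableT_comp mf (pair1_measurable t)).
rewrite (fubini_tonelli (m1 := mu) (m2 := P) G)// /cost.
have mGo o : measurable_fun setT (fun t : R => G (t, o)).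
  exact: (measurableT_comp mG (pair2_measurable o)).
have a0 : 0 <= (alpha^-1)%:E by rewrite lee_fin invr_ge0 ltW.
have GE o (t : R) : t \in (`]0%R, +oo[%classic : set R) ->
    (alpha^-1)%:E * G (t, o) = ((enorm (p t o) ^+ 2 + enorm (y t o) ^+ 2) * expR (- alpha * t))%:E.
  rewrite inE/= in_itv/= andbT => t0; rewrite /G /f /state_at/= /exp_ker t0 !enorm_sqr !from0E ?(ltW t0)//.
  by rewrite -EFinD -!EFinM; congr EFin; field; rewrite gt_eqF.
transitivity (alpha%:E * \int[P]_o ((alpha^-1)%:E * \int[mu]_t G (t, o))).
  congr (_ * _); apply: eq_integral => o _; rewrite -ge0_integralZl//; last exact: mGo.
  have mL : measurable_fun (`]0%R, +oo[%classic : set R) (fun t : R => ((enorm (p t o) ^+ 2 + enorm (y t o) ^+ 2) * expR (- alpha * t))%:E).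
    apply: (eq_measurable_fun (fun t : R => (alpha^-1)%:E * G (t, o))); first exact: GE.
    by apply: measurable_funTS; exact: emeasurable_funM.
  rewrite -(integral_itv_obnd_cbnd mL) [LHS]integral_mkcond; apply: eq_integral => t _.
  rewrite patchE; case: ifPn => [/GE <-//|].
  rewrite notin_setE/= in_itv/= andbT => /negP/negbTE t0.
  by rewrite /G /exp_ker t0 !mule0.
rewrite (@ge0_integralZl _ _ _ P _ measurableT (fun o => \int[mu]_t G (t, o)))//; last 2 first.
- exact: (measurable_fun_fubini_tonelli_G (m1 := mu) G).
- by move=> o _; apply: integral_ge0.
by rewrite muleA -EFinM divff ?gt_eqF// mul1e.
Qed.

End driven_system.

(** * The feedback system *)

Section paths.
Context {R : realType}.
Notation mu := (@lebesgue_measure R).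

Lemma continuous_max0 : continuous (fun t : R => Num.max 0 t).
Proof. by move=> t; apply: continuous_max => //; exact: cvg_cst. Qed.

Lemma cvg_max0_within (A : set R) (t : R) :
  (\forall s \near t, A (Num.max 0 s)) ->
  Num.max 0 s @[s --> t] --> within A (nbhs (Num.max 0 t)).
Proof.
move=> At B nB; have H := @continuous_max0 t _ nB.
by apply: filterS2 At H => s As; apply.
Qed.

Lemma continuous_from0 (V : topologicalType) (f : R -> V) :
  {within `[0, +oo[, continuous f} -> continuous (fun t : R => f (Num.max 0 t)).
Proof.
move=> /subspace_continuousP cf t.
apply: (@cvg_comp R R V (fun s : R => Num.max 0 s) f (nbhs t)
  (within `[0, +oo[%classic (nbhs (Num.max 0 t))) (nbhs (f (Num.max 0 t)))).
  by apply: cvg_max0_within; apply: filterE => s; rewrite /= in_itv/= andbT le_max lexx.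
by apply: cf; rewrite /= in_itv/= andbT le_max lexx.
Qed.

Lemma continuous_integral_from0 (f : R -> R) :
  (forall t, 0 <= t -> mu.-integrable `[0, t] (EFin \o f)) ->
  continuous (fun t : R => \int[mu]_(r in `[0, Num.max 0 t]) f r).
Proof.
move=> fi t; pose b := Num.max 0 t + 1.
have m0 : 0 <= Num.max 0 t by rewrite le_max lexx.
have b0 : 0 <= b by rewrite addr_ge0.
have /subspace_continuousP H := parameterized_integral_continuous b0 (fi b b0).
apply: (@cvg_comp R R R (fun s : R => Num.max 0 s) (fun s => \int[mu]_(r in `[0, s]) f r) (nbhs t)
  (within `[0, b]%classic (nbhs (Num.max 0 t))) (nbhs (\int[mu]_(r in `[0, Num.max 0 t]) f r))); last first.
  by apply: H; rewrite /= in_itv/= m0/= /b lerDl.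
apply: cvg_max0_within; near=> s.
rewrite /= in_itv/= le_max lexx/= ge_max b0/=.
have st : s < t + 1 by near: s; apply: lt_nbhsl; rewrite ltrDl.
by rewrite (le_trans (ltW st))// lerD2r le_max lexx orbT.
Unshelve. all: by end_near. Qed.

Lemma continuous_integrable_itv (f : R -> R) a b : continuous f ->
  mu.-integrable `[a, b] (EFin \o f).
Proof.
move=> cf; apply: continuous_compact_integrable; first exact: segment_compact.
exact: continuous_subspaceT.
Qed.

Lemma cvg_integral_average (g : R -> R) (t : R) (s : nat -> R) : continuous g ->
  (forall n, 0 < s n) -> s n @[n --> \oo] --> 0 ->
  (\int[mu]_(r in `[t, t + s n]) g r) / s n @[n --> \oo] --> g t.
Proof.
move=> cg s0 sc; apply/cvgrPdist_le => e e0.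
have /cvgrPdist_le /(_ e e0) [dl /= dl0 H] := cg t.
near=> n.
have sd : s n < dl.
  by near: n; move: sc => /cvgrPdist_lt /(_ dl dl0); apply: filterS => n; rewrite sub0r normrN gtr0_norm.
have H' r : r \in (`[t, t + s n]%classic : set R) -> g t - e <= g r <= g t + e.
  rewrite inE/= in_itv/= => /andP[tr rt]; have := H r.
  have tb : ball_ Num.norm t dl r.
    by rewrite /ball_/= distrC ger0_norm ?subr_ge0// ltrBlDl (le_lt_trans rt)// ltrD2l.
  by move=> /(_ tb); rewrite ler_norml => /andP[h1 h2]; apply/andP; split; lra.
have ci (c : R) : mu.-integrable `[t, t + s n] (EFin \o cst c) by apply: continuous_integrable_itv => x; exact: cvg_cst.
have gi : mu.-integrable `[t, t + s n] (EFin \o g) by exact: continuous_integrable_itv.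
have cE (c : R) : \int[mu]_(r in `[t, t + s n]) cst c r = c * s n.
  rewrite Rintegral_cst//=.
  by rewrite [X in fine X](_ : _ = (s n)%:E)//; apply: lebesgue_window; exact: ltW.
have L : (g t - e) * s n <= \int[mu]_(r in `[t, t + s n]) g r.
  rewrite -cE; apply: le_Rintegral => //.
  by move=> r rt; have /andP[] := H' r (mem_set rt).
have U : \int[mu]_(r in `[t, t + s n]) g r <= (g t + e) * s n.
  rewrite -cE; apply: le_Rintegral => //.
  by move=> r rt; have /andP[] := H' r (mem_set rt).
have U' : (\int[mu]_(r in `[t, t + s n]) g r) / s n <= g t + e by rewrite ler_pdivrMr.
have L' : g t - e <= (\int[mu]_(r in `[t, t + s n]) g r) / s n by rewrite ler_pdivlMr.
by rewrite ler_distlC L' U'.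
Unshelve. all: by end_near. Qed.

Lemma is_derive_integral (f : R -> R) (t : R) : continuous f -> 0 < t ->
  is_derive t 1 (fun x : R => \int[mu]_(r in `[0, x]) f r) (f t).
Proof.
move=> cf t0.
have [|dF e] := @continuous_FTC1_closed _ f 0 t (t + 1) _ (continuous_integrable_itv 0 (t + 1) cf) t0 (cf t).
  by rewrite ltrDl.
by apply: DeriveDef; [exact: dF|rewrite -derive1E e].
Qed.

Lemma continuous_primitive (f : R -> R) b : continuous f -> 0 <= b ->
  {within `[0, b], continuous (fun x => \int[mu]_(r in `[0, x]) f r)}.
Proof.
by move=> cf b0; apply: parameterized_integral_continuous => //; exact: continuous_integrable_itv.
Qed.

End paths.

Section path_energy.
Context {R : realType} {N : nat}.
Notation mu := (@lebesgue_measure R).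
Variables (z : 'rV[R]_N -> R) (x : 'rV[R]_N) (sigma : R).
Hypothesis cz : continuous z.
Hypothesis cg : forall i, continuous (partial i z).
Hypothesis z0 : forall v, 0 <= z v.
Hypothesis subg : forall a b : 'rV[R]_N, z a + \sum_i partial i z a * (b 0 i - a 0 i) <= z b.
Variables Y W : R -> 'rV[R]_N.
Hypothesis cY : continuous Y.
Hypothesis cW : continuous W.
Hypothesis YE : forall t i, 0 <= t ->
  Y t 0 i = x 0 i + \int[mu]_(r in `[0, t]) (- 2^-1 * partial i z (Y r)) + sigma * W t 0 i.

Let f i r := - 2^-1 * partial i z (Y r).
Let cf i : continuous (f i).
Proof.
move=> r; apply: cvgMl_tmp; apply: (@cvg_comp _ _ _ Y (partial i z)); [exact: cY|exact: cg].
Qed.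
Let zeta r := z (sigma *: W r).
Let czeta : continuous zeta.
Proof.
move=> r; apply: (@cvg_comp _ _ _ (fun r => sigma *: W r) z); last exact: cz.
by apply: cvgZl_tmp; exact: cW.
Qed.

(* d/dt |Y - sigma W|^2 = - grad z(Y) . (Y - sigma W) <= z (sigma W) - z Y by convexity. *)
Lemma path_energy b : 0 <= b ->
  nsq (Y b - sigma *: W b) <= nsq x + \int[mu]_(r in `[0, b]) z (sigma *: W r).
Proof.
move=> b0.
(* [m] is Y - sigma W written as a primitive: with the noise removed the path is differentiable and
   ordinary calculus applies. *)
pose m i : R -> R := cst (x 0 i) + (fun t => \int[mu]_(r in `[0, t]) f i r).
pose J t := \int[mu]_(r in `[0, t]) zeta r.
pose psi : R -> R := (\sum_(i < N) m i ^+ 2) - J.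
have mE t i : 0 <= t -> m i t = Y t 0 i - sigma * W t 0 i.
  by move=> t0; rewrite (YE i t0) /m fctE/=; ring.
have psiE t : psi t = \sum_i m i t ^+ 2 - J t.
  transitivity ((\sum_(i < N) m i ^+ 2) t - J t); first by [].
  by congr (_ - _); rewrite fct_sumE; apply: eq_bigr => i _; rewrite exprfctE.
have dpsi (t : R) : 0 < t -> is_derive t 1 psi (\sum_i (2%:R * m i t ^+ 1) *: f i t - zeta t).
  move=> t0; apply: is_deriveB; last exact: is_derive_integral.
  apply: is_derive_sum => i; apply: is_deriveX.
  by rewrite -[f i t]add0r; apply: is_deriveD; exact: is_derive_integral.
have cpsi : {within `[0, b], continuous psi}.
  have -> : psi = (fun t => \sum_i m i t ^+ 2 - J t) by apply/funext.
  have /subspace_continuousP cJ := @continuous_primitive _ zeta b czeta b0.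
  apply/subspace_continuousP => t tb; apply: cvgB; last exact: cJ.
  apply: cvg_sumr => i _.
  apply: (@cvg_comp _ _ _ (m i) (fun u => u ^+ 2)); last exact: sqr_continuous.
  have /subspace_continuousP cm := @continuous_primitive _ (f i) b (@cf i) b0.
  by apply: cvgD; [exact: cvg_cst|exact: cm].
have := @ler0_derive1_nincr _ psi 0 b _ _ cpsi 0 b (lexx _) b0 (lexx _).
rewrite !psiE /J set_itv1 Rintegral_set1 subr0 => H.
have -> : nsq (Y b - sigma *: W b) = \sum_i m i b ^+ 2.
  by apply: eq_bigr => i _; rewrite mE// !mxE.
have -> : nsq x = \sum_i m i 0 ^+ 2.
  by apply: eq_bigr => i _; rewrite /m fctE/= set_itv1 Rintegral_set1 addr0.
rewrite -lerBlDr; apply: H => t; rewrite in_itv/= => /andP[t0 _].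
  by have [] := dpsi t t0.
rewrite derive1E (@derive_val _ _ _ _ _ _ _ (dpsi t t0)).
have := subg (Y t) (sigma *: W t); have := z0 (Y t); rewrite /zeta => h1 h2.
suff -> : \sum_i (2%:R * m i t ^+ 1) *: f i t =
    \sum_i partial i z (Y t) * ((sigma *: W t) 0 i - Y t 0 i) by lra.
apply: eq_bigr => i _; transitivity (2 * m i t * f i t); first by rewrite expr1.
by rewrite mE ?(ltW t0)// /f !mxE; field.
Qed.

End path_energy.

(** * Path regularity and moments under the feedback control *)

Section feedback_system.
Local Open Scope ereal_scope.
Context {R : realType} {N : nat} {d : measure_display} {T : measurableType d}.
Notation mu := (@lebesgue_measure R).
Variables (alpha sigma : R) (x : 'rV[R]_N).
Hypothesis alpha0 : (0 < alpha)%R.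
Variable z : 'rV[R]_N -> R.
Hypothesis cz : continuous z.
Hypothesis cg : forall i, continuous (partial i z).
Hypothesis z0 : forall v, (0 <= z v)%R.
Hypothesis subg : forall a b : 'rV[R]_N, (z a + \sum_i partial i z a * (b 0 i - a 0 i) <= z b)%R.
Variable K0 : R.
Hypothesis zK : forall v, (z v <= nsq v + K0)%R.
Variable P : probability T R.
Variable F : R -> set (set T).
Variables w y : R -> T -> 'rV[R]_N.
Hypothesis BM : brownian_motion P F w.
Hypothesis CS : controlled_system P F w sigma x (feedback z y) y.
Hypothesis mw : forall t i, (0 <= t)%R -> measurable_fun setT (fun o => w t o 0%R i).
Hypothesis FS : forall t, (0 <= t)%R -> sigma_algebra setT (F t).

Lemma feedbackE t o i : feedback z y t o 0%R i = (- 2^-1 * partial i z (y t o))%R.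
Proof. by rewrite /feedback !mxE. Qed.

(** The state equation supplies continuity: a primitive of an integrable drift plus continuous
    noise. *)
Lemma continuous_paths : {ae P, forall o,
  continuous (fun t : R => from0 y t o) /\ continuous (fun t : R => from0 w t o)}.
Proof.
have [_ _ _ _ sys] := CS; have [_ _ wc _] := BM.
move: sys wc; apply: filterS2 => o H wc.
have cw : continuous (fun t : R => from0 w t o) by exact: (continuous_from0 wc).
split=> // t; apply: cvg_row => i.
have pi (s : R) : (0 <= s)%R -> mu.-integrable `[0%R, s] (EFin \o (fun r => feedback z y r o 0%R i)).
  by move=> s0; have [] := H s i s0.
have E : (fun s : R => from0 y s o 0%R i) = (fun s : R => x 0 i +
    \int[mu]_(r in `[0, Num.max 0 s]) feedback z y r o 0 i + sigma * from0 w s o 0 i)%R.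
  apply/funext => s; have m0 : (0 <= Num.max 0 s)%R by rewrite le_max lexx.
  by have [_ ->] := H _ i m0.
rewrite (_ : from0 y t o 0%R i = (x 0 i +
    \int[mu]_(r in `[0, Num.max 0 t]) feedback z y r o 0 i + sigma * from0 w t o 0 i)%R); last exact: (congr1 (fun f => f t) E).
rewrite [X in X @ _ --> _]E.
apply: cvgD; first (apply: cvgD; [exact: cvg_cst|exact: (continuous_integral_from0 pi)]).
apply: cvgMl_tmp; apply: (@cvg_comp _ _ _ (fun s : R => from0 w s o) (fun v => v 0%R i)); [exact: cw|].
exact: coord_continuous.
Qed.

Lemma gradient_average_cvg t : {ae P, forall o, forall i,
  grad_avg z (from0 y) t (harmonic n ^+ 2)%R o i @[n --> \oo] --> (2 * partial i z (from0 y t o))%R}.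
Proof.
move: continuous_paths; apply: filterS => o [cy _] i.
pose g (r : R) := partial i z (from0 y r o).
have cgy : continuous g.
  by move=> r; apply: (@cvg_comp _ _ _ (fun r : R => from0 y r o) (partial i z)); [exact: cy|exact: cg].
have sc : ((harmonic n : R) ^+ 2)%R @[n --> \oo] --> (0 : R)%R.
  rewrite -[X in _ --> X](mulr0 0%R); under eq_fun do rewrite expr2.
  by apply: cvgM; exact: cvg_harmonic.
have -> : (2 * partial i z (from0 y t o) = g t + g t)%R by rewrite /g; ring.
apply: cvgD; last first.
  by apply: cvg_integral_average => // n; rewrite exprn_gt0// harmonic_gt0.
have tc : (t + harmonic n ^+ 2)%R @[n --> \oo] --> t.
  by rewrite -[X in _ --> X](addr0 t); apply: cvgD; [exact: cvg_cst|exact: sc].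
by apply: (@cvg_comp _ _ _ (fun n => t + harmonic n ^+ 2)%R g); [exact: tc|exact: cgy].
Qed.

(** A jointly measurable stand-in for [sigma *: w], solved from the state equation: [w] is only
    adapted with almost surely continuous paths, and Tonelli in [mean_energy] needs joint
    measurability. *)
Let V (q : measurableTypeR R * T) : 'rV[R]_N := (\row_i (from0 y q.1 q.2 0 i - x 0 i -
  \int[mu]_(r in `[0, q.1]) from0 (feedback z y) r q.2 0 i))%R.

Let mV i : measurable_fun setT (fun q => V q 0%R i).
Proof.
have [hp _ hy _ _] := CS.
under eq_fun do rewrite mxE; apply: measurable_funB.
  by apply: measurable_funB => //; exact: (measurable_from0 hy).
exact: (measurable_Rinitial (measurable_from0 hp i)).
Qed.

Let VE : {ae P, forall o, forall r : R, (0 <= r)%R -> V (r, o) = (sigma *: w r o)%R}.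
Proof.
have [_ _ _ _ sys] := CS; move: sys; apply: filterS => o H r r0.
apply/rowP => i; rewrite !mxE/= from0E//; have [_ ->] := H r i r0.
have -> : (\int[mu]_(s in `[0, r]) from0 (feedback z y) s o 0 i = \int[mu]_(s in `[0, r]) feedback z y s o 0 i)%R.
  by apply: eq_Rintegral => s; rewrite inE/= in_itv/= => /andP[s0 _]; rewrite from0E.
by ring.
Qed.

Let mzV : measurable_fun setT (fun q => (z (V q))%:E).
Proof. by apply/measurable_EFinP; exact: measurable_fun_row. Qed.

Let zV0 q : 0 <= (z (V q))%:E. Proof. by rewrite lee_fin. Qed.

Lemma energy_bound b : (0 <= b)%R -> {ae P, forall o,
  (nsq (y b o))%:E <= (2 * nsq x)%:E + (2%:E * \int[mu]_(r in `[0%R, (0 + b)%R]) (z (V (r, o)))%:E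
    + (2 * sigma ^+ 2)%:E * (nsq (w b o - w 0 o))%:E)}.
Proof.
move=> b0; have [_ _ _ _ sys] := CS; have [_ w0 _ _] := BM.
have VC : {ae P, forall o, (forall r : R, (0 <= r)%R -> V (r, o) = (sigma *: w r o)%R) /\
    (continuous (fun t : R => from0 y t o) /\ continuous (fun t : R => from0 w t o))}.
  by move: VE continuous_paths; apply: filterS2 => o; split.
move: sys w0 VC; apply: filterS3 => o H w0o [Vo [cy cw]].
have YE t i : (0 <= t)%R -> (from0 y t o 0 i = x 0 i + \int[mu]_(r in `[0, t])
    (- 2^-1 * partial i z (from0 y r o)) + sigma * from0 w t o 0 i)%R.
  move=> t0; rewrite !from0E//; have [_ ->] := H t i t0; congr (_ + _ + _)%R.
  by apply: eq_Rintegral => r; rewrite inE/= in_itv/= => /andP[r0 _]; rewrite from0E// feedbackE.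
have := @path_energy _ _ z x sigma cz cg z0 subg (fun t => from0 y t o) (fun t => from0 w t o) cy cw YE b b0.
rewrite !from0E// => E.
have zi : mu.-integrable `[0%R, b] (EFin \o (fun r : R => z (sigma *: from0 w r o))).
  apply: continuous_integrable_itv => r; apply: (@cvg_comp _ _ _ (fun r : R => sigma *: from0 w r o)%R z); last exact: cz.
  by apply: cvgZl_tmp; exact: cw.
have -> : \int[mu]_(r in `[0%R, (0 + b)%R]) (z (V (r, o)))%:E =
    (\int[mu]_(r in `[0, b]) z (sigma *: from0 w r o))%R%:E.
  rewrite add0r /Rintegral fineK; last exact: integrable_fin_num.
  apply: eq_integral => r; rewrite inE/= in_itv/= => /andP[r0 _].
  by rewrite Vo// from0E.
rewrite -!EFinM -!EFinD lee_fin w0o subr0.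
have := nsqD (y b o - sigma *: w b o) (sigma *: w b o); rewrite subrK nsqZ.
by move: E; move: (nsq (_ - _)) (Rintegral _ _ _) => A B; lra.
Qed.

(** Quadratic growth bounds E z(sigma w(r)) by sigma^2 r N + K0; integrating over [0, b] with r <= b
    gives a bound quadratic in [b]. *)
Lemma mean_energy b : (0 <= b)%R ->
  \int[P]_o (nsq (y b o))%:E <=
  (2 * nsq x + 2 * (b * (sigma ^+ 2 * (b * N%:R) + K0)) + 2 * sigma ^+ 2 * (b * N%:R))%:E.
Proof.
move=> b0; have [_ _ hy _ _] := CS.
have mn t : (0 <= t)%R -> measurable_fun setT (fun o => (nsq (w t o - w 0 o))%:E).
  move=> t0; apply/measurable_EFinP; apply: measurable_fun_row => [|i]; first exact: continuous_nsq.
  by under eq_fun do rewrite !mxE; apply: measurable_funB; exact: mw.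
have n0 (v : 'rV[R]_N) : 0 <= (nsq v)%:E by rewrite lee_fin nsq_ge0.
have mI : measurable_fun setT (fun o => \int[mu]_(r in `[0%R, (0 + b)%R]) (z (V (r, o)))%:E).
  have h := @measurable_window _ _ _ _ b mzV zV0.
  exact: (measurableT_comp h (pair1_measurable (0%R : measurableTypeR R))).
have I0 o : 0 <= \int[mu]_(r in `[0%R, (0 + b)%R]) (z (V (r, o)))%:E.
  by apply: integral_ge0 => r _; exact: zV0.
have s0 : 0 <= (2 * sigma ^+ 2)%:E by rewrite lee_fin mulr_ge0// sqr_ge0.
have m2 : measurable_fun setT (fun o => 2%:E * \int[mu]_(r in `[0%R, (0 + b)%R]) (z (V (r, o)))%:E).
  exact: emeasurable_funM.
have m3 : measurable_fun setT (fun o => (2 * sigma ^+ 2)%:E * (nsq (w b o - w 0 o))%:E).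
  by apply: emeasurable_funM => //; exact: mn.
have m4 := emeasurable_funD m2 m3.
have p2 o : 0 <= 2%:E * \int[mu]_(r in `[0%R, (0 + b)%R]) (z (V (r, o)))%:E by exact: mule_ge0.
have p3 o : 0 <= (2 * sigma ^+ 2)%:E * (nsq (w b o - w 0 o))%:E by exact: mule_ge0.
have p4 o := adde_ge0 (p2 o) (p3 o).
have p1 : 0 <= (2 * nsq x)%:E by rewrite lee_fin mulr_ge0// nsq_ge0.
apply: (@le_trans _ _ (\int[P]_o ((2 * nsq x)%:E + (2%:E * \int[mu]_(r in `[0%R, (0 + b)%R]) (z (V (r, o)))%:E
    + (2 * sigma ^+ 2)%:E * (nsq (w b o - w 0 o))%:E)))).
  apply: ae_ge0_le_integral => //.
  - apply/measurable_EFinP; apply: measurable_fun_row => [|i]; first exact: continuous_nsq.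
    exact: measurable_at.
  - by move=> o _; exact: adde_ge0.
  - exact: emeasurable_funD.
  - by move: (energy_bound b0); apply: filterS => o H _.
rewrite (@ge0_integralD _ _ _ P _ measurableT (cst (2 * nsq x)%:E))//.
rewrite (@ge0_integralD _ _ _ P _ measurableT (fun o => 2%:E * \int[mu]_(r in `[0%R, (0 + b)%R]) (z (V (r, o)))%:E))//.
rewrite (@ge0_integralZl _ _ _ P _ measurableT (fun o => \int[mu]_(r in `[0%R, (0 + b)%R]) (z (V (r, o)))%:E))//.
rewrite (@ge0_integralZl _ _ _ P _ measurableT (fun o => (nsq (w b o - w 0 o))%:E))//; last exact: mn.
rewrite (noise_second_moment BM CS mw FS b0) (window_swap P mzV zV0).
rewrite integral_cst//= [X in _ * X + _](_ : _ = 1) ?mule1; last exact: probability_setT.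
have H : \int[mu]_(r in `[0%R, (0 + b)%R]) \int[P]_o (z (V (r, o)))%:E <= (b * (sigma ^+ 2 * (b * N%:R) + K0))%:E.
  have k0 : (0 <= K0)%R.
    by have := le_trans (z0 0%R) (zK 0%R); rewrite /nsq big1 ?add0r// => i _; rewrite mxE expr0n.
  have c0 : (0 <= sigma ^+ 2 * (b * N%:R) + K0)%R by rewrite addr_ge0// mulr_ge0 ?sqr_ge0// mulr_ge0.
  apply: (@le_trans _ _ (\int[mu]_(r in `[0%R, (0 + b)%R]) (sigma ^+ 2 * (b * N%:R) + K0)%:E)); last first.
    by rewrite integral_cst//= [X in _ * X](_ : _ = b%:E) -?EFinM 1?mulrC//; exact: lebesgue_window.
  apply: ge0_le_integral => //.
  - by move=> r _; apply: integral_ge0 => o _; exact: zV0.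
  - by apply: measurable_funTS; exact: (measurable_mean P mzV zV0).
  move=> r /=; rewrite in_itv/= add0r => /andP[r0 rb].
  have mnr := mn r r0.
  apply: (@le_trans _ _ (\int[P]_o ((sigma ^+ 2)%:E * (nsq (w r o - w 0 o))%:E + K0%:E))).
    apply: ae_ge0_le_integral => //.
    - exact: (measurableT_comp mzV (pair1_measurable (r : measurableTypeR R))).
    - by move=> o _; rewrite adde_ge0 ?lee_fin// mulr_ge0 ?sqr_ge0 ?nsq_ge0.
    - by apply: emeasurable_funD => //; exact: emeasurable_funM.
    have [_ w0 _ _] := BM; move: VE w0; apply: filterS2 => o Vo w0o _.
    by rewrite Vo// w0o subr0 -EFinM -EFinD lee_fin (le_trans (zK _))// nsqZ.
  rewrite ge0_integralD//; last 2 first.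
  - by move=> o _; rewrite mule_ge0// lee_fin sqr_ge0.
  - exact: emeasurable_funM.
  rewrite ge0_integralZl//; last by rewrite lee_fin sqr_ge0.
  rewrite (noise_second_moment BM CS mw FS r0).
  rewrite integral_cst//= [X in _ + _ * X](_ : _ = 1) ?mule1; last exact: probability_setT.
  rewrite -EFinM -EFinD lee_fin lerD2r ler_wpM2l ?sqr_ge0// ler_wpM2r//.
have {}H := lee_wpmul2l (lee0n 2 : 0 <= 2%:E) H.
apply: (le_trans (leeD2l _ (leeD2r _ H))); rewrite -!EFinM -!EFinD lee_fin.
by rewrite addrA.
Qed.

Let C : R := (2 * nsq x + (2 * K0 + 2 * sigma ^+ 2 * N%:R) * (2 / alpha) + 2 * sigma ^+ 2 * N%:R * (16 / alpha ^+ 2))%R.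

(** With E = exp(alpha b/2), the inequality (1 + alpha b/4)^2 <= E bounds 1, b and b^2 by multiples
    1, 2/alpha and 16/alpha^2 of E; these are the factors in [C]. Half the discount rate is left
    over for decay. *)
Lemma mean_energy_exp b : (0 <= b)%R ->
  \int[P]_o (nsq (y b o))%:E <= (C * expR (alpha / 2 * b))%:E.
Proof.
move=> b0; apply: (le_trans (mean_energy b0)); rewrite lee_fin.
have k0 : (0 <= K0)%R.
  by have := le_trans (z0 0%R) (zK 0%R); rewrite /nsq big1 ?add0r// => i _; rewrite mxE expr0n.
set E := expR _.
have E1 : (1 + alpha / 4 * b <= expR (alpha / 4 * b))%R by exact: expR_ge1Dx.
have EE : (E = expR (alpha / 4 * b) ^+ 2)%R by rewrite /E expr2 -expRD; congr expR; field.
have ab : (0 <= alpha / 4 * b)%R by rewrite !mulr_ge0// ltW.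
have E2 : (1 + alpha / 2 * b + alpha ^+ 2 / 16 * b ^+ 2 <= E)%R.
  rewrite EE; have -> : (1 + alpha / 2 * b + alpha ^+ 2 / 16 * b ^+ 2 = (1 + alpha / 4 * b) ^+ 2)%R by field.
  by rewrite lerXn2r// nnegrE ?expR_ge0// addr_ge0.
have a2 : (0 <= alpha ^+ 2 / 16 * b ^+ 2)%R by rewrite mulr_ge0 ?sqr_ge0// divr_ge0// sqr_ge0.
have e0 : (1 <= E)%R by move: ab a2 E2; lra.
have e1 : (b <= 2 / alpha * E)%R.
  have -> : (b = 2 / alpha * (alpha / 2 * b))%R by field; rewrite gt_eqF.
  by rewrite ler_wpM2l ?divr_ge0 ?(ltW alpha0)//; move: ab a2 E2; lra.
have e2 : (b ^+ 2 <= 16 / alpha ^+ 2 * E)%R.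
  have -> : (b ^+ 2 = 16 / alpha ^+ 2 * (alpha ^+ 2 / 16 * b ^+ 2))%R by field; rewrite gt_eqF.
  by rewrite ler_wpM2l ?divr_ge0 ?sqr_ge0//; move: ab a2 E2; lra.
have c1 : (0 <= 2 * nsq x)%R by rewrite mulr_ge0// nsq_ge0.
have c3 : (0 <= 2 * sigma ^+ 2 * N%:R)%R by rewrite mulr_ge0// mulr_ge0// sqr_ge0.
have c2 : (0 <= 2 * K0 + 2 * sigma ^+ 2 * N%:R)%R by rewrite addr_ge0// mulr_ge0.
have h1 := ler_wpM2l c1 e0; have h2 := ler_wpM2l c2 e1; have h3 := ler_wpM2l c3 e2.
rewrite /C; move: h1 h2 h3; lra.
Qed.

Lemma energy_discounted_lty (rho : probability (measurableTypeR R) R) :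
  (forall f : R -> \bar R, measurable_fun setT f -> (forall t, 0 <= f t) ->
    \int[rho]_t f t = \int[mu]_t (f t * (exp_ker alpha t)%:E)) ->
  \int[discounted_measure rho P]_q (nsq (state_at (from0 y) q))%:E < +oo.
Proof.
move=> rhoE; have [_ _ hy _ _] := CS.
have mY : measurable_fun setT (fun q : measurableTypeR R * T => (nsq (from0 y q.1 q.2))%:E).
  by apply/measurable_EFinP; apply: measurable_fun_row; [exact: continuous_nsq|exact: measurable_from0].
have n0 (q : measurableTypeR R * T) : 0 <= (nsq (from0 y q.1 q.2))%:E by rewrite lee_fin nsq_ge0.
rewrite -(iterated_discounted rho P mY n0) (rhoE _ (measurable_mean P mY n0)); last first.
  by move=> t; apply: integral_ge0 => o _; exact: (n0 (t, o)).
have a20 : (0 < alpha / 2)%R by rewrite divr_gt0.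
(* Against the density of rate alpha, a growth exp(alpha t/2) leaves twice the density of rate
   alpha/2, which has total mass 1. *)
have [rho' rhoE'] := exponential_law a20.
have C0 : (0 <= C)%R.
  have := mean_energy_exp (lexx 0%R); rewrite mulr0 expR0 mulr1 => h.
  by rewrite -lee_fin; apply: le_trans h; apply: integral_ge0 => o _; rewrite lee_fin nsq_ge0.
apply: (@le_lt_trans _ _ (\int[mu]_t ((2 * C)%:E * (exp_ker (alpha / 2) t)%:E))).
  apply: ge0_le_integral => //.
  - move=> t _; apply: mule_ge0; last by rewrite lee_fin exp_ker_ge0.
    by apply: integral_ge0 => o _; exact: (n0 (t, o)).
  - apply: emeasurable_funM; first exact: (measurable_mean P mY n0).
    by apply/measurable_EFinP; exact: measurable_exp_ker.
  - by apply: emeasurable_funM => //; apply/measurable_EFinP; exact: measurable_exp_ker.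
  move=> t _; rewrite /exp_ker; case: ifPn => [t0|_]; last by rewrite !mule0.
  have h := mean_energy_exp (ltW t0).
  have e0 : 0 <= (alpha * expR (- alpha * t))%:E by rewrite lee_fin mulr_ge0 ?expR_ge0// ltW.
  have := lee_wpmul2r e0 h; rewrite -!EFinM.
  have -> : (C * expR (alpha / 2 * t) * (alpha * expR (- alpha * t)) = 2 * C * (alpha / 2 * expR (- (alpha / 2) * t)))%R.
    have -> : (expR (- (alpha / 2) * t) = expR (alpha / 2 * t) * expR (- alpha * t))%R.
      by rewrite -expRD; congr expR; field.
    by field.
  by move=> /(le_trans _); apply; rewrite /= from0E// ltW.
have C20 : 0 <= (2 * C)%:E by rewrite lee_fin mulr_ge0.
rewrite -(rhoE' (fun=> (2 * C)%:E) (measurable_cst _) (fun=> C20)).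
by rewrite integral_cst//= [X in _ * X](_ : _ = 1) ?mule1 ?ltry//; exact: probability_setT.
Qed.

Lemma transversality :
  (fun t : R => \int[P]_o (expR (- alpha * t) * enorm (y t o) ^+ 2)%:E) @ +oo%R --> 0.
Proof.
have [_ _ hy _ _] := CS.
have U : ((C * expR (- (alpha / 2 * t)))%:E) @[t --> +oo%R] --> 0.
  apply: cvg_EFin; first exact: nearW.
  rewrite -(mulr0 C); apply: cvgMl_tmp.
  apply: (@cvg_comp _ _ _ (fun t : R => alpha / 2 * t)%R (fun u => expR (- u))%R _ +oo%R).
    by apply: gt0_cvgMry; [rewrite divr_gt0|exact: cvg_id].
  exact: cvgr_expR.
apply: (squeeze_cvge _ (cvg_cst 0) U).
near=> t; have t0 : (0 <= t)%R by near: t; exact: nbhs_pinfty_ge.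
apply/andP; split.
  by apply: integral_ge0 => o _; rewrite lee_fin mulr_ge0 ?expR_ge0// sqr_ge0.
under eq_integral do rewrite enorm_sqr EFinM.
rewrite ge0_integralZl//.
- have e0 : 0 <= (expR (- alpha * t))%:E by rewrite lee_fin expR_ge0.
  apply: (le_trans (lee_wpmul2l e0 (mean_energy_exp t0))).
  rewrite -EFinM lee_fin mulrCA -expRD le_eqVlt; apply/orP; left; apply/eqP.
  by congr (_ * expR _)%R; field.
- apply/measurable_EFinP; apply: measurable_fun_row => [|i]; first exact: continuous_nsq.
  exact: measurable_at.
- by move=> o _; rewrite lee_fin nsq_ge0.
Unshelve. all: by end_near. Qed.

End feedback_system.

(** * The number z(x) separates the costs on the two probability spaces *)

Section optimality.
Local Open Scope ereal_scope.
Context {R : realType} {N : nat}.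
Variables alpha sigma : R.
Hypotheses (alpha0 : (0 < alpha)%R) (sigma0 : (0 < sigma)%R) (N0 : (0 < N)%N).
Variable z : 'rV[R]_N -> R.
Hypothesis zC2 : is_C2 setT z.
Hypothesis zconstr : constructed_by_balls alpha sigma z.
Hypothesis zpos : forall x, (0 < z x)%R.
Hypothesis zconv : convex_function setT z.
Hypothesis zeq : forall x, hjb_equation alpha sigma z x.
Variable x : 'rV[R]_N.

Let cz := C2_continuous zC2.
Let cg := C2_partial_continuous zC2.
Let zge0 v : (0 <= z v)%R. Proof. exact: ltW. Qed.
Let subg := value_subgradient N0 zC2 zconv.
Let sd0 := second_diff_ge0 zconv.
Let zK := value_quadratic alpha0 sigma0 zconstr.
Let gK := gradient_quadratic alpha0 sigma0 N0 zC2 zconstr zpos zconv.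
Let HK := second_partial_quadratic alpha0 sigma0 N0 zC2 zconstr zpos zconv zeq.
Let hjb := hjb_sum zeq.
Let dz := C2_derivable zC2.
Let ddz := C2_partial_derivable zC2.
Let cH := C2_second_continuous zC2.

Lemma value_lower_bound (d : measure_display) (T : measurableType d) (P : probability T R)
    (w p y : R -> T -> 'rV[R]_N) : measure_is_complete P ->
  brownian_motion P (completed_natural_filtration P w) w ->
  controlled_system P (completed_natural_filtration P w) w sigma x p y ->
  cost P alpha p y < +oo -> (z x)%:E <= cost P alpha p y.
Proof.
move=> Pc BM CS cfin; have [rho rhoE] := exponential_law alpha0.
have FS t : (0 <= t)%R -> sigma_algebra setT (completed_natural_filtration P w t).
  by move=> _; exact: smallest_sigma_algebra.
have mw := noise_measurable_complete CS Pc sigma0.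
have [hp _ hy _ _] := CS.
have cE := cost_discounted alpha0 CS rhoE.
have S0 : 0 <= \int[discounted_measure rho P]_q (nsq (state_at (from0 y) q))%:E.
  by apply: integral_ge0 => q _; rewrite lee_fin nsq_ge0.
have P0 : 0 <= \int[discounted_measure rho P]_q (nsq (from0 p q.1 q.2))%:E.
  by apply: integral_ge0 => q _; rewrite lee_fin nsq_ge0.
have fin : \int[discounted_measure rho P]_q (nsq (state_at (from0 y) q))%:E + \int[discounted_measure rho P]_q (nsq (from0 p q.1 q.2))%:E < +oo.
  by rewrite -cE lte_mul_pinfty// lee_fin ltW.
have Sfin := le_lt_trans (leeDl _ P0) fin.
have Pfin := le_lt_trans (leeDr _ S0) fin.
have := value_le_cost alpha0 rhoE cz cg zge0 subg sd0 (unit_increment_gaussian BM mw FS)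
  (measurable_from0 hy) (measurable_from0 hp) mw (increment_independent BM CS mw FS)
  (state_increment CS) zK gK (initial_state BM CS) Pfin dz ddz cH HK hjb Sfin.
by rewrite -cE EFinM lee_pmul2l ?lte_fin.
Qed.

(** The noise is measurable because the filtration of a weak solution consists of measurable sets;
    the moment bound yields finite state energy, and the quadratic growth of |grad z|^2 then yields
    finite control energy. *)
Lemma feedback_upper_bound (d : measure_display) (T : measurableType d) (P : probability T R)
    (F : R -> set (set T)) (w y : R -> T -> 'rV[R]_N) :
  weak_solution P F w sigma z x y ->
  acceptable P alpha (feedback z y) y /\ cost P alpha (feedback z y) y <= (z x)%:E.
Proof.
move=> [[FS FM _] BM CS]; have [rho rhoE] := exponential_law alpha0.
have mw t i : (0 <= t)%R -> measurable_fun setT (fun o => w t o 0%R i).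
  move=> t0 _ B mB; rewrite setTI; have [aw _ _ _] := BM.
  exact: (FM t t0 _ (aw i t B t0 mB)).
have [hp _ hy _ _] := CS.
have cE := cost_discounted alpha0 CS rhoE.
have Sfin := energy_discounted_lty alpha0 cz cg zge0 subg zK BM CS mw FS rhoE.
have pE (t : R) (o : T) i : from0 (feedback z y) t o 0%R i = (- 2^-1 * partial i z (from0 y t o))%R.
  by rewrite /from0 feedbackE.
have mY := measurable_from0 hy.
have K0 : (0 <= @growth_const R N alpha sigma)%R by exact: growth_const_ge0.
have Pfin : \int[discounted_measure rho P]_q (nsq (from0 (feedback z y) q.1 q.2))%:E < +oo.
  have g1 v : (0 <= gsq z v <= (16 + 8 * @growth_const R N alpha sigma) * (1 + nsq v))%R.
    rewrite gsq_ge0/=; apply: le_trans (gK v) _.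
    have := mulr_ge0 K0 (nsq_ge0 v); lra.
  have := @integral_quadratic_lty _ _ _ _
    (lebesgue_integral_fubini_product_measure1__canonical__probability_measure_Probability rho P)
    (discounted_measure_setT rho P) (state_at (from0 y)) mY Sfin (gsq z) (continuous_gsq cg) _ g1.
  apply: le_lt_trans; apply: ge0_le_integral => //.
  - by move=> q _; rewrite lee_fin nsq_ge0.
  - by apply/measurable_EFinP; apply: measurable_fun_row; [exact: continuous_nsq|exact: measurable_from0].
  - by apply/measurable_EFinP; apply: measurable_fun_row; [exact: continuous_gsq|exact: mY].
  move=> q _; rewrite lee_fin; apply: ler_sum => i _; rewrite pE.
  have := sqr_ge0 (partial i z (from0 y q.1 q.2)); rewrite /state_at; lra.
have H := cost_le_value alpha0 rhoE cz cg zge0 subg sd0 (unit_increment_gaussian BM mw FS)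
  mY (measurable_from0 hp) mw (increment_independent BM CS mw FS)
  (state_increment CS) pE zK gK (initial_state BM CS) Pfin dz ddz cH HK hjb Sfin
  (fun t _ => gradient_average_cvg cg BM CS t).
have {}H : cost P alpha (feedback z y) y <= (z x)%:E.
  by move: H; rewrite -cE EFinM lee_pmul2l ?lte_fin.
split=> //; split; first by rewrite (le_lt_trans H) ?ltry.
exact: (transversality alpha0 cz cg zge0 subg zK BM CS mw FS).
Qed.

End optimality.

Theorem mainTheorem4 (R : realType) (N : nat) (alpha sigma : R)
  (hN : (1 <= N)%N) (halpha : 0 < alpha) (hsigma : 0 < sigma)
  (z : 'rV[R]_N -> R)
  (hzC2 : is_C2 setT z)
  (hzconstr : constructed_by_balls alpha sigma z)
  (hzpos : forall x, 0 < z x)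
  (hzconvex : convex_function setT z)
  (hzeq : forall x, hjb_equation alpha sigma z x)
  (x : 'rV[R]_N)
  (* the optimally controlled system: a weak solution *)
  (d' : measure_display) (T' : measurableType d') (P' : probability T' R)
  (F' : R -> set (set T')) (w' ystar : R -> T' -> 'rV[R]_N)
  (hystar : weak_solution P' F' w' sigma z x ystar) :
  acceptable P' alpha (feedback z ystar) ystar /\
  forall (d : measure_display) (T : measurableType d) (P : probability T R)
    (w p y : R -> T -> 'rV[R]_N),
    measure_is_complete P ->
    brownian_motion P (completed_natural_filtration P w) w ->
    controlled_system P (completed_natural_filtration P w) w sigma x p y ->
    acceptable P alpha p y ->
    (cost P' alpha (feedback z ystar) ystar <= cost P alpha p y)%E.
Proof.
have [acc up] := feedback_upper_bound halpha hsigma hN hzC2 hzconstr hzpos hzconvex hzeq hystar.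
split=> // d T P w p y Pc BM CS [fin _]; apply: (le_trans up).
exact: (value_lower_bound halpha hsigma hN hzC2 hzconstr hzpos hzconvex hzeq Pc BM CS fin).
Qed.
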